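(* Consider the probability space $(L(\mathbb B_\infty),\mathrm{tr}_\infty)$ equipped with the 1-shifted inverse representation $\rho_1^{\mathrm{inv}}:\mathbb B_\infty\to\mathrm{Aut}(L(\mathbb B_\infty),\mathrm{tr}_\infty)$ given by $\rho_1^{\mathrm{inv}}(\tau):=\mathrm{Ad}\,L_{\mathrm{sh}(\mathrm{inv}(\tau))}$, and let $\rho(\tau):=\mathrm{Ad}\,L_\tau$. Then: (i) $\rho_1^{\mathrm{inv}}$ has the generating property. (ii) $L(\mathbb B_\infty)^{\rho_1^{\mathrm{inv}}(\mathbb B_\infty)}\simeq\mathbb C$. (iii) $L(\mathbb B_\infty)^{\rho_1^{\mathrm{inv}}(\mathbb B_{n+2,\infty})}=L(\mathbb B_{n+2})$ for all $n\ge0$. (iv) The map $$\beta(x):=\lim_{n\to\infty}\rho_1^{\mathrm{inv}}(\sigma_1\sigma_2\cdots\sigma_n)(x)=\lim_{n\to\infty}\rho(\sigma_2^{-1}\sigma_3^{-1}\cdots\sigma_n^{-1})(x)$$ (limits in the strong operator topology) is an endomorphism for $(L(\mathbb B_\infty),\mathrm{tr}_\infty)$ such that $\beta(L_\tau)=L_{\mathrm{sh}_1(\tau)}$ for $\tau\in\mathbb B_\infty$. (v) Each cell of the triangular tower of inclusions $$\begin{matrix} \mathbb C&\subset&L(\mathbb B_2)&\subset&L(\mathbb B_3)&\subset&L(\mathbb B_4)&\subset\cdots\subset&L(\mathbb B_\infty)\\ &&\cup&&\cup&&\cup&&\cup\\ &&\mathbb C&\subset&\beta(L(\mathbb B_2))&\subset&\beta(L(\mathbb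 B_3))&\subset\cdots\subset&\beta(L(\mathbb B_\infty))\\ &&&&\cup&&\cup&&\cup\\ &&&&\mathbb C&\subset&\beta^2(L(\mathbb B_2))&\subset\cdots\subset&\beta^2(L(\mathbb B_\infty))\\ &&&&&&\cup&&\cup\\ &&&&&&\vdots&&\vdots \end{matrix}$$ is a commuting square. (vi) The maps $\iota_n^{(\beta)}:=\beta^n|_{L(\mathbb B_2)}$, $n\in\mathbb N_0$, define a braidable, spreadable and full $\mathbb C$-independent random sequence $\iota^{(\beta)}$ from $(L(\mathbb B_2),\mathrm{tr}_2)$ to $(L(\mathbb B_\infty),\mathrm{tr}_\infty)$. In particular, $\beta$ is a full Bernoulli shift over $\mathbb C$ with generator $L(\mathbb B_2)$. (vii) The random sequence $\iota^{(\beta)}$ is not exchangeable.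
   Context: $\mathbb B_\infty$ is the infinite braid group, generated by $\sigma_1,\sigma_2,\dots$ subject to $\sigma_i\sigma_j\sigma_i=\sigma_j\sigma_i\sigma_j$ if $|i-j|=1$ and $\sigma_i\sigma_j=\sigma_j\sigma_i$ if $|i-j|>1$; $\mathbb B_n=\langle\sigma_1,\dots,\sigma_{n-1}\rangle$ and $\mathbb B_{n,\infty}=\langle\sigma_k\mid k\ge n\rangle$. The shift $\mathrm{sh}$ is the endomorphism of $\mathbb B_\infty$ with $\mathrm{sh}(\sigma_n)=\sigma_{n+1}$; $\mathrm{inv}$ is the automorphism of $\mathbb B_\infty$ with $\mathrm{inv}(\sigma_n)=\sigma_n^{-1}$; $\mathrm{sh}_1(\tau):=\sigma_1\,\mathrm{sh}(\tau)\,\sigma_1^{-1}$. $L(\mathbb B_\infty)$ is the group von Neumann algebra generated by the left regular representation $\sigma\mapsto L_\sigma$ on $\ell^2(\mathbb B_\infty)$, $\mathrm{tr}_\infty$ its canonical faithful normal tracial state ($\mathrm{tr}_\infty(L_\sigma)=1$ if $\sigma$ is the unit, $0$ otherwise), $L(\mathbb B_n)\subset L(\mathbb B_\infty)$ the von Neumann subalgebra generated by $L_\sigma$, $\sigma\in\mathbb B_n$, and $\mathrm{tr}_n$ the restriction of $\mathrm{tr}_\infty$ to it. $\mathrm{Ad}\,u=u\,\cdot\,u^*$. Superscripts denote fixed point algebras. A representation $\rho'$ of $\mathbb B_\infty$ in $\mathrm{Aut}(L(\mathbb B_\infty),\mathrm{tr}_\infty)$ (trace-preserving automorphisms) has the generating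 property if $L(\mathbb B_\infty)$ is generated as a von Neumann algebra by the algebras $L(\mathbb B_\infty)^{\rho'(\mathbb B_{n,\infty})}$, $n\in\mathbb N$. For a von Neumann subalgebra $\mathcal B$, $E_{\mathcal B}$ denotes the trace-preserving conditional expectation onto $\mathcal B$. A square of inclusions with top row $\mathcal N_2\subset\mathcal P$ and bottom row $\mathcal N\subset\mathcal N_1$ is a commuting square if $E_{\mathcal N_1}E_{\mathcal N_2}=E_{\mathcal N}$. Cells of the tower are the squares formed by two consecutive rows and two consecutive columns, and also those formed with the rightmost column. For a sequence $(\iota_n)_{n\in\mathbb N_0}$ of trace-preserving injective $*$-homomorphisms (random variables) from $(\mathcal A_0,\varphi_0)$ to $(\mathcal A,\varphi)$, and $\mathbf i:\{1,\dots,n\}\to\mathbb N_0$, put $\varphi_\iota[\mathbf i;\mathbf a]=\varphi(\iota_{\mathbf i(1)}(a_1)\cdots\iota_{\mathbf i(n)}(a_n))$. The sequence is exchangeable if $\varphi_\iota[\mathbf i;\cdot]=\varphi_\iota[\mathbf j;\cdot]$ whenever $\mathbf i=\pi\circ\mathbf j$ for a finite permutation $\pi$ of $\mathbb N_0$; spreadable if this holds whenever moreover $\pi$ is order preserving on the range of $\mathbf j$; braidable if there is a representation $\rho':\mathbb B_\infty\to\mathrm{Aut}(\mathcal A,\varphi)$ (state-preserving automorphisms) with $\iota_n=\rho'(\sigma_n\sigma_{n-1}\cdots\sigma_1)\iota_0$ for $n\ge1$ and $\rho'(\sigma_n)\iota_0=\iota_0$ for $n\ge2$; full $\mathbb C$-independent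 if $\varphi(xy)=\varphi(x)\varphi(y)$ for all $x\in\bigvee_{i\in I}\iota_i(\mathcal A_0)$, $y\in\bigvee_{j\in J}\iota_j(\mathcal A_0)$ and all disjoint $I,J\subset\mathbb N_0$ ($\bigvee$ = generated von Neumann algebra). An endomorphism $\beta$ (restricted to $\bigvee_n\beta^n(\mathcal B_0)$) is a full Bernoulli shift over $\mathbb C$ with generator $\mathcal B_0$ if $(\beta^n(\mathcal B_0))_{n\in\mathbb N_0}$ is full $\mathbb C$-independent in this sense. *)

(* Defs.v *)
From HB Require Import structures.
From mathcomp Require Import all_boot all_order all_algebra.
From mathcomp Require Import generic_quotient complex.
From mathcomp Require Import all_classical all_reals all_analysis.
From mathcomp Require Import ring lra.
From mathcomp.analysis.showcase Require summability.

Set Implicit Arguments.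
Unset Strict Implicit.
Unset Printing Implicit Defensive.

Import Order.TTheory GRing.Theory Num.Theory.
Import numFieldNormedType.Exports.

Local Open Scope classical_set_scope.
Local Open Scope ring_scope.
Local Open Scope complex_scope.

Local Notation normc := Normc.normc.

Lemma normc_ge0 (R : realType) (z : R[i]) : 0 <= normc z.
Proof. by case: z => a b; rewrite /Normc.normc sqrtr_ge0. Qed.

Section SquareSummable.
Variables (R : realType) (T : choiceType).
Implicit Types f g : T -> R[i].

Definition energy f : \bar R := (\esum_(i in [set: T]) (normc (f i) ^+ 2)%:E)%E.

Definition sqsum : {pred (T -> R[i])} := [pred f | `[< (energy f < +oo)%E >]].

Lemma energy_ge0 f : (0 <= energy f)%E.
Proof. by apply: esum_ge0 => i _; rewrite lee_fin sqr_ge0. Qed.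

Lemma esumZ_le (c : R) (a : T -> \bar R) : 0 <= c -> (forall i, 0 <= a i)%E ->
  (\esum_(i in [set: T]) (c%:E * a i) <= c%:E * \esum_(i in [set: T]) a i)%E.
Proof.
move=> c0 a0; apply: ge_ereal_sup => _ [A [finA _] <-].
rewrite -ge0_mule_fsumr//; apply: lee_wpmul2l; first by rewrite lee_fin.
by apply: esum_ge; exists A => //; split.
Qed.

Lemma energy_ge f i : ((normc (f i) ^+ 2)%:E <= energy f)%E.
Proof.
apply: esum_ge; exists [set i]; last by rewrite fsbig_set1.
by split => //; exact: finite_set1.
Qed.

Lemma energy0 : energy (0 : T -> R[i]) = 0%E.
Proof.
apply: esum1 => i _.
by rewrite [(0 : T -> R[i]) i]/(0 : R[i]) Normc.normc0 expr0n.
Qed.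

Lemma energyZ_le (a : R[i]) f :
  (energy (a *: f)%R <= (normc a ^+ 2)%:E * energy f)%E.
Proof.
apply: le_trans (esumZ_le _ _); last 2 first.
- exact: sqr_ge0.
- by move=> i; rewrite lee_fin sqr_ge0.
by apply: le_esum => i _; rewrite -EFinM lee_fin -exprMn -Normc.normcM.
Qed.

Lemma sqr_sum_le (s x y z : R) : 0 < s -> 0 <= x -> x <= y + z ->
  x ^+ 2 <= (1 + s) * y ^+ 2 + (1 + s^-1) * z ^+ 2.
Proof.
move=> s0 x0 xyz; apply: (@le_trans _ _ ((y + z) ^+ 2)).
  by rewrite lerXn2r// nnegrE// (le_trans x0).
have ss : s * s^-1 = 1 by rewrite divff// gt_eqF.
rewrite -subr_ge0.
suff -> : (1 + s) * y ^+ 2 + (1 + s^-1) * z ^+ 2 - (y + z) ^+ 2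
    = s * (y - s^-1 * z) ^+ 2 by rewrite mulr_ge0 ?sqr_ge0// ltW.
have -> : s * (y - s^-1 * z) ^+ 2 =
  s * y ^+ 2 - (s * s^-1) * 2 * y * z + (s * s^-1) * s^-1 * z ^+ 2 by ring.
by rewrite ss; ring.
Qed.

Lemma energyD_le (s : R) f g : 0 < s ->
  (energy (f + g)%R <= (1 + s)%:E * energy f + (1 + s^-1)%:E * energy g)%E.
Proof.
move=> s0; have s'0 : 0 < s^-1 by rewrite invr_gt0.
apply: (@le_trans _ _
  (\esum_(i in [set: T]) ((1 + s)%:E * (normc (f i) ^+ 2)%:E)
   + \esum_(i in [set: T]) ((1 + s^-1)%:E * (normc (g i) ^+ 2)%:E))%E).
  rewrite -esumD; last 2 first.
  - by move=> i _; rewrite -EFinM lee_fin mulr_ge0 ?sqr_ge0// addr_ge0// ltW.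
  - by move=> i _; rewrite -EFinM lee_fin mulr_ge0 ?sqr_ge0// addr_ge0// ltW.
  apply: le_esum => i _; rewrite -!EFinM -EFinD lee_fin.
  apply: sqr_sum_le => //; first exact: normc_ge0.
  exact: (@le_normcD R (f i) (g i)).
by apply: leeD; apply: esumZ_le => [|i]; rewrite ?lee_fin ?sqr_ge0// addr_ge0// ltW.
Qed.

Lemma sqsumP f : reflect (energy f < +oo)%E (f \in sqsum).
Proof. exact: asboolP. Qed.

Lemma sqsum_submod_closed : submod_closed sqsum.
Proof.
split; first by apply/sqsumP; rewrite energy0.
move=> a f g /sqsumP ff /sqsumP gf; apply/sqsumP.
apply: le_lt_trans (energyD_le _ _ ltr01) _.
rewrite lte_add_pinfty//; apply: lte_mul_pinfty => //; rewrite ?lee_fin ?addr_ge0 ?invr_ge0//.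
apply: le_lt_trans (energyZ_le _ _) _.
by apply: lte_mul_pinfty => //; rewrite lee_fin sqr_ge0.
Qed.

HB.instance Definition _ :=
  GRing.isSubmodClosed.Build R[i] (T -> R[i]) sqsum sqsum_submod_closed.

Record ell2 := Ell2 { ell2_val :> T -> R[i]; _ : ell2_val \in sqsum }.

HB.instance Definition _ := [isSub for ell2_val].
HB.instance Definition _ := gen_eqMixin ell2.
HB.instance Definition _ := gen_choiceMixin ell2.
HB.instance Definition _ := [SubChoice_isSubLmodule of ell2 by <:].


Implicit Types u v : ell2.

Lemma ell2_energyK u : (fine (energy u))%:E = energy u.
Proof.
by rewrite fineK// ge0_fin_numE ?energy_ge0//; apply/sqsumP; case: u.
Qed.

Definition ell2_norm u : R := Num.sqrt (fine (energy u)).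

Lemma ell2_norm_ge0 u : 0 <= ell2_norm u. Proof. exact: sqrtr_ge0. Qed.

Lemma ell2_normE u : (ell2_norm u ^+ 2)%:E = energy u.
Proof. by rewrite sqr_sqrtr ?ell2_energyK// fine_ge0 ?energy_ge0. Qed.

Lemma ell2_norm_eq0 u : ell2_norm u = 0 -> u = 0.
Proof.
move=> u0; have e0 : energy u = 0%E by rewrite -ell2_normE u0 expr0n.
apply: val_inj; apply/funext => i; apply: Normc.eq0_normc; apply/eqP.
by rewrite -sqrf_eq0 eq_le sqr_ge0 andbT -lee_fin (le_trans (energy_ge u i))// e0.
Qed.

Lemma ell2_normZ_le a u : ell2_norm (a *: u) <= normc a * ell2_norm u.
Proof.
have a0 := normc_ge0 a.
rewrite -(@ler_pXn2r _ 2)// ?nnegrE ?mulr_ge0 ?ell2_norm_ge0//.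
rewrite exprMn -lee_fin [leRHS]EFinM !ell2_normE; exact: energyZ_le.
Qed.

Lemma ell2_normZ a u : ell2_norm (a *: u) = normc a * ell2_norm u.
Proof.
apply/eqP; rewrite eq_le ell2_normZ_le/=.
have [->|a0] := eqVneq a 0; first by rewrite Normc.normc0 mul0r ell2_norm_ge0.
have na : 0 < normc a.
  rewrite lt_neqAle; apply/andP; split; last exact: normc_ge0.
  by apply: contra a0 => /eqP/esym/Normc.eq0_normc ->.
rewrite -ler_pdivlMl// -Normc.normcV.
by have := ell2_normZ_le a^-1 (a *: u); rewrite scalerK.
Qed.

Lemma ell2_normD u v : ell2_norm (u + v) <= ell2_norm u + ell2_norm v.
Proof.
have [/ell2_norm_eq0 ->|u0] := eqVneq (ell2_norm u) 0.
  by rewrite add0r lerDr ell2_norm_ge0.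
have [/ell2_norm_eq0 ->|v0] := eqVneq (ell2_norm v) 0.
  by rewrite addr0 lerDl ell2_norm_ge0.
have {}u0 : 0 < ell2_norm u by rewrite lt_def u0 ell2_norm_ge0.
have {}v0 : 0 < ell2_norm v by rewrite lt_def v0 ell2_norm_ge0.
rewrite -(@ler_pXn2r _ 2)// ?nnegrE ?addr_ge0 ?ell2_norm_ge0//.
have := energyD_le (ell2_val u) (ell2_val v) (divr_gt0 v0 u0).
rewrite -[X in energy X]/(ell2_val (u + v)) -!ell2_normE -!EFinM -EFinD lee_fin.
move=> /le_trans; apply; rewrite le_eqVlt; apply/orP; left; apply/eqP.
by field; rewrite !gt_eqF.
Qed.


Lemma ell2_normcD u v :
  (ell2_norm (u + v))%:C <= (ell2_norm u)%:C + (ell2_norm v)%:C :> R[i].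
Proof. by rewrite -rmorphD lecR ell2_normD. Qed.

Lemma ell2_normcZ (a : R[i]) u :
  (ell2_norm (a *: u))%:C = `|a| * (ell2_norm u)%:C :> R[i].
Proof. by rewrite ell2_normZ rmorphM. Qed.

Lemma ell2_normc_eq0 u : (ell2_norm u)%:C = 0 :> R[i] -> u = 0.
Proof. by move=> [] /ell2_norm_eq0. Qed.

HB.instance Definition _ := Lmodule_isNormed.Build R[i] ell2
  ell2_normcD ell2_normcZ ell2_normc_eq0.

(* The series is summed along the net of finite subsets of [T]. *)
Definition dot u v : R[i] := summability.sum (fun i => (u i * (v i)^* : R[i]^o)).

Lemma delta_sqsum (i : T) : (fun j => (j == i)%:R : R[i]) \in sqsum.
Proof.
apply/sqsumP; rewrite /energy (esumID [set i])//= ; last first.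
  by move=> j _; rewrite lee_fin sqr_ge0.
rewrite setTI esum_set1 ?lee_fin ?sqr_ge0// [X in (_ + X)%E]esum1 ?adde0 ?ltry//.
move=> j [_ /= /eqP/negbTE ->]; by rewrite Normc.normc0 expr0n.
Qed.

Definition delta (i : T) : ell2 := Ell2 (delta_sqsum i).

End SquareSummable.

Arguments delta {R T}.

Section BoundedOperators.
Variables (R : realType) (T : choiceType).
Local Notation H := (ell2 R T).

Definition is_bop : {pred (H -> H)} := [pred F | `[< linear F /\ continuous F >]].

Lemma is_bopP (F : H -> H) : reflect (linear F /\ continuous F) (F \in is_bop).
Proof. exact: asboolP. Qed.

Lemma is_bop_submod_closed : submod_closed is_bop.
Proof.
split.
  apply/is_bopP; split; last exact: cst_continuous.
  move=> a u v; rewrite [RHS]/(a *: (0 : H) + (0 : H)) scaler0.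
  exact/esym/(addr0 (0 : H)).
move=> a F G /is_bopP [lF cF] /is_bopP [lG cG]; apply/is_bopP; split.
  move=> b u v; rewrite /= ![(a *: F + G) _]/(a *: F _ + G _) lF lG.
  by rewrite !scalerDr !scalerA [b * a]mulrC addrACA.
by move=> u; exact: (cvgD (cvgZl_tmp (cF u)) (cG u)).
Qed.

HB.instance Definition _ :=
  GRing.isSubmodClosed.Build R[i] (H -> H) is_bop is_bop_submod_closed.

Record bop := Bop { bop_val :> H -> H; _ : bop_val \in is_bop }.

HB.instance Definition _ := [isSub for bop_val].
HB.instance Definition _ := gen_eqMixin bop.
HB.instance Definition _ := gen_choiceMixin bop.
HB.instance Definition _ := [SubChoice_isSubLmodule of bop by <:].

Implicit Types x y z : bop.

Lemma bop_linear x : linear x. Proof. by case: x => F /= /is_bopP []. Qed.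
Lemma bop_continuous x : continuous x.
Proof. by case: x => F /= /is_bopP []. Qed.

HB.instance Definition _ x := GRing.isLinear.Build R[i] H H _ x (bop_linear x).

Lemma bop1_subproof : idfun \in is_bop.
Proof. by apply/is_bopP; split=> // u; exact: cvg_id. Qed.

Lemma bopM_subproof x y : x \o y \in is_bop.
Proof.
apply/is_bopP; split; first by move=> a u v; rewrite /= !linearP.
by move=> u; apply: continuous_comp; exact: bop_continuous.
Qed.

Definition bop1 : bop := Bop bop1_subproof.
Definition bopM x y : bop := Bop (bopM_subproof x y).

Lemma bopMA : associative bopM. Proof. by move=> x y z; exact: val_inj. Qed.
Lemma bop1M : left_id bop1 bopM. Proof. by move=> x; exact: val_inj. Qed.
Lemma bopM1 : right_id bop1 bopM. Proof. by move=> x; exact: val_inj. Qed.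
Lemma bopMDl : left_distributive bopM +%R.
Proof. by move=> x y z; exact: val_inj. Qed.
Lemma bopMDr : right_distributive bopM +%R.
Proof.
by move=> x y z; apply: val_inj; apply/funext => u; exact: linearD.
Qed.

HB.instance Definition _ :=
  GRing.Zmodule_isPzRing.Build bop bopMA bop1M bopM1 bopMDl bopMDr.

(* By Riesz representation the adjoint always exists and is unique. *)
Definition adj x : bop :=
  xget (0 : bop) [set y : bop | forall u v : H, dot (x u) v = dot u (y v)].

Definition positive x := forall u : H, 0 <= dot (x u) u.

Definition sot_lim (x : bop^nat) y := forall u : H, (fun n => x n u) @ \oo --> y u.

Definition Ad u x := u * x * adj u.

Definition commutant (S : set bop) : set bop :=
  [set y | forall x, S x -> x * y = y * x].

(* A set of operators that equals its bicommutant is a unital subalgebra. *)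
Definition vonNeumann (M : set bop) :=
  (forall x, M x -> M (adj x)) /\ commutant (commutant M) = M.

Definition vN_gen (S : set bop) : set bop := smallest vonNeumann S.

Definition scalars : set bop := [set x : bop | exists c : R[i], x = c *: (1 : bop)].

End BoundedOperators.

Section GroupVonNeumannAlgebra.
Variables (R : realType) (G : groupType).
Local Notation H := (ell2 R G).
Local Notation op := (bop R G).
Implicit Types (s t : G) (A B M : set op) (phi : op -> op).

Definition lreg_fun s (u : G -> R[i]) : G -> R[i] := fun g => u (s^-1 * g)%g.

Lemma energy_lreg s (u : G -> R[i]) : energy (lreg_fun s u) = energy u.
Proof.
rewrite /energy (reindex_esum [set: G] [set: G] (fun g => s * g)%g).
  by apply: eq_esum => g _; rewrite /lreg_fun mulKg.
split => //; first by move=> x y _ _; exact: mulgI.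
by move=> g _; exists (s^-1 * g)%g => //; rewrite mulVKg.
Qed.

Lemma lreg_sqsum s (u : H) : lreg_fun s u \in @sqsum R G.
Proof. by apply/sqsumP; rewrite energy_lreg; apply/sqsumP; case: u. Qed.

Definition lreg_ell2 s (u : H) : H := Ell2 (lreg_sqsum s u).

Lemma lreg_linear s : linear (lreg_ell2 s).
Proof. by move=> a u v; exact: val_inj. Qed.

Lemma lreg_norm s (u : H) : `|lreg_ell2 s u| = `|u|.
Proof.
by rewrite [LHS]/(ell2_norm _)%:C [RHS]/(ell2_norm _)%:C /ell2_norm energy_lreg.
Qed.

Lemma lreg_is_bop s : lreg_ell2 s \in @is_bop R G.
Proof.
apply/is_bopP; split; first exact: lreg_linear.
move=> u; apply/(@cvgrPdist_lt _ _ _ (nbhs u)) => e e0; near=> v.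
have -> : lreg_ell2 s u - lreg_ell2 s v = lreg_ell2 s (u - v) by exact: val_inj.
rewrite lreg_norm; near: v.
by apply: (@cvgr_dist_lt _ _ _ (nbhs u)) => //; exact: cvg_id.
Unshelve. all: by end_near. Qed.

(* The left regular representation, [L_s delta_t = delta_(s t)]. *)
Definition lreg s : op := Bop (lreg_is_bop s).

Definition tr (x : op) : R[i] := dot (x (delta 1%g)) (delta 1%g).

(* [L(K)] as a von Neumann subalgebra of [L(G)]. *)
Definition gvN (K : set G) : set op := vN_gen [set lreg s | s in K].

(* An injective unital *-homomorphism from [A] to [B] that preserves the
   trace.  Between finite von Neumann algebras such a map is normal. *)
Record nc_random_variable A B phi : Prop := RandomVariable {
  rv_sub : forall x, A x -> B (phi x);
  rv_linear : forall (c : R[i]) x y, A x -> A y ->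
    phi (c *: x + y) = c *: phi x + phi y;
  rv_mul : forall x y, A x -> A y -> phi (x * y) = phi x * phi y;
  rv_one : phi 1 = 1;
  rv_adj : forall x, A x -> phi (adj x) = adj (phi x);
  rv_tr : forall x, A x -> tr (phi x) = tr x;
  rv_inj : forall x y, A x -> A y -> phi x = phi y -> x = y }.

Definition endomorphism M phi := nc_random_variable M M phi.

Definition automorphism M phi :=
  nc_random_variable M M phi /\ forall y, M y -> exists2 x, M x & phi x = y.

(* A representation of the group [K] in Aut([M], tr) *)
Definition representation (K : groupType) M (rho : K -> op -> op) :=
  (forall s : K, automorphism M (rho s)) /\
  (forall (s t : K) x, M x -> rho (s * t)%g x = rho s (rho t x)).

Definition fixed_points (K : groupType) M (rho : K -> op -> op) (S : set K) :
    set op :=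
  [set x | M x /\ forall s : K, S s -> rho s x = x].

(* The trace-preserving conditional expectation of [M] onto [B]. *)
Record cond_exp M B (E : op -> op) : Prop := CondExp {
  ce_sub : forall x, M x -> B (E x);
  ce_linear : forall (c : R[i]) x y, M x -> M y -> E (c *: x + y) = c *: E x + E y;
  ce_id : forall b, B b -> E b = b;
  ce_bimod : forall a x b, B a -> M x -> B b -> E (a * x * b) = a * E x * b;
  ce_pos : forall x, M x -> positive x -> positive (E x);
  ce_tr : forall x, M x -> tr (E x) = tr x }.

(* The square    N2 < P
                 N  < N1   of von Neumann subalgebras of [M]. *)
Definition commuting_square M (N2 P N N1 : set op) :=
  [/\ vonNeumann N2 /\ vonNeumann P, vonNeumann N /\ vonNeumann N1,
      [/\ N2 `<=` P, N `<=` N1, N `<=` N2, N1 `<=` P & P `<=` M] &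
      exists E1 E2 E : op -> op,
        [/\ cond_exp M N1 E1, cond_exp M N2 E2, cond_exp M N E &
            forall x, M x -> E1 (E2 x) = E x]].

Definition moment (iota : nat -> op -> op) n (i : 'I_n -> nat)
    (a : 'I_n -> op) : R[i] :=
  tr (\prod_(k < n) iota (i k) (a k)).

Definition finite_perm (p : nat -> nat) :=
  bijective p /\ exists N : nat, forall m, (N <= m)%N -> p m = m.

Definition exchangeable A (iota : nat -> op -> op) :=
  forall n (i j : 'I_n -> nat) (p : nat -> nat), finite_perm p ->
    (forall k, i k = p (j k)) ->
    forall a : 'I_n -> op, (forall k, A (a k)) ->
    moment iota i a = moment iota j a.

Definition spreadable A (iota : nat -> op -> op) :=
  forall n (i j : 'I_n -> nat) (p : nat -> nat), finite_perm p ->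
    (forall k l, (j k < j l)%N -> (p (j k) < p (j l))%N) ->
    (forall k, i k = p (j k)) ->
    forall a : 'I_n -> op, (forall k, A (a k)) ->
    moment iota i a = moment iota j a.

(* Full independence over the scalars of a sequence of subalgebras. *)
Definition full_independent (B : nat -> set op) :=
  forall I J : set nat, I `&` J = set0 ->
  forall x y, vN_gen (\bigcup_(i in I) B i) x ->
    vN_gen (\bigcup_(j in J) B j) y -> tr (x * y) = tr x * tr y.

Definition full_Bernoulli_shift (beta : op -> op) (B0 : set op) :=
  endomorphism (vN_gen (\bigcup_n (iter n beta @` B0))) beta /\
  full_independent (fun n => iter n beta @` B0).

End GroupVonNeumannAlgebra.

Section BraidGroup.

(* The letter [(k, false)] stands for sigma_(k+1), [(k, true)] for its
   inverse. *)
Definition braid_word := seq (nat * bool).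
Implicit Types u v w : braid_word.

Inductive braid_rel : braid_word -> braid_word -> Prop :=
| BraidCancel u v k b : braid_rel (u ++ [:: (k, b); (k, ~~ b)] ++ v) (u ++ v)
| BraidBraid u v k :
    braid_rel (u ++ [:: (k, false); (k.+1, false); (k, false)] ++ v)
              (u ++ [:: (k.+1, false); (k, false); (k.+1, false)] ++ v)
| BraidComm u v j k : (j.+1 < k)%N ->
    braid_rel (u ++ [:: (j, false); (k, false)] ++ v)
              (u ++ [:: (k, false); (j, false)] ++ v)
| BraidRefl u : braid_rel u u
| BraidSym u v : braid_rel u v -> braid_rel v u
| BraidTrans u v w : braid_rel u v -> braid_rel v w -> braid_rel u w.

Lemma braid_rel_ctx w1 w2 u v :
  braid_rel u v -> braid_rel (w1 ++ u ++ w2) (w1 ++ v ++ w2).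
Proof.
elim=> {u v}.
- by move=> u v k b; rewrite -!catA catA [w1 ++ u ++ v ++ w2]catA; constructor.
- move=> u v k; rewrite -!catA catA [w1 ++ u ++ _ ++ _ ++ _]catA.
  exact: BraidBraid.
- move=> u v j k jk; rewrite -!catA catA [w1 ++ u ++ _ ++ _ ++ _]catA.
  exact: BraidComm.
- by move=> u; exact: BraidRefl.
- by move=> u v _; exact: BraidSym.
- by move=> u v w _ uv _; exact: BraidTrans.
Qed.

Lemma braid_rel_cat u u' v v' :
  braid_rel u u' -> braid_rel v v' -> braid_rel (u ++ v) (u' ++ v').
Proof.
move=> uu' vv'; apply: (@BraidTrans _ (u' ++ v)).
  exact: (braid_rel_ctx [::] v uu').
by have := braid_rel_ctx u' [::] vv'; rewrite !cats0.
Qed.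

Definition word_inv w : braid_word := rev [seq (l.1, ~~ l.2) | l <- w].

Lemma word_invK : involutive word_inv.
Proof.
move=> w; rewrite /word_inv map_rev revK -map_comp -[RHS]map_id.
by apply: eq_map => -[k b] /=; rewrite negbK.
Qed.

Lemma word_invr w : braid_rel (w ++ word_inv w) [::].
Proof.
elim: w => [|[k b] w IHw]; first exact: BraidRefl.
have -> : ((k, b) :: w) ++ word_inv ((k, b) :: w) =
    [:: (k, b)] ++ (w ++ word_inv w) ++ [:: (k, ~~ b)].
  by rewrite /word_inv map_cons rev_cons -cats1 /= catA.
apply: BraidTrans (braid_rel_ctx _ _ IHw) _.
exact: (BraidCancel [::] [::] k b).
Qed.

Lemma word_invl w : braid_rel (word_inv w ++ w) [::].
Proof. by have := word_invr (word_inv w); rewrite word_invK. Qed.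

Lemma word_inv_rel u v : braid_rel u v -> braid_rel (word_inv u) (word_inv v).
Proof.
move=> uv; apply: (@BraidTrans _ (word_inv u ++ v ++ word_inv v)).
  rewrite -[X in braid_rel X _]cats0; apply: braid_rel_cat (BraidRefl _) _.
  exact/BraidSym/word_invr.
rewrite catA; apply: (@BraidTrans _ ((word_inv u ++ u) ++ word_inv v)).
  apply: braid_rel_cat (BraidRefl _); apply: braid_rel_cat (BraidRefl _) _.
  exact: BraidSym.
exact: (braid_rel_cat (word_invl u) (BraidRefl _)).
Qed.

Definition braid_relb : rel braid_word := fun u v => `[< braid_rel u v >].

Lemma braid_relbP u v : reflect (braid_rel u v) (braid_relb u v).
Proof. exact: asboolP. Qed.

Lemma braid_relb_refl : reflexive braid_relb.
Proof. by move=> u; apply/braid_relbP; exact: BraidRefl. Qed.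
Lemma braid_relb_sym : symmetric braid_relb.
Proof. by move=> u v; apply/braid_relbP/braid_relbP => /BraidSym. Qed.
Lemma braid_relb_trans : transitive braid_relb.
Proof.
by move=> v u w /braid_relbP uv /braid_relbP vw; apply/braid_relbP/(BraidTrans uv).
Qed.

Canonical braid_equiv :=
  EquivRel braid_relb braid_relb_refl braid_relb_sym braid_relb_trans.

Definition braid := {eq_quot braid_equiv}%qT.
HB.instance Definition _ := Choice.on braid.

Definition braid_of (w : braid_word) : braid := (\pi_({eq_quot braid_equiv}) w)%qT.
Definition braid_repr (x : braid) : braid_word := repr x.

Lemma braid_reprK : cancel braid_repr braid_of.
Proof. by move=> x; exact: reprK. Qed.

Lemma braid_ofP u v : braid_of u = braid_of v <-> braid_rel u v.
Proof.
split; first by move=> /eqquotP /braid_relbP.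
by move=> /braid_relbP uv; apply/eqquotP.
Qed.

Lemma repr_braid_of w : braid_rel (braid_repr (braid_of w)) w.
Proof. by apply/braid_ofP; exact: braid_reprK. Qed.

Definition braid_one : braid := braid_of [::].
Definition braid_inv x := braid_of (word_inv (braid_repr x)).
Definition braid_mul x y := braid_of (braid_repr x ++ braid_repr y).

Lemma braid_of_cat u v : braid_of (u ++ v) = braid_mul (braid_of u) (braid_of v).
Proof.
by apply/braid_ofP/BraidSym/braid_rel_cat; exact: repr_braid_of.
Qed.

Lemma braid_of_inv u : braid_of (word_inv u) = braid_inv (braid_of u).
Proof. by apply/braid_ofP/BraidSym/word_inv_rel; exact: repr_braid_of. Qed.

Lemma braid_mulA : associative braid_mul.
Proof.
move=> x y z; rewrite -(braid_reprK x) -(braid_reprK y) -(braid_reprK z).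
by rewrite -!braid_of_cat catA.
Qed.

Lemma braid_mul1 : left_id braid_one braid_mul.
Proof. by move=> x; rewrite -(braid_reprK x) -braid_of_cat. Qed.

Lemma braid_mulr1 : right_id braid_one braid_mul.
Proof. by move=> x; rewrite -(braid_reprK x) -braid_of_cat cats0. Qed.

Lemma braid_mulV : left_inverse braid_one braid_inv braid_mul.
Proof.
move=> x; rewrite -(braid_reprK x) -braid_of_inv -braid_of_cat.
exact/braid_ofP/word_invl.
Qed.

Lemma braid_mulrV : right_inverse braid_one braid_inv braid_mul.
Proof.
move=> x; rewrite -(braid_reprK x) -braid_of_inv -braid_of_cat.
exact/braid_ofP/word_invr.
Qed.

HB.instance Definition _ := isGroup.Build braid
  braid_mulA braid_mul1 braid_mulr1 braid_mulV braid_mulrV.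

(* sigma_n for n >= 1; sigma_0 is not a generator and is set to 1. *)
Definition sigma (n : nat) : braid :=
  if n is k.+1 then braid_of [:: (k, false)] else 1%g.

Lemma braid_ofM u v : braid_of (u ++ v) = (braid_of u * braid_of v)%g.
Proof. exact: braid_of_cat. Qed.

Lemma sigma_braid i : (0 < i)%N ->
  (sigma i * sigma i.+1 * sigma i = sigma i.+1 * sigma i * sigma i.+1)%g.
Proof.
case: i => // k _; rewrite /sigma -!braid_ofM.
exact/braid_ofP/(BraidBraid [::] [::]).
Qed.

Lemma sigma_comm i j : (0 < i)%N -> (i.+1 < j)%N ->
  (sigma i * sigma j = sigma j * sigma i)%g.
Proof.
case: i j => // i [//|j] _ ij; rewrite /sigma -!braid_ofM.
exact/braid_ofP/(BraidComm [::] [::]).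
Qed.

Section Lift.
Variables (K : groupType) (s : nat -> K).

Definition word_val w : K :=
  foldr (fun l x => (if l.2 then (s l.1)^-1 else s l.1) * x)%g 1%g w.

(* The homomorphism that maps sigma_(k+1) to [s k], if the [s k] satisfy the
   braid relations. *)
Definition braid_lift (x : braid) : K := word_val (braid_repr x).

Hypothesis s_braid : forall k, (s k * s k.+1 * s k = s k.+1 * s k * s k.+1)%g.
Hypothesis s_comm : forall j k, (j.+1 < k)%N -> (s j * s k = s k * s j)%g.

Lemma word_val_cat u v : word_val (u ++ v) = (word_val u * word_val v)%g.
Proof.
elim: u => [|l u IHu]; first by rewrite mul1g.
by rewrite cat_cons [LHS]/= -/(word_val (u ++ v)) IHu mulgA.
Qed.

Lemma word_val_rel u v : braid_rel u v -> word_val u = word_val v.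
Proof.
elim=> {u v} //.
- move=> u v k b; rewrite !word_val_cat; congr (_ * _)%g.
  by case: b => /=; rewrite mulg1 ?mulVg ?mulgV mul1g.
- move=> u v k; rewrite !word_val_cat; congr (_ * (_ * _))%g.
  by rewrite /= !mulg1 !mulgA s_braid.
- move=> u v j k jk; rewrite !word_val_cat; congr (_ * (_ * _))%g.
  by rewrite /= !mulg1 s_comm.
- by move=> u v w _ -> _ ->.
Qed.

Lemma braid_lift_of w : braid_lift (braid_of w) = word_val w.
Proof. exact/word_val_rel/repr_braid_of. Qed.

Lemma braid_liftM x y : braid_lift (x * y)%g = (braid_lift x * braid_lift y)%g.
Proof.
by rewrite -(braid_reprK x) -(braid_reprK y) -braid_ofM !braid_lift_of word_val_cat.
Qed.

Lemma braid_lift_sigma k : braid_lift (sigma k.+1) = s k.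
Proof. by rewrite braid_lift_of /= mulg1. Qed.

End Lift.

Definition sh : braid -> braid := braid_lift (fun k => sigma k.+2).

Lemma shM x y : sh (x * y)%g = (sh x * sh y)%g.
Proof.
by apply: braid_liftM => [k|j k jk]; [exact: sigma_braid|exact: sigma_comm].
Qed.

Lemma sh_sigma n : (0 < n)%N -> sh (sigma n) = sigma n.+1.
Proof.
case: n => // k _; apply: (braid_lift_sigma (s := fun k => sigma k.+2)).
  by move=> j; exact: sigma_braid.
by move=> i j ij; exact: sigma_comm.
Qed.

Definition inv : braid -> braid := braid_lift (fun k => (sigma k.+1)^-1)%g.

Let inv_braid k :
  ((sigma k.+1)^-1 * (sigma k.+2)^-1 * (sigma k.+1)^-1 =
   (sigma k.+2)^-1 * (sigma k.+1)^-1 * (sigma k.+2)^-1)%g.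
Proof. by rewrite -!invgM !mulgA sigma_braid. Qed.

Let inv_comm j k : (j.+1 < k)%N ->
  ((sigma j.+1)^-1 * (sigma k.+1)^-1 = (sigma k.+1)^-1 * (sigma j.+1)^-1)%g.
Proof. by move=> jk; rewrite -!invgM (@sigma_comm j.+1 k.+1). Qed.

Lemma invM x y : inv (x * y)%g = (inv x * inv y)%g.
Proof. exact: (braid_liftM inv_braid inv_comm). Qed.

Lemma inv_sigma n : inv (sigma n) = (sigma n)^-1%g.
Proof.
case: n => [|k]; last exact: (braid_lift_sigma inv_braid inv_comm).
by rewrite [LHS](braid_lift_of inv_braid inv_comm [::]) /= invg1.
Qed.

Definition sh1 (t : braid) : braid := (sigma 1 * sh t * (sigma 1)^-1)%g.

Definition subgroup_set (K : groupType) : set (set K) :=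
  [set S | S 1%g /\ forall x y, S x -> S y -> S (x * y^-1)%g].

Definition gen_group (K : groupType) (S : set K) : set K :=
  smallest (@subgroup_set K) S.

Definition Bn (n : nat) : set braid :=
  gen_group [set sigma k | k in [set k | (0 < k < n)%N]].

Definition Bn_oo (n : nat) : set braid :=
  gen_group [set sigma k | k in [set k | (0 < k)%N && (n <= k)%N]].

End BraidGroup.

Section BraidAlgebra.
Variable R : realType.
Local Notation op := (bop R braid).

Definition LB_oo : set op := gvN [set: braid].
Definition LB (n : nat) : set op := gvN (Bn n).

Definition rho (t : braid) : op -> op := Ad (lreg R t).
Definition rho1_inv (t : braid) : op -> op := Ad (lreg R (sh (inv t))).

Definition generating_property (r : braid -> op -> op) :=
  vN_gen (\bigcup_n fixed_points LB_oo r (Bn_oo n.+1)) = LB_oo.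

Definition braidable (A : set op) (iota : nat -> op -> op) :=
  exists r : braid -> op -> op,
    [/\ representation LB_oo r,
        forall n x, A x -> (0 < n)%N ->
          iota n x = r (\prod_(i < n) sigma (n - i))%g (iota 0%N x) &
        forall n x, A x -> (2 <= n)%N -> r (sigma n) (iota 0%N x) = iota 0%N x].

Definition beta (x : op) : op :=
  xget (0 : op)
    [set y : op | sot_lim (fun n => rho1_inv (\prod_(1 <= i < n.+1) sigma i)%g x) y].

(* Row [k], column [m] of the triangular tower, [k <= m]; the diagonal
   consists of copies of the scalars, and [tower_oo] is the last column. *)
Definition tower (k m : nat) : set op :=
  if m == k then @scalars R braid else iter k beta @` LB (m - k).+1.

Definition tower_oo (k : nat) : set op := iter k beta @` LB_oo.

Definition iota_beta (n : nat) : op -> op := iter n beta.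

End BraidAlgebra.

Arguments LB_oo R _ : clear implicits.
Arguments LB R n _ : clear implicits.
Arguments rho R t x : clear implicits, rename.
Arguments rho1_inv R t x : clear implicits, rename.
Arguments beta R x : clear implicits.
Arguments tower R k m _ : clear implicits.
Arguments tower_oo R k _ : clear implicits.
Arguments iota_beta R n x : clear implicits, rename.

(* Main.v *)
Require Import Defs.
From mathcomp Require Import all_boot all_order all_algebra complex finmap.
From mathcomp Require Import all_classical all_reals all_analysis.
From mathcomp Require Import zify ring lra.
From mathcomp.analysis.showcase Require summability.

(** Everything is governed by two facts: an operator of [L(G)] is determined by
    its coefficients, the square summable family [x delta_1] on [G], and the
    algebra [L(K)] of a subgroup [K] consists of the operators whose
    coefficients vanish off [K] ([gvNE]).  Each part of the theorem thereby
    becomes a statement about the braid group.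

    Operators.  [L(G)] is the commutant of the right translations.  For an
    injective endomorphism [f] of [G] and a subgroup [K], moving the coefficient
    at [k] in [K] to [f k] and dropping the others defines a bounded operator,
    because it acts separately on the cosets of [f K] ([block_op]).  With
    [f = id] this is the conditional expectation onto [L(K)], so subgroup
    algebras form commuting squares as soon as the subgroups intersect correctly
    ([commuting_square_gvN]).  With [K = G] it is a trace-preserving
    endomorphism ([implements_rv]), and it is the strong limit of inner
    automorphisms [Ad L_(c_n)] if the conjugations by [c_n] converge pointwise
    to [f] ([sot_lim_Ad]).  On every [B_n] the conjugations of the theorem are
    eventually equal to [sh1] ([sh1_conj]); hence [beta] is the endomorphism
    implemented by [sh1].

    Braids.  The one geometric tool is the deletion of a strand, defined on words
    and compatible with the braid relations ([delete_rel]).  Deleting the last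
    strand on both sides of [y sigma_(n+1) = sigma_(n+1) t] shows that [y] lies
    in [B_n] if [y] and [t] lie in [B_(n+1)] ([Bn_drop]).  Consequently
    the centraliser of [sigma_(n+1), sigma_(n+2), ...] is [B_n]
    ([Bn_centralizer]), and a braid off [B_n] has infinitely many conjugates
    under these generators ([infinite_orbit]).  The coefficients of a fixed point
    of the representation are constant on such orbits and square summable, hence
    they vanish off [B_n]: this gives the fixed point algebras.  The centraliser
    also gives that [sh1 x] lies in [B_(n+1)] only if [x] lies in [B_n], which is
    the intersection property behind the triangular tower.

    The random sequence.  The algebra [beta^n(L(B_2))] is generated by the half
    twist [star n = sh1^n(sigma_1)].  Conjugation by a suitable braid raises all
    indices from [k] on by one and fixes the others, so every order preserving
    change of indices is inner ([shift_star]): the sequence is spreadable.  If [x]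
    lies in the groups generated by two disjoint sets of the half twists, then for
    each [k] one of the sets misses [k], so that opening a gap at [k] or at
    [k+1] has the same effect on [x]; therefore [x] commutes with all
    [sigma_(k+2)] and is trivial ([star_group_disjoint]).  Independence follows,
    since [tr (x y)] is the sum of the products of the coefficients of [x] at [g]
    and of [y] at [g^-1].  Finally the commutator of
    [(star 0)^-1 (star 1) (star 0)] with [star 2] is trivial, but it is not
    after exchanging the indices 0 and 1, as one sees by deleting strands until
    only two are left; so the sequence is not exchangeable. *)

Set Implicit Arguments.
Unset Strict Implicit.
Unset Printing Implicit Defensive.

Local Open Scope classical_set_scope.

Section Braids.

Local Open Scope group_scope.

(** * Deleting a strand of a braid *)

Definition strand_pos1 (p k : nat) : nat :=
  if p == k then k.+1 else if p == k.+1 then k else p.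

(** Positions are counted from 0 and the letter [(k, b)] crosses the positions [k]
    and [k.+1].  A crossing that involves the deleted strand disappears; those
    to its right move down by one position. *)
Definition delete1 (p : nat) (l : nat * bool) : braid_word :=
  if (l.1.+1 < p)%N then [:: l]
  else if (p < l.1)%N then [:: (l.1.-1, l.2)] else [::].

Fixpoint strand_pos (p : nat) (w : braid_word) : nat :=
  if w is l :: w' then strand_pos (strand_pos1 p l.1) w' else p.

Fixpoint delete (p : nat) (w : braid_word) : braid_word :=
  if w is l :: w' then delete1 p l ++ delete (strand_pos1 p l.1) w' else [::].

Lemma strand_pos_cat p u v :
  strand_pos p (u ++ v) = strand_pos (strand_pos p u) v.
Proof. by elim: u p => //= l u IHu p; rewrite IHu. Qed.

Lemma delete_cat p u v :
  delete p (u ++ v) = delete p u ++ delete (strand_pos p u) v.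
Proof. by elim: u p => //= l u IHu p; rewrite IHu catA. Qed.

Lemma delete_rel_ctx x y u v :
  (forall p, strand_pos p x = strand_pos p y) ->
  (forall p, braid_rel (delete p x) (delete p y)) ->
  forall p, strand_pos p (u ++ x ++ v) = strand_pos p (u ++ y ++ v) /\
    braid_rel (delete p (u ++ x ++ v)) (delete p (u ++ y ++ v)).
Proof.
move=> hp hd p; rewrite !strand_pos_cat hp; split => //.
rewrite !delete_cat hp; apply: braid_rel_cat (BraidRefl _) _.
exact: braid_rel_cat (hd _) (BraidRefl _).
Qed.

Ltac split_tests := repeat (case: ifP => /=; try lia).

(** Isotopic braids remain isotopic when a strand is removed.  The position of
    the deleted strand changes along a word, so the end position has to be
    carried through the induction. *)
Lemma delete_rel u v : braid_rel u v ->
  forall p, strand_pos p u = strand_pos p v /\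
    braid_rel (delete p u) (delete p v).
Proof.
elim=> {u v}.
- move=> u v k b p.
  have := @delete_rel_ctx [:: (k, b); (k, ~~ b)] [::] u v; apply=> {}p.
    by rewrite /= /strand_pos1; split_tests.
  rewrite /= /delete1 /strand_pos1 /=; split_tests; move=> *; try exact: BraidRefl.
  + exact: (BraidCancel [::] [::]).
  + exact: (BraidCancel [::] [::]).
- move=> u v k p; apply: delete_rel_ctx => {}p.
    by rewrite /= /strand_pos1; split_tests.
  rewrite /= /delete1 /strand_pos1 /=; split_tests; move=> *.
  all: try exact: (BraidBraid [::] [::]).
  all: try exact: BraidRefl.
  have -> : k = k.-1.+1 by lia.
  exact: (BraidBraid [::] [::] k.-1).
- move=> u v j k jk p; apply: delete_rel_ctx => {}p.
    by rewrite /= /strand_pos1; split_tests.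
  rewrite /= /delete1 /strand_pos1 /=; split_tests; move=> *.
  all: try exact: BraidRefl.
  all: try (apply: (BraidComm [::] [::]); lia).
- by move=> u p; split => //; exact: BraidRefl.
- by move=> u v _ IH p; have [-> h] := IH p; split => //; exact: BraidSym.
- move=> u v w _ IH1 _ IH2 p; have [-> h1] := IH1 p; have [-> h2] := IH2 p.
  by split => //; exact: BraidTrans h1 h2.
Qed.

Lemma delete_id N p w : all (fun l => l.1.+1 < N)%N w -> (N <= p)%N ->
  delete p w = w /\ strand_pos p w = p.
Proof.
elim: w => //= l w IH /andP[lN wN] Np.
have -> : strand_pos1 p l.1 = p by rewrite /strand_pos1; split_tests.
have [-> ->] := IH wN Np; split => //.
by rewrite /delete1 (leq_trans lN Np).
Qed.

Lemma delete_all N p w : all (fun l => l.1.+1 < N.+1)%N w -> (p <= N)%N ->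
  all (fun l => l.1.+1 < N)%N (delete p w) /\ (strand_pos p w <= N)%N.
Proof.
elim: w p => //= l w IH p /andP[lN wN] pN.
have qN : (strand_pos1 p l.1 <= N)%N by rewrite /strand_pos1; split_tests.
have [dN sN] := IH _ wN qN; split => //.
rewrite all_cat dN andbT /delete1.
by case: ltnP => /=; [lia|]; case: ltnP => /=; lia.
Qed.

(** * Generated subgroups and the filtration by the number of strands *)

Section GeneratedSubgroup.
Variables (K : groupType) (S : set K).

Lemma gen_group_sub : S `<=` gen_group S.
Proof. exact: sub_gen_smallest. Qed.

Lemma gen_group1 : gen_group S 1.
Proof. by move=> A [[A1 _] _]. Qed.

Lemma gen_group_divg x y : gen_group S x -> gen_group S y -> gen_group S (x * y^-1).
Proof. by move=> xS yS A hA; apply: hA.1.2; [exact: xS|exact: yS]. Qed.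

Lemma gen_groupV x : gen_group S x -> gen_group S x^-1.
Proof.
by move=> xS; rewrite -[x^-1]mul1g; apply: gen_group_divg => //; exact: gen_group1.
Qed.

Lemma gen_groupM x y : gen_group S x -> gen_group S y -> gen_group S (x * y).
Proof.
by move=> xS yS; rewrite -[y]invgK; apply: gen_group_divg => //; exact: gen_groupV.
Qed.

Lemma gen_group_min (A : set K) : subgroup_set A -> S `<=` A -> gen_group S `<=` A.
Proof. by move=> gA SA; exact: smallest_sub. Qed.

Lemma gen_group_subgroup : subgroup_set (gen_group S).
Proof. by split; [exact: gen_group1|exact: gen_group_divg]. Qed.

End GeneratedSubgroup.

Lemma homV (K L : groupType) (h : K -> L) : h 1 = 1 ->
  (forall x y, h (x * y) = h x * h y) -> forall x, h x^-1 = (h x)^-1.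
Proof. by move=> h1 hM x; apply: (mulgI (h x)); rewrite -hM !mulgV h1. Qed.

Lemma gen_group_hom (K L : groupType) (f : K -> L) (S : set K) (A : set L) :
  f 1 = 1 -> (forall x y, f (x * y) = f x * f y) -> subgroup_set A ->
  (forall x, S x -> A (f x)) -> forall x, gen_group S x -> A (f x).
Proof.
move=> f1 fM [A1 AM] SA; apply: gen_group_min => //; split; first by rewrite /= f1.
by move=> x y Ax Ay; rewrite fM (homV f1 fM); exact: AM.
Qed.

Lemma eq_gen_group_hom (K L : groupType) (f g : K -> L) (S : set K) :
  f 1 = 1 -> (forall x y, f (x * y) = f x * f y) ->
  g 1 = 1 -> (forall x y, g (x * y) = g x * g y) ->
  (forall x, S x -> f x = g x) -> forall x, gen_group S x -> f x = g x.
Proof.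
move=> f1 fM g1 gM fg.
apply: (@gen_group_min _ _ [set x | f x = g x]) => //.
split=> [|x y /= xfg yfg]; first by rewrite /= f1 g1.
by rewrite fM gM (homV f1 fM) (homV g1 gM) xfg yfg.
Qed.

Lemma braid_ofV w : braid_of (word_inv w) = (braid_of w)^-1.
Proof. exact: braid_of_inv. Qed.

Lemma braid_of1 l : braid_of [:: l] = (if l.2 then (sigma l.1.+1)^-1 else sigma l.1.+1).
Proof. by case: l => k [] //=; rewrite -braid_ofV. Qed.

Lemma braid_ind (P : braid -> Prop) : P 1 ->
  (forall k x, P x -> P (sigma k.+1 * x)) ->
  (forall k x, P x -> P ((sigma k.+1)^-1 * x)) -> forall x, P x.
Proof.
move=> P1 Ps PV x; rewrite -(braid_reprK x).
elim: (braid_repr x) => // l w IH; rewrite -cat1s braid_ofM braid_of1.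
by case: l.2; [exact: PV|exact: Ps].
Qed.

Lemma Bn_braid_of n w : all (fun l => l.1.+1 < n)%N w -> Bn n (braid_of w).
Proof.
elim: w => [_|l w IH /= /andP[ln wn]]; first exact: gen_group1.
rewrite -cat1s braid_ofM braid_of1; apply: gen_groupM (IH wn).
have h : Bn n (sigma l.1.+1) by apply: gen_group_sub; exists l.1.+1.
by case: l.2 => //; exact: gen_groupV.
Qed.

Lemma BnP n x : Bn n x -> exists2 w, all (fun l => l.1.+1 < n)%N w & x = braid_of w.
Proof.
move: x; apply: gen_group_min; last first.
  by move=> _ [[|k] //= kn <-]; exists [:: (k, false)] => //=; rewrite kn.
split; first by exists [::].
move=> _ _ [u un ->] [v vn ->]; exists (u ++ word_inv v).
  rewrite all_cat un /= /word_inv all_rev all_map.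
  by apply: sub_all vn => -[].
by rewrite braid_ofM braid_ofV.
Qed.

Lemma Bn_sigma n k : (0 < k < n)%N -> Bn n (sigma k).
Proof. by move=> kn; apply: gen_group_sub; exists k. Qed.

Lemma Bn_mono m n : (m <= n)%N -> Bn m `<=` Bn n.
Proof.
move=> mn x /BnP[w wm ->]; apply: Bn_braid_of.
by apply: sub_all wm => l lm; exact: leq_trans lm mn.
Qed.

Lemma Bn_exists x : exists n, Bn n x.
Proof.
elim/braid_ind: x => [|k x [n xn]|k x [n xn]]; first by exists 0%N; exact: gen_group1.
  exists (maxn k.+2 n); apply: gen_groupM; last by apply: Bn_mono xn; lia.
  by apply: Bn_sigma; lia.
exists (maxn k.+2 n); apply: gen_groupM; last by apply: Bn_mono xn; lia.
by apply: gen_groupV; apply: Bn_sigma; lia.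
Qed.

Lemma Bn1 x : Bn 1 x -> x = 1.
Proof. by move=> /BnP[[|l w]] //= _ ->. Qed.

Lemma Bn_sigma_comm n k x : Bn n x -> (n < k)%N -> x * sigma k = sigma k * x.
Proof.
move=> xn nk; apply: (@gen_group_min _ _ [set x | x * sigma k = sigma k * x]) x xn.
  split=> [|x y /= hx hy]; first by rewrite /= mulg1 mul1g.
  have hV : y^-1 * sigma k = sigma k * y^-1.
    by apply: (mulgI y); rewrite !mulgA mulgV mul1g hy -mulgA mulgV mulg1.
  by rewrite -mulgA hV mulgA hx mulgA.
by move=> _ [j /= jn <-]; apply: sigma_comm; lia.
Qed.

(** Deleting the strand that starts at position [n.+1] turns [y sigma_(n+1)] into
    [y].  In [sigma_(n+1) t] it first moves to position [n] and then is one of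
    the strands of [t], so that a braid on one strand less is left. *)
Lemma Bn_drop n y t : Bn n.+1 y -> Bn n.+1 t ->
  y * sigma n.+1 = sigma n.+1 * t -> Bn n y.
Proof.
move=> /BnP[u un ->] /BnP[v vn ->]; rewrite /sigma -!braid_ofM => /braid_ofP.
move=> /delete_rel /(_ n.+1)[_]; rewrite !delete_cat.
have [-> ->] := delete_id un (leqnn _).
rewrite /= /delete1 /strand_pos1 /= eqxx; split_tests; rewrite cats0 => *.
have [wn _] := delete_all vn (leqnn n).
have -> : braid_of u = braid_of (delete n v) by exact/braid_ofP.
exact: Bn_braid_of.
Qed.

(** [Bn_drop] with [y] and [t] equal removes the strands above [n] one by one. *)
Lemma Bn_centralizer n x : (0 < n)%N ->
  (forall k, (n < k)%N -> x * sigma k = sigma k * x) -> Bn n x.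
Proof.
move=> n0 xk; have [m xm] := Bn_exists x.
elim: m xm => [|m IH] xm; first by apply: Bn_mono xm.
have [mn|nm] := leqP m.+1 n; first by apply: Bn_mono xm.
apply: IH; apply: (Bn_drop xm xm); exact: xk.
Qed.

(** * The shift *)

Lemma sh1g : sh 1 = 1.
Proof. by apply: (mulgI (sh 1)); rewrite -shM !mulg1. Qed.

Lemma inv1g : Defs.inv 1 = 1.
Proof. by apply: (mulgI (Defs.inv 1)); rewrite -invM !mulg1. Qed.

Lemma shV x : sh x^-1 = (sh x)^-1.
Proof. exact: (homV sh1g shM). Qed.

Lemma braid_invV x : Defs.inv x^-1 = (Defs.inv x)^-1.
Proof. exact: (homV inv1g invM). Qed.

Lemma sh1_1 : sh1 1 = 1.
Proof. by rewrite /sh1 sh1g mulg1 mulgV. Qed.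

Lemma sh1M x y : sh1 (x * y) = sh1 x * sh1 y.
Proof. by rewrite /sh1 shM !mulgA mulgVK. Qed.

Lemma sh1V x : sh1 x^-1 = (sh1 x)^-1.
Proof. exact: (homV sh1_1 sh1M). Qed.

Definition coxeter n : braid := \prod_(1 <= i < n.+1) sigma i.

Lemma coxeterS n : coxeter n.+1 = coxeter n * sigma n.+1.
Proof. by rewrite /coxeter big_nat_recr. Qed.

Lemma coxeter_Bn n : Bn n.+1 (coxeter n).
Proof.
elim: n => [|n IH]; first by rewrite /coxeter big_geq //; exact: gen_group1.
rewrite coxeterS; apply: gen_groupM; first by apply: Bn_mono IH.
by apply: Bn_sigma; lia.
Qed.

Lemma coxeter_sigma n k : (0 < k < n)%N ->
  coxeter n * sigma k = sigma k.+1 * coxeter n.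
Proof.
elim: n => [|n IH] kn; first by lia.
have [kn'|kn'] := ltnP k n.
  rewrite coxeterS -mulgA -sigma_comm; [|lia..].
  by rewrite mulgA IH ?mulgA //; lia.
have -> : k = n by lia.
case: n kn {IH kn'} => [|n] kn; first by lia.
rewrite !coxeterS -!mulgA [RHS]mulgA.
rewrite -(Bn_sigma_comm (@coxeter_Bn n)) // -!mulgA; congr (_ * _).
by rewrite !mulgA sigma_braid.
Qed.

(** On finitely many strands the shift is the restriction of an inner
    automorphism; this is why it is injective. *)
Lemma sh_coxeter n x : Bn n x -> coxeter n * x = sh x * coxeter n.
Proof.
move=> xn; suff -> : sh x = coxeter n * x * (coxeter n)^-1 by rewrite mulgVK.
apply: (@eq_gen_group_hom _ _ sh (fun x => coxeter n * x * (coxeter n)^-1)) xn.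
- exact: sh1g.
- exact: shM.
- by rewrite mulg1 mulgV.
- by move=> u v; rewrite !mulgA mulgVK.
- move=> _ [k /= kn <-]; rewrite coxeter_sigma // mulgK sh_sigma //; lia.
Qed.

Lemma sh_inj : injective sh.
Proof.
move=> x y xy; have [m xm] := Bn_exists x; have [n yn] := Bn_exists y.
have {}xm : Bn (maxn m n) x by apply: Bn_mono xm; lia.
have {}yn : Bn (maxn m n) y by apply: Bn_mono yn; lia.
by apply: (mulgI (coxeter (maxn m n))); rewrite !sh_coxeter // xy.
Qed.

Lemma sh1_inj : injective sh1.
Proof. by move=> x y /mulIg/mulgI/sh_inj. Qed.

(** * The partial shift as a limit of inner automorphisms *)

Lemma inv_coxeter_sigma n k : (0 < k < n)%N ->
  Defs.inv (coxeter n) * sigma k = sigma k.+1 * Defs.inv (coxeter n).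
Proof.
move=> kn; have := congr1 Defs.inv (coxeter_sigma kn).
rewrite !invM !inv_sigma => e; apply: (mulgI (sigma k.+1)^-1).
by apply: (mulIg (sigma k)^-1); rewrite mulKg mulgA mulgK -e.
Qed.

(** The mirror image of [sh_coxeter] under [inv].  For [0 < n] the factor
    [sigma 1] cancels, and the conjugating braid is
    [sigma_2^-1 ... sigma_n^-1]. *)
Lemma sh1_conj n x : Bn n x ->
  sh1 x = (sigma 1 * Defs.inv (coxeter n)) * x * (sigma 1 * Defs.inv (coxeter n))^-1.
Proof.
move=> xn; rewrite /sh1 invgM !mulgA; congr (_ * _).
rewrite -!mulgA; congr (_ * _); rewrite mulgA.
apply: (@eq_gen_group_hom _ _ sh
  (fun x => Defs.inv (coxeter n) * x * (Defs.inv (coxeter n))^-1)) xn.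
- exact: sh1g.
- exact: shM.
- by rewrite mulg1 mulgV.
- by move=> u v; rewrite !mulgA mulgVK.
- move=> _ [k /= kn <-]; rewrite inv_coxeter_sigma // mulgK sh_sigma //; lia.
Qed.

Lemma sh_inv_coxeter n : sh (Defs.inv (coxeter n)) = sigma 1 * Defs.inv (coxeter n.+1).
Proof.
elim: n => [|n IH].
  by rewrite coxeterS /coxeter big_geq // mul1g inv1g sh1g inv_sigma mulgV.
rewrite coxeterS invM shM IH inv_sigma shV sh_sigma // [coxeter n.+2]coxeterS.
by rewrite invM inv_sigma mulgA.
Qed.

Lemma prod_sigmaV n :
  \prod_(2 <= i < n.+2) (sigma i)^-1 = sigma 1 * Defs.inv (coxeter n.+1).
Proof.
elim: n => [|n IH].
  by rewrite big_geq // coxeterS /coxeter big_geq // mul1g inv_sigma mulgV.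
by rewrite big_nat_recr //= IH [coxeter n.+2]coxeterS invM inv_sigma mulgA.
Qed.

Lemma sh1_sigma k : (1 < k)%N -> sh1 (sigma k) = sigma k.+1.
Proof.
by move=> k1; rewrite /sh1 sh_sigma; [rewrite sigma_comm // mulgK|lia].
Qed.

Lemma sh1_Bn n x : (0 < n)%N -> Bn n x -> Bn n.+1 (sh1 x).
Proof.
move=> n0 xn; apply: (gen_group_hom sh1_1 sh1M _ _ xn).
  exact: gen_group_subgroup.
move=> _ [k /= kn <-]; rewrite /sh1 sh_sigma //; last by lia.
apply: gen_groupM; first apply: gen_groupM.
- by apply: Bn_sigma; lia.
- by apply: Bn_sigma; lia.
- by apply: gen_groupV; apply: Bn_sigma; lia.
Qed.

(** [sh x] commutes with the generators from [sigma_(n+2)] on, hence [x] with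
    those from [sigma_(n+1)] on, and [Bn_centralizer] applies. *)
Lemma sh1_Bn_inv n x : (0 < n)%N -> Bn n.+1 (sh1 x) -> Bn n x.
Proof.
move=> n0 xn; apply: Bn_centralizer => // k nk; apply: sh_inj.
rewrite !shM sh_sigma; last by lia.
apply: (@Bn_sigma_comm n.+1); last by lia.
have -> : sh x = (sigma 1)^-1 * sh1 x * sigma 1 by rewrite /sh1 !mulgA mulVg mul1g mulgVK.
have s1 : Bn n.+1 (sigma 1) by apply: Bn_sigma; lia.
by apply: gen_groupM => //; apply: gen_groupM => //; exact: gen_groupV.
Qed.

(** * Infinite conjugation orbits *)

Fixpoint climb N j : braid := if j is j'.+1 then sigma (N + j') * climb N j' else 1.

Lemma climb_Bn_oo N j : (0 < N)%N -> Bn_oo N (climb N j).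
Proof.
move=> N0; elim: j => [|j IH] /=; first exact: gen_group1.
apply: gen_groupM => //; apply: gen_group_sub; exists (N + j)%N => //=; lia.
Qed.

(** If conjugation by the next generator did not lead to a new level, then
    [Bn_drop] would put the previous conjugate on a lower level as well. *)
Lemma climb_level N j x : Bn N.+1 x -> ~ Bn N x ->
  Bn (N.+1 + j) (climb N.+1 j * x * (climb N.+1 j)^-1) /\
  ~ Bn (N + j) (climb N.+1 j * x * (climb N.+1 j)^-1).
Proof.
move=> xN xN'; elim: j => [|j [IH IH']]; first by rewrite invg1 mulg1 mul1g !addn0.
set y := climb _ j * _ * _ in IH IH'.
have -> : climb N.+1 j.+1 * x * (climb N.+1 j.+1)^-1 =
    sigma (N.+1 + j) * y * (sigma (N.+1 + j))^-1.
  by rewrite /= invgM /y !mulgA.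
split.
  have hs : Bn (N.+1 + j.+1) (sigma (N.+1 + j)) by apply: Bn_sigma; lia.
  apply: gen_groupM; last exact: gen_groupV.
  by apply: gen_groupM => //; apply: Bn_mono IH; lia.
rewrite addnS => h; apply: IH'.
set z := (z in Bn _ z) in h.
have zs : z * sigma (N + j).+1 = sigma (N + j).+1 * y by rewrite /z addSn mulgVK.
have zN : Bn (N + j) z by exact: Bn_drop zs.
suff -> : y = z by [].
apply: (mulgI (sigma (N + j).+1)); rewrite -zs.
by apply: Bn_sigma_comm zN _.
Qed.

(** The conjugates produced by [climb] lie on different levels of the
    filtration. *)
Lemma infinite_orbit n x : (0 < n)%N -> ~ Bn n x ->
  exists g : nat -> braid, (forall j, Bn_oo n.+1 (g j)) /\
    injective (fun j => g j * x * (g j)^-1).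
Proof.
move=> n0 xn; have [N0 xN0] := Bn_exists x.
have [N nN [xN xN']] : exists2 N, (n <= N)%N & Bn N.+1 x /\ ~ Bn N x.
  elim: N0 xN0 => [|N IH] xN; first by case: xn; exact: Bn_mono xN.
  have [/IH//|xN'] := pselect (Bn N x); exists N => //.
  by rewrite leqNgt; apply/negP => Nn; apply: xn; exact: Bn_mono xN.
exists (climb N.+1); split.
  move=> j; have := @climb_Bn_oo N.+1 j isT; apply: gen_group_min.
    exact: gen_group_subgroup.
  move=> _ [k /= kN <-]; apply: gen_group_sub; exists k => //=; lia.
suff lt_neq i j : (i < j)%N -> climb N.+1 i * x * (climb N.+1 i)^-1 <>
    climb N.+1 j * x * (climb N.+1 j)^-1.
  by move=> i j /= e; case: (ltngtP i j) => // /lt_neq; rewrite e.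
move=> ij e; have [_] := climb_level j xN xN'; apply; rewrite -e.
by have [h _] := climb_level i xN xN'; apply: Bn_mono h; lia.
Qed.

(** The operators [rho1_inv s] with [s] in [Bn_oo n] are thus the conjugations by
    all elements of [Bn_oo n.+1]. *)
Lemma Bn_oo_sh_inv n x : (0 < n)%N -> Bn_oo n.+1 x ->
  exists2 s, Bn_oo n s & x = sh (Defs.inv s).
Proof.
move=> n0; move: x; apply: gen_group_min; last first.
  move=> _ [[//|k] /= kn <-]; exists (sigma k)^-1.
    by apply: gen_groupV; apply: gen_group_sub; exists k => //=; lia.
  by rewrite braid_invV inv_sigma invgK sh_sigma //; lia.
split; first by exists 1; [exact: gen_group1|rewrite inv1g sh1g].
move=> _ _ [s sn ->] [t tn ->]; exists (s * t^-1); first exact: gen_group_divg.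
by rewrite invM shM braid_invV shV.
Qed.

(** * Star generators *)

(** The half twist of the strands 1 and [n + 2] along an arc that passes on one
    side of the strands between; these arcs form a star with centre 1. *)
Definition star n : braid := iter n sh1 (sigma 1).

Lemma starS n : star n.+1 = sh1 (star n). Proof. by []. Qed.

Lemma star0 : star 0 = sigma 1. Proof. by []. Qed.

Lemma star_Bn n : Bn n.+2 (star n).
Proof. by elim: n => [|n IH]; [exact: Bn_sigma|exact: sh1_Bn]. Qed.

Lemma conjM (K : groupType) (g h x : K) :
  (g * h) * x * (g * h)^-1 = g * (h * x * h^-1) * g^-1.
Proof. by rewrite invgM !mulgA. Qed.

Lemma conj_id (K : groupType) (g x : K) : g * x * g^-1 = x <-> x * g = g * x.
Proof.
split=> [e|<-]; last by rewrite mulgK.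
by apply: (mulIg g^-1); rewrite mulgK e.
Qed.

Lemma commVg (K : groupType) (g x : K) : x * g = g * x -> x * g^-1 = g^-1 * x.
Proof.
by move=> e; apply: (mulgI g); rewrite mulgA -e mulgK mulgA mulgV mul1g.
Qed.

Lemma conjg_comm (K : groupType) (g x s : K) : x * s = s * x -> s * g = g * s ->
  g^-1 * x * g * s = s * (g^-1 * x * g).
Proof.
move=> xs sg; rewrite -mulgA -sg !mulgA (commVg sg); congr (_ * _).
by rewrite -!mulgA xs.
Qed.

Lemma star_next n : (sigma n.+2)^-1 * star n * sigma n.+2 = star n.+1.
Proof.
elim: n => [|n IH].
  rewrite starS star0 /sh1 sh_sigma //; apply: (mulgI (sigma 2)); apply: (mulIg (sigma 1)).
  by rewrite !mulgA mulgV mul1g mulgVK sigma_braid.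
by rewrite [RHS]starS -[in RHS]IH !sh1M sh1V sh1_sigma.
Qed.

(** The arc of [star i] is disjoint from the segment that joins the strands [j]
    and [j + 1], unless one of them is the end [i + 2] of the arc. *)
Lemma star_sigma_comm i j : (1 < j)%N -> j <> i.+1 -> j <> i.+2 ->
  star i * sigma j = sigma j * star i.
Proof.
move=> j1 ji1 ji2; have [ij|ij] := ltnP i.+2 j.
  exact: (Bn_sigma_comm (@star_Bn i)).
elim: i j j1 ji1 ji2 ij => [|i IH] j j1 ji1 ji2 ij; first by lia.
have [j3|j2] := ltnP 2 j.
  have -> : sigma j = sh1 (sigma j.-1) by rewrite sh1_sigma ?prednK//; lia.
  rewrite starS -!sh1M IH //; lia.
have i0 : (0 < i)%N by lia.
(* Only [sigma 2] is not a shifted generator; there the index of the star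
   generator is lowered by [star_next] instead. *)
have {j1 j2 ji1 ji2 ij} -> : j = 2%N by lia.
case: i i0 {IH} => // i _; elim: i => [|i IH].
  rewrite -star_next -star_next star0.
  rewrite -!mulgA.
  have e1 : sigma 2 * ((sigma 3)^-1 * (sigma 2)^-1) =
      (sigma 3)^-1 * (sigma 2)^-1 * sigma 3.
    apply: (mulgI (sigma 2 * sigma 3)); apply: (mulIg (sigma 2 * sigma 3)).
    by rewrite !mulgA !mulgVK mulgK mulgV mul1g sigma_braid.
  transitivity (sigma 2 * ((sigma 3)^-1 * (sigma 2)^-1) * (sigma 1 * (sigma 2 * sigma 3))).
    rewrite e1 -!mulgA; congr (_ * (_ * _)).
    rewrite [RHS]mulgA -(@sigma_comm 1 3) // -!mulgA; congr (_ * _).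
    by rewrite !mulgA sigma_braid.
  by rewrite !mulgA.
have c : sigma 2 * sigma i.+4 = sigma i.+4 * sigma 2 by exact: sigma_comm.
by rewrite -star_next; exact: conjg_comm.
Qed.

(** * Partial shifts of the star generators *)

Fixpoint partial_shift k m : braid :=
  if m is m'.+1 then (sigma k.+2)^-1 * partial_shift k.+1 m' else 1.

(** Among the letters of [partial_shift k m], only [sigma_(i+2)] moves [star i],
    and the letters to its left fix [star i.+1]. *)
Lemma partial_shift_star k m i : (i < k + m)%N ->
  partial_shift k m * star i * (partial_shift k m)^-1 =
  star (if (i < k)%N then i else i.+1).
Proof.
elim: m k => [|m IH] k ikm.
  by rewrite /= mul1g invg1 mulg1 (_ : (i < k)%N); last lia.
rewrite conjM; rewrite IH; last by lia.
have [ik|ki] := ltnP i k.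
  rewrite ifT; last by lia.
  by apply/conj_id/commVg/star_sigma_comm; lia.
have [ik|ik] := ltnP i k.+1.
  have -> : i = k by lia.
  by rewrite invgK star_next.
by apply/conj_id/commVg/star_sigma_comm; lia.
Qed.

Lemma shift_star_from k e M : exists g, forall x, (x < M)%N ->
  g * star x * g^-1 = star (if (x < k)%N then x else (x + e)%N).
Proof.
elim: e => [|e [g IH]].
  by exists 1 => x _; rewrite mul1g invg1 mulg1 addn0 if_same.
exists (partial_shift k (M + e) * g) => x xM.
rewrite conjM IH // partial_shift_star; last by case: ifP => _; lia.
congr star; have [xk|xk] := ltnP x k; first by rewrite xk.
by rewrite ifF; lia.
Qed.

(** An increasing change of indices is a composition of partial shifts: the gaps
    are opened from the left, and [r] is the last index whose final place has
    been reached. *)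
Lemma shift_star (D : nat -> nat) M : {homo D : x y / (x <= y)%N} ->
  exists g, forall x, (x < M)%N -> g * star x * g^-1 = star (x + D x)%N.
Proof.
move=> Dmono.
suff H r : forall M, exists g, forall x, (x < M)%N ->
    g * star x * g^-1 = star (x + D (minn x r))%N.
  have [g hg] := H M M; exists g => x xM; rewrite hg //; congr (star (_ + D _)); lia.
elim: r => {M} [|r IH] M.
  have [g hg] := shift_star_from 0 (D 0%N) M.
  by exists g => x xM; rewrite hg // minn0.
have [g hg] := IH M.
have [h hh] := shift_star_from (r.+1 + D r) (D r.+1 - D r) (M + D r)%N.
exists (h * g) => x xM; have Drr := Dmono r r.+1 (leqnSn r).
have Dx := Dmono (minn x r) r (geq_minr _ _).
rewrite conjM hg // hh; last by lia.
congr star; have [xr|xr] := leqP x r.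
  have -> : minn x r.+1 = x by lia.
  by rewrite ifT //; have := Dmono x r xr; lia.
have -> : minn x r.+1 = r.+1 by lia.
by rewrite ifF; lia.
Qed.

(** * Disjoint sets of star generators *)

Definition star_group (I : set nat) : set braid :=
  gen_group [set star i | i in I].

Lemma star_group_bounded I x : star_group I x ->
  exists M, star_group [set i | I i /\ (i < M)%N] x.
Proof.
move: x; apply: gen_group_min; last first.
  by move=> _ [i Ii <-]; exists i.+1; apply: gen_group_sub; exists i => //=; split.
split; first by exists 0%N; exact: gen_group1.
move=> x y [M xM] [N yN]; exists (maxn M N).
have mono P : (P <= maxn M N)%N -> star_group [set i | I i /\ (i < P)%N] `<=`
    star_group [set i | I i /\ (i < maxn M N)%N].
  move=> PM; apply: gen_group_min; first exact: gen_group_subgroup.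
  move=> _ [i /= [Ii iP] <-]; apply: gen_group_sub; exists i => //=; split=> //; lia.
by apply: gen_group_divg; [apply: mono xM|apply: mono yN]; lia.
Qed.

(** Conjugation by [partial_shift k m] and by [partial_shift k.+1 m] treat all
    star generators but [star k] alike; so they agree on [x].  They differ by a
    conjugation with [sigma_(k+2)], and the second one fixes [x]. *)
Lemma star_group_miss I k x : ~ I k -> star_group I x ->
  (forall j, (k < j)%N -> x * sigma j.+2 = sigma j.+2 * x) ->
  x * sigma k.+2 = sigma k.+2 * x.
Proof.
move=> Ik /star_group_bounded[M xM] xj.
have fix_x : partial_shift k.+1 M * x * (partial_shift k.+1 M)^-1 = x.
  have : forall j, (k.+1 <= j)%N -> x * partial_shift j M = partial_shift j M * x.
    elim: {xM} M => [|M IH] j kj /=; first by rewrite mulg1 mul1g.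
    by rewrite mulgA commVg ?xj // -mulgA IH ?mulgA //; lia.
  by move=> /(_ k.+1 (leqnn _)) e; apply/conj_id.
rewrite -{}fix_x; move: x xM {xj}.
pose c x := partial_shift k.+1 M * x * (partial_shift k.+1 M)^-1.
suff H : star_group [set i | I i /\ (i < M)%N] `<=`
    [set x | (sigma k.+2)^-1 * c x * sigma k.+2 = c x].
  move=> x /H /=; rewrite -/(c x); move: (c x) => y e.
  by apply: (mulgI (sigma k.+2)^-1); rewrite !mulgA mulVg mul1g.
have cM x y : c (x * y) = c x * c y by rewrite /c !mulgA mulgVK.
apply: (@eq_gen_group_hom _ _ (fun x => (sigma k.+2)^-1 * c x * sigma k.+2) c).
- by rewrite /c mulg1 mulgV mulg1 mulVg.
- by move=> x y; rewrite cM !mulgA mulgK.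
- by rewrite /c mulg1 mulgV.
- exact: cM.
- move=> _ [i /= [Ii iM] <-]; rewrite /c partial_shift_star; last by lia.
  have ik : i <> k by move=> ik; apply: Ik; rewrite -ik.
  rewrite -mulgA (star_sigma_comm (j := k.+2)) ?mulKg //; case: ifP; lia.
Qed.

(** Each index misses one of the two sets, so [star_group_miss] yields, by descent
    from an index beyond the strands of [x], that [x] commutes with
    [sigma_2, sigma_3, ...]; only the unit does. *)
Lemma star_group_disjoint I J x : I `&` J = set0 ->
  star_group I x -> star_group J x -> x = 1.
Proof.
move=> IJ xI xJ; apply: Bn1; apply: Bn_centralizer => // -[//|[//|k]] _.
have [N xN] := Bn_exists x.
have [d] : exists d, (N <= k + d)%N by exists N; lia.
elim: d k => [|d IH] k kd; first by apply: Bn_sigma_comm xN _; lia.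
have xj j : (k < j)%N -> x * sigma j.+2 = sigma j.+2 * x by move=> kj; apply: IH; lia.
have [Ik|/star_group_miss] := pselect (I k); last exact.
have [Jk|/star_group_miss] := pselect (J k); last exact.
by have : (I `&` J) k by []; rewrite IJ.
Qed.

(** * A relation that is not symmetric in the star generators *)

(** Invariance of the exponent sum, written without subtraction. *)
Lemma braid_rel_exponent u v : braid_rel u v ->
  (count (fun l => l.2) u + count (fun l => ~~ l.2) v =
   count (fun l => l.2) v + count (fun l => ~~ l.2) u)%N.
Proof.
elim=> {u v} [u v k []|u v k|u v j k jk|u|u v _ IH|u v w _ IH1 _ IH2] //=;
  rewrite ?count_cat /=; lia.
Qed.

Definition letter_val (l : nat * bool) : braid :=
  if l.2 then (star l.1)^-1 else star l.1.

(** The commutator of [(star 0)^-1 (star 1) (star 0)], which is [sigma 2], with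
    [star 2].  After the exchange of 0 and 1 the first entry becomes a half twist
    of the strands 2 and 3 along an arc around the strand 1, which cannot be
    separated from the arc of [star 2]. *)
Definition asym_word : seq (nat * bool) :=
  [:: (0, true); (1, false); (0, false); (2, false);
      (0, true); (1, true); (0, false); (2, true)]%N.

Definition swap01 (n : nat) : nat := if n is 0 then 1 else if n is 1 then 0 else n.

Lemma asym_word_val : \prod_(l <- asym_word) letter_val l = 1.
Proof.
rewrite !big_cons big_nil /letter_val /= mulg1.
have e : (star 0)^-1 * star 1 * star 0 = sigma 2.
  rewrite -star_next star0; apply: (mulgI (sigma 2 * sigma 1)).
  by rewrite !mulgA !mulgK mulgV mul1g sigma_braid.
have c := @star_sigma_comm 2 2 isT ltac:(by []) ltac:(by []).
have -> : (star 0)^-1 * (star 1 * (star 0 * (star 2 * ((star 0)^-1 *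
    ((star 1)^-1 * (star 0 * (star 2)^-1)))))) =
  ((star 0)^-1 * star 1 * star 0) * star 2 *
    ((star 0)^-1 * star 1 * star 0)^-1 * (star 2)^-1.
  move: (star 0) (star 1) (star 2) => x y z.
  by rewrite !invgM invgK -!mulgA.
by rewrite e -c mulgK mulgV.
Qed.

Definition star_word n : braid_word :=
  [seq (k, false) | k <- iota 0 n] ++ (n, false) :: rev [seq (k, true) | k <- iota 0 n].

Lemma sh_braid_of w : sh (braid_of w) = braid_of [seq (l.1.+1, l.2) | l <- w].
Proof.
elim: w => [|l w IH]; first exact: sh1g.
rewrite map_cons -cat1s -[in RHS]cat1s !braid_ofM shM IH !braid_of1.
by case: l.2; rewrite ?shV sh_sigma.
Qed.

Lemma sh1_braid_of w :
  sh1 (braid_of w) =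
  braid_of ((0, false) :: rcons [seq (l.1.+1, l.2) | l <- w] (0, true))%N.
Proof.
by rewrite /sh1 sh_braid_of -cats1 -cat1s !braid_ofM !braid_of1 mulgA.
Qed.

Lemma star_word1 : star 1 = braid_of (star_word 1).
Proof. by rewrite starS star0 [sigma 1]/(braid_of _) sh1_braid_of. Qed.

Lemma star_word2 : star 2 = braid_of (star_word 2).
Proof. by rewrite starS star_word1 sh1_braid_of. Qed.

Definition letter_word (l : nat * bool) : braid_word :=
  if l.2 then word_inv (star_word l.1) else star_word l.1.

Lemma letter_valE l : (l.1 < 3)%N -> letter_val l = braid_of (letter_word l).
Proof.
have h n : (n < 3)%N -> star n = braid_of (star_word n).
  by case: n => [|[|[|//]]] _; [|exact: star_word1|exact: star_word2].
by move=> /h e; rewrite /letter_val /letter_word e; case: l.2; rewrite ?braid_ofV.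
Qed.

Lemma prod_letter_val s : all (fun l => l.1 < 3)%N s ->
  \prod_(l <- s) letter_val l = braid_of (flatten [seq letter_word l | l <- s]).
Proof.
elim: s => [_|l s IH /= /andP[l3 s3]]; first by rewrite big_nil.
by rewrite big_cons IH // braid_ofM letter_valE.
Qed.

(** Two of the four strands remain after the deletions, and the exponent sum is
    not zero. *)
Lemma asym_word_swap_val :
  \prod_(l <- [seq (swap01 l.1, l.2) | l <- asym_word]) letter_val l <> 1.
Proof.
rewrite prod_letter_val //.
set w := flatten _ => /braid_ofP /delete_rel/(_ 0%N)[_] /delete_rel/(_ 0%N)[_].
by move=> /braid_rel_exponent; vm_compute.
Qed.

End Braids.

Import Order.TTheory GRing.Theory Num.Theory.
Import numFieldNormedType.Exports.

Local Open Scope ring_scope.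
Local Open Scope complex_scope.

Local Notation normc := Normc.normc.
Existing Instance summability.totally_filter.

(** * Complex numbers *)

Lemma normcR (R : realType) (z : R[i]) : `|z| = (normc z)%:C.
Proof. by []. Qed.

Lemma mulC_conj (R : realType) (z : R[i]) : z * z^* = (normc z ^+ 2)%:C.
Proof. by rewrite -sqr_normc normcR rmorphXn. Qed.

Lemma conjR (R : realType) (r : R) : (r%:C : R[i])^*%R = r%:C.
Proof. exact: conjc_real. Qed.

Lemma complex_gt0P (R : realType) (e : R[i]) : 0 < e ->
  exists2 r : R, 0 < r & e = r%:C.
Proof.
by case: e => a b; rewrite ltcE /= => /andP[/eqP b0 a0]; exists a; rewrite // b0.
Qed.

Lemma normcD_le (R : realType) (z w : R[i]) : normc (z + w) <= normc z + normc w.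
Proof. exact: (@le_normcD R z w). Qed.

Lemma normcB_le (R : realType) (z w : R[i]) : normc (z - w) <= normc z + normc w.
Proof. by rewrite -[normc w](@normcN R w); exact: normcD_le. Qed.

(** * Square summable families *)

Section SquareSummable.
Variables (R : realType) (T : choiceType).
Local Notation H := (ell2 R T).
Local Notation N := (@ell2_norm R T).
Implicit Types (u v w : H) (i : T) (A B : set T).

Lemma ell2P u v : (forall i, u i = v i) -> u = v.
Proof. by move=> uv; apply: val_inj; apply/funext. Qed.

Lemma ell2D u v i : (u + v) i = u i + v i. Proof. by []. Qed.
Lemma ell2Z a u i : (a *: u) i = a * u i. Proof. by []. Qed.
Lemma ell2B u v i : (u - v) i = u i - v i. Proof. by []. Qed.
Lemma ell20 i : (0 : H) i = 0. Proof. by []. Qed.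

Lemma deltaE i j : (delta i : H) j = (j == i)%:R. Proof. by []. Qed.

Lemma ell2_sum I (s : seq I) (f : I -> H) i : (\sum_(k <- s) f k) i = \sum_(k <- s) f k i.
Proof. by elim/big_rec2: _ => // k x y _ <-. Qed.

Lemma ell2_norm_normr u : `|u| = (N u)%:C. Proof. by []. Qed.

Lemma ell2_norm0 : N 0 = 0.
Proof. by have := ell2_normZ 0 (0 : H); rewrite scale0r Normc.normc0 mul0r. Qed.

Lemma ell2_normN u : N (- u) = N u.
Proof.
rewrite -scaleN1r ell2_normZ -[X in normc X]/(- (1 : Rcomplex R)).
by rewrite normcN Normc.normc1 mul1r.
Qed.

Lemma ell2_distC u v : N (u - v) = N (v - u).
Proof. by rewrite -ell2_normN opprB. Qed.

Lemma le_ell2_norm (u : H) (S : choiceType) (v : ell2 R S) (c : R) : 0 <= c ->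
  (energy u <= (c ^+ 2)%:E * energy v)%E -> N u <= c * ell2_norm v.
Proof.
move=> c0; rewrite -!ell2_normE -EFinM lee_fin -exprMn.
by rewrite ler_pXn2r // nnegrE ?mulr_ge0 ?ell2_norm_ge0.
Qed.

(** * Restriction to a set of coordinates *)

Definition coord_proj_fun A (u : T -> R[i]) i := if `[< A i >] then u i else 0.

Lemma energy_coord_proj A (u : T -> R[i]) :
  energy (coord_proj_fun A u) = (\esum_(i in A) (normc (u i) ^+ 2)%:E)%E.
Proof.
rewrite [RHS]esum_mkcond; apply: eq_esum => i _; rewrite /coord_proj_fun.
case: asboolP => Ai; first by rewrite mem_set.
by rewrite memNset // Normc.normc0 expr0n.
Qed.

Lemma energy_split A (u : T -> R[i]) :
  (energy u = energy (coord_proj_fun A u) + energy (coord_proj_fun (~` A) u))%E.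
Proof.
rewrite !energy_coord_proj /energy (esumID A) ?setTI // => i _.
by rewrite lee_fin sqr_ge0.
Qed.

Lemma coord_proj_sqsum A u : coord_proj_fun A u \in @sqsum R T.
Proof.
apply/sqsumP; apply: (@le_lt_trans _ _ (energy u)); last by apply/sqsumP; case: u.
by rewrite (energy_split A u) leeDl // energy_ge0.
Qed.

Definition coord_proj A u : H := Ell2 (coord_proj_sqsum A u).

Lemma coord_projE A u i : coord_proj A u i = if `[< A i >] then u i else 0.
Proof. by []. Qed.

Lemma coord_proj_linear A : linear (coord_proj A).
Proof.
move=> a u v; apply: ell2P => i; rewrite ell2D ell2Z !coord_projE.
by case: ifP => _ //; rewrite mulr0 addr0.
Qed.

Lemma ell2_norm_split A u : N u ^+ 2 = N (coord_proj A u) ^+ 2 + N (coord_proj (~` A) u) ^+ 2.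
Proof. by apply: EFin_inj; rewrite EFinD !ell2_normE (energy_split A u). Qed.

Lemma coord_proj_norm_le A u : N (coord_proj A u) <= N u.
Proof.
rewrite -(@ler_pXn2r _ 2)// ?nnegrE ?ell2_norm_ge0 //.
by rewrite (ell2_norm_split A u) lerDl sqr_ge0.
Qed.

Lemma coord_projC A u : coord_proj (~` A) u = u - coord_proj A u.
Proof.
apply: ell2P => i; rewrite ell2B !coord_projE.
case: asboolP => [nA|/contrapT Ai]; case: asboolP => // _; rewrite ?subr0 ?subrr //.
Qed.

Lemma coord_proj_sub_norm A B u : A `<=` B -> N (coord_proj A u) <= N (coord_proj B u).
Proof.
move=> AB; have -> : coord_proj A u = coord_proj A (coord_proj B u).
  apply: ell2P => i; rewrite !coord_projE; case: asboolP => // Ai.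
  by case: asboolP => // nB; case: nB; exact: AB.
exact: coord_proj_norm_le.
Qed.

Lemma sum_deltaE (F : {fset T}) (a : T -> R[i]) i :
  (\sum_(j <- F) a j *: (delta j : H)) i = if i \in F then a i else 0.
Proof.
rewrite ell2_sum; case: ifPn => iF.
  rewrite (bigD1_seq i) //; rewrite [X in X + _ = _]ell2Z deltaE eqxx mulr1.
  rewrite big1 ?addr0 //.
  by move=> j ji; rewrite ell2Z deltaE eq_sym (negbTE ji) mulr0.
rewrite big_seq big1 // => j jF; rewrite ell2Z deltaE.
by case: eqP => [ij|_]; [rewrite ij jF in iF|rewrite mulr0].
Qed.

Lemma coord_proj_fset (F : {fset T}) u :
  coord_proj [set` F] u = \sum_(i <- F) u i *: delta i.
Proof. by apply: ell2P => i; rewrite sum_deltaE coord_projE asboolb. Qed.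

Lemma ell2_norm_fset (F : {fset T}) u :
  N (coord_proj [set` F] u) ^+ 2 = \sum_(i <- F) normc (u i) ^+ 2.
Proof.
apply: EFin_inj; rewrite ell2_normE energy_coord_proj.
rewrite -sumEFin esum_fset ?fsbig_finite ?set_fsetK //=.
by move=> i _; rewrite lee_fin sqr_ge0.
Qed.

Lemma ell2_tail u e : 0 < e ->
  exists F : {fset T}, forall A, [set` F] `<=` A -> N (u - coord_proj A u) < e.
Proof.
move=> e0; have e20 : 0 < e ^+ 2 by rewrite exprn_gt0.
have : ((N u ^+ 2 - e ^+ 2)%:E < energy u)%E.
  by rewrite -ell2_normE lte_fin ltrBlDr ltrDl.
move=> /ereal_sup_gt[_ [A [finA _] <-]].
rewrite fsbig_finite //= sumEFin lte_fin => lt.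
exists (fset_set A) => B AB; rewrite -coord_projC.
apply: (@le_lt_trans _ _ (N (coord_proj (~` [set` fset_set A]) u))).
  by apply: coord_proj_sub_norm; exact: subsetC.
rewrite -(@ltr_pXn2r _ 2) // ?nnegrE ?ell2_norm_ge0 ?ltW //.
move: lt; rewrite -ell2_norm_fset (ell2_norm_split [set` fset_set A] u).
lra.
Qed.

(** Density of the finitely supported families, as an induction principle for
    closed properties. *)
Lemma ell2_dense_ind (P : H -> Prop) : P 0 ->
  (forall a i v, P v -> P (a *: delta i + v)) ->
  (forall u, (forall e, 0 < e -> exists2 v, P v & N (u - v) < e) -> P u) ->
  forall u, P u.
Proof.
move=> P0 PD Pcl u; apply: Pcl => e e0.
have [F FA] := ell2_tail u e0.
exists (coord_proj [set` F] u); last exact: FA.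
rewrite coord_proj_fset; elim: (enum_fset F) => [|i s IH]; first by rewrite big_nil.
by rewrite big_cons; exact: PD.
Qed.

(** * The inner product *)

Local Notation is_sum f l :=
  (summability.partial_sum (f : T -> R[i]^o) @ summability.totally --> (l : R[i]^o)).

Lemma totally_sup (F : {fset T}) (P : {fset T} -> Prop) :
  (forall B : {fset T}, [set` F] `<=` [set` B] -> P B) ->
  \forall B \near summability.totally, P B.
Proof.
move=> FP; exists F => // B /= /fsubsetP FB; apply: FP => x /=; exact: FB.
Qed.

Lemma partial_sumE (f : T -> R[i]^o) (F : {fset T}) :
  summability.partial_sum f F = \sum_(i <- F) f i.
Proof. by rewrite [RHS]big_seq_fsetE. Qed.

Lemma is_sum_unique (f : T -> R[i]) (l : R[i]) : is_sum f l ->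
  summability.sum (f : T -> R[i]^o) = l.
Proof. by move=> fl; apply/cvg_lim => //; exact: norm_hausdorff. Qed.

Lemma is_sum_lin (a : R[i]) (f g : T -> R[i]) (l m : R[i]) : is_sum f l -> is_sum g m ->
  is_sum (fun i => a * f i + g i) (a * l + m).
Proof.
move=> fl gm.
have -> : summability.partial_sum (fun i => a * f i + g i : R[i]^o) =
    (fun F => a *: summability.partial_sum (f : T -> R[i]^o) F +
       summability.partial_sum (g : T -> R[i]^o) F).
  by apply/funext => F; rewrite !partial_sumE scaler_sumr big_split.
exact: (cvgD (cvgZl_tmp fl) gm).
Qed.

Lemma is_sum1 i (f : T -> R[i]) : (forall j, j != i -> f j = 0) -> is_sum f (f i).
Proof.
move=> fi; apply/cvgrPdist_le => e e0; apply: (@totally_sup [fset i]%fset) => B iB.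
rewrite partial_sumE (bigD1_seq i) //=; last by apply: iB; rewrite /= inE.
by rewrite big1 // addr0 subrr normr0 ltW.
Qed.

Lemma is_sum_norm w : is_sum (fun i => w i * (w i)^*) ((N w ^+ 2)%:C).
Proof.
apply/cvgrPdist_le => e e0.
have [r r0 ->] := complex_gt0P e0.
have e'0 : 0 < Num.sqrt r by rewrite sqrtr_gt0.
have [F hF] := ell2_tail w e'0; apply: (@totally_sup F) => B FB.
have {hF} := hF [set` B] FB; rewrite -coord_projC => lt.
rewrite partial_sumE.
have -> : \sum_(i <- B) (w i * (w i)^* : R[i]^o) = (N (coord_proj [set` B] w) ^+ 2)%:C.
  rewrite ell2_norm_fset rmorph_sum /=; apply: eq_bigr => i _.
  by rewrite mulC_conj.
rewrite (ell2_norm_split [set` B] w) -rmorphB addrC addKr.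
rewrite ger0_norm ?lecR ?sqr_ge0 // -(sqr_sqrtr (ltW r0)).
by rewrite ler_pXn2r ?nnegrE ?ell2_norm_ge0 ?sqrtr_ge0 // ltW.
Qed.

Arguments is_sum_norm w : clear implicits.
Arguments is_sum_lin a {f g l m} _ _ P _ : rename.

Lemma is_sum_eq (f g : T -> R[i]) (l m : R[i]) :
  is_sum f l -> f =1 g -> l = m -> is_sum g m.
Proof. by move=> fl /funext <- <-. Qed.

Lemma polarization (a b : R[i]) :
  4 * (a * b^*) = (a + b) * (a + b)^* + (- 1 * ((a - b) * (a - b)^*) +
   ('i * ((a + 'i * b) * (a + 'i * b)^*) +
    - 'i * ((a - 'i * b) * (a - 'i * b)^*))).
Proof.
have -> : 4 = (4 : R)%:C :> R[i] by rewrite rmorph_nat.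
case: a b => a1 a2 [b1 b2].
apply/eqP; rewrite eq_complex /=; apply/andP; split; apply/eqP; ring.
Qed.

Lemma conj_polar (p q r s : R) :
  (4^-1 * (p%:C + (- 1 * q%:C + ('i * r%:C + - 'i * s%:C))))^*%R =
  4^-1 * (p%:C + (- 1 * q%:C + ('i * s%:C + - 'i * r%:C))) :> R[i].
Proof.
have -> : 4^-1 = (4^-1 : R)%:C :> R[i] by rewrite fmorphV rmorph_nat.
by apply/eqP; rewrite eq_complex /=; apply/andP; split; apply/eqP; ring.
Qed.

Definition polar u v : R[i] := 4^-1 *
  ((N (u + v) ^+ 2)%:C + (- 1 * (N (u - v) ^+ 2)%:C
   + ('i * (N (u + 'i *: v) ^+ 2)%:C + - 'i * (N (u - 'i *: v) ^+ 2)%:C))).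

(** Polarisation reduces the convergence of the series of [dot u v] to that of
    series with nonnegative terms. *)
Lemma is_sum_polar u v : is_sum (fun i => u i * (v i)^*) (polar u v).
Proof.
have z : is_sum (fun i => (0 : H) i * ((0 : H) i)^*) 0.
  by have := is_sum_norm 0; rewrite ell2_norm0 expr0n.
have s1 := is_sum_lin (- 'i) (is_sum_norm (u - 'i *: v)) z.
have s2 := is_sum_lin 'i (is_sum_norm (u + 'i *: v)) s1.
have s3 := is_sum_lin (- 1) (is_sum_norm (u - v)) s2.
have s4 := is_sum_lin 1 (is_sum_norm (u + v)) s3.
have s5 := is_sum_lin 4^-1 s4 z.
apply: is_sum_eq s5 _ _; last by rewrite mul1r !addr0.
move=> i; rewrite !ell20 !mul0r !addr0 mul1r.
rewrite !(ell2B, ell2D, ell2Z) -polarization mulKf //.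
Qed.

Arguments is_sum_polar u v : clear implicits.

Lemma dotE u v : dot u v = polar u v.
Proof. exact/is_sum_unique/is_sum_polar. Qed.

Lemma is_sum_dot u v : is_sum (fun i => u i * (v i)^*) (dot u v).
Proof. by rewrite dotE; exact: is_sum_polar. Qed.

Arguments is_sum_dot u v : clear implicits.

Lemma dot_eq u v (l : R[i]) : is_sum (fun i => u i * (v i)^*) l -> dot u v = l.
Proof. exact: is_sum_unique. Qed.

Lemma dot_linl (a : R[i]) u v w : dot (a *: u + v) w = a * dot u w + dot v w.
Proof.
apply: dot_eq; apply: is_sum_eq (is_sum_lin a (is_sum_dot u w) (is_sum_dot v w)) _ _; last by [].
by move=> i; rewrite ell2D ell2Z mulrDl mulrA.
Qed.

Lemma dotC u v : dot u v = (dot v u)^*%R.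
Proof.
rewrite !dotE /polar conj_polar (addrC u v) (ell2_distC u v).
have -> : u + 'i *: v = 'i *: (v - 'i *: u).
  by rewrite scalerBr scalerA -expr2 sqr_i scaleN1r opprK addrC.
have -> : u - 'i *: v = - 'i *: (v + 'i *: u).
  by rewrite scalerDr scaleNr scalerA mulNr -expr2 sqr_i opprK scale1r addrC.
have ni : normc ((0 : R) +i* 1) = 1 by rewrite /Normc.normc expr0n expr1n add0r sqrtr1.
have nmi : normc (- ((0 : R) +i* 1)) = 1.
  by rewrite /Normc.normc /= oppr0 sqrrN expr0n expr1n add0r sqrtr1.
by rewrite !ell2_normZ ni nmi !mul1r.
Qed.

Lemma dot_linr (a : R[i]) u v w : dot u (a *: v + w) = a^* * dot u v + dot u w.
Proof. by rewrite dotC dot_linl rmorphD rmorphM /= -!dotC. Qed.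

Lemma dot0l v : dot (0 : H) v = 0.
Proof.
have := dot_linl 1 (0 : H) 0 v; rewrite scaler0 addr0 mul1r => /esym/eqP.
by rewrite -subr_eq0 addrK => /eqP.
Qed.

Lemma dotDl u v w : dot (u + v) w = dot u w + dot v w.
Proof. by rewrite -{1}[u]scale1r dot_linl mul1r. Qed.

Lemma dotZl a u w : dot (a *: u) w = a * dot u w.
Proof. by rewrite -[a *: u]addr0 dot_linl dot0l addr0. Qed.

Lemma dotBl u v w : dot (u - v) w = dot u w - dot v w.
Proof. by rewrite dotDl -scaleN1r dotZl mulN1r. Qed.

Lemma dotDr u v w : dot u (v + w) = dot u v + dot u w.
Proof. by rewrite dotC dotDl rmorphD /= -!dotC. Qed.

Lemma dotZr a u v : dot u (a *: v) = a^* * dot u v.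
Proof. by rewrite dotC dotZl rmorphM /= -!dotC. Qed.

Lemma dot_delta u i : dot u (delta i) = u i.
Proof.
have := @is_sum1 i (fun j => u j * (delta i j)^*).
rewrite deltaE eqxx rmorph1 mulr1 => h; apply: dot_eq; apply: h => j ji.
by rewrite deltaE (negbTE ji) rmorph0 mulr0.
Qed.

Lemma dot_single u v i : (forall j, j != i -> u j = 0 \/ v j = 0) ->
  dot u v = u i * (v i)^*.
Proof.
move=> uv; apply: dot_eq; apply: (@is_sum1 i (fun j => u j * (v j)^*)) => j ji.
by have [->|->] := uv j ji; rewrite ?mul0r // rmorph0 mulr0.
Qed.

Lemma dot_nondegenerate u v : (forall w, dot w u = dot w v) -> u = v.
Proof. by move=> uv; apply: ell2P => i; rewrite -!dot_delta [LHS]dotC uv -dotC. Qed.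

(** The Cauchy-Schwarz inequality up to a constant, which is enough for
    continuity: on unit vectors it can be read off the polarisation identity. *)
Lemma dot_bound u v : normc (dot u v) <= 4 * N u * N v.
Proof.
have [/ell2_norm_eq0->|u0] := eqVneq (N u) 0.
  by rewrite dot0l Normc.normc0 ell2_norm0 mulr0 mul0r.
have [/ell2_norm_eq0->|v0] := eqVneq (N v) 0.
  by rewrite dotC dot0l rmorph0 Normc.normc0 ell2_norm0 mulr0.
have {}u0 : 0 < N u by rewrite lt_def u0 ell2_norm_ge0.
have {}v0 : 0 < N v by rewrite lt_def v0 ell2_norm_ge0.
have nR (r : R) : 0 <= r -> normc r%:C = r.
  by move=> r0; apply: complexI; rewrite -normcR ger0_norm // lecR.
pose u' := ((N u)^-1)%:C *: u; pose v' := ((N v)^-1)%:C *: v.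
have nu' : N u' = 1 by rewrite ell2_normZ nR ?invr_ge0 ?ell2_norm_ge0 // mulVf ?gt_eqF.
have nv' : N v' = 1 by rewrite ell2_normZ nR ?invr_ge0 ?ell2_norm_ge0 // mulVf ?gt_eqF.
have uE : u = (N u)%:C *: u' by rewrite /u' scalerA -rmorphM mulfV ?gt_eqF // scale1r.
have vE : v = (N v)%:C *: v' by rewrite /v' scalerA -rmorphM mulfV ?gt_eqF // scale1r.
rewrite {1}uE {1}vE dotZl dotZr conjR !Normc.normcM !nR ?ell2_norm_ge0 //.
suff d4 : normc (dot u' v') <= 4.
  by rewrite mulrA -[4 * _ * _]mulrA [4 * _]mulrC ler_pM2l ?mulr_gt0.
rewrite -lecR -normcR dotE /polar.
have n'i : `|'i%R : R[i]| = 1 by exact: normCi.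
have b (c : R[i]) : `|c| = 1 -> `|(N (u' + c *: v') ^+ 2)%:C : R[i]| <= 4.
  move=> c1; rewrite ger0_norm ?lecR ?sqr_ge0 // -[4](rmorph_nat (real_complex R)) lecR.
  have -> : 4%:R = 2 ^+ 2 :> R by rewrite -natrX.
  rewrite ler_pXn2r ?nnegrE ?ell2_norm_ge0 //.
  apply: le_trans (ell2_normD _ _) _; rewrite [N (c *: v')]ell2_normZ nu' nv' mulr1.
  by rewrite (_ : normc c = 1) //; apply: complexI; rewrite -normcR c1.
have b1 := b 1 (normr1 _); have b2 := b (-1) (normrN1 _).
have b3 := b 'i%R n'i; have b4 := b (- 'i%R) (etrans (normrN _) n'i).
rewrite scale1r in b1; rewrite scaleN1r in b2; rewrite scaleNr in b4.
rewrite normrM ger0_norm ?invr_ge0 ?ler0n // ler_pdivrMl ?ltr0n //.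
apply: le_trans (ler_normD _ _) _.
have -> : 4 * 4%:C = 4 + (4 + (4 + 4)) :> R[i].
  by rewrite (rmorph_nat (real_complex R)); ring.
rewrite lerD //; apply: le_trans (ler_normD _ _) _.
rewrite normrM normrN1 mul1r lerD //; apply: le_trans (ler_normD _ _) _.
by rewrite !normrM normrN n'i !mul1r lerD.
Qed.

End SquareSummable.

Arguments is_sum_dot {R T} u v P _ : rename.

(** * Bounded operators *)

Section BoundedOperators.
Variables (R : realType) (T : choiceType).
Local Notation H := (ell2 R T).
Local Notation N := (@ell2_norm R T).
Local Notation op := (bop R T).
Implicit Types (u v w : H) (x y z : op) (i : T).

Lemma bopP x y : (forall u, x u = y u) -> x = y.
Proof. by move=> xy; apply: val_inj; apply/funext. Qed.

Lemma bopE_M x y u : (x * y) u = x (y u). Proof. by []. Qed.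
Lemma bopE_D x y u : (x + y) u = x u + y u. Proof. by []. Qed.
Lemma bopE_Z a x u : (a *: x) u = a *: x u. Proof. by []. Qed.
Lemma bopE_1 u : (1 : op) u = u. Proof. by []. Qed.
Lemma bopE_0 u : (0 : op) u = 0. Proof. by []. Qed.

Lemma bop_lin x a u v : x (a *: u + v) = a *: x u + x v.
Proof. exact: bop_linear. Qed.
Lemma bop_0 x : x 0 = 0. Proof. exact: linear0. Qed.
Lemma bop_B x u v : x (u - v) = x u - x v. Proof. exact: linearB. Qed.
Lemma bop_Z x a u : x (a *: u) = a *: x u. Proof. exact: linearZ. Qed.
Lemma bop_sum x I (s : seq I) (f : I -> H) : x (\sum_(k <- s) f k) = \sum_(k <- s) x (f k).
Proof. exact: linear_sum. Qed.

Lemma bop_bounded x : exists2 c : R, 0 < c & forall u, N (x u) <= c * N u.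
Proof.
have /linear_bounded_continuous/linear_boundedP := @bop_continuous R T x.
move=> /pinfty_ex_gt0[M M0 xM]; have [c c0 Mc] := complex_gt0P M0.
exists c => // u; have := xM u.
by rewrite Mc !ell2_norm_normr -rmorphM lecR.
Qed.

Lemma bounded_is_bop (F : H -> H) (c : R) : linear F -> 0 <= c ->
  (forall u, N (F u) <= c * N u) -> F \in @is_bop R T.
Proof.
move=> lF c0 Fc; apply/is_bopP; split => // u.
apply/(@cvgrPdist_le _ _ _ (nbhs u)) => e /complex_gt0P[r r0 ->]; near=> v.
have -> : F u - F v = F (u - v).
  have := lF (-1) v u; rewrite !scaleN1r addrC => <-; congr F; exact: addrC.
rewrite ell2_norm_normr lecR (le_trans (Fc _)) //.
have : `|u - v| <= (r / (c + 1))%:C.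
  near: v; apply: (@cvgr_dist_le _ _ _ (nbhs u)); first exact: cvg_id.
  by rewrite ltcR divr_gt0 // ltr_wpDl.
rewrite ell2_norm_normr lecR ler_pdivlMr ?ltr_wpDl // => h.
apply: le_trans h; rewrite mulrC ler_wpM2l ?ell2_norm_ge0 ?lerDl.
Unshelve. all: by end_near. Qed.

Lemma dist_small_eq u v (c : R) : 0 <= c ->
  (forall e : R, 0 < e -> N (u - v) <= c * e) -> u = v.
Proof.
move=> c0 uv; apply/eqP; rewrite -subr_eq0; apply/eqP/ell2_norm_eq0/eqP.
rewrite eq_le ell2_norm_ge0 andbT; apply/ler_addgt0Pl => e e0; rewrite addr0.
have c1 : 0 < c + 1 by rewrite ltr_wpDl.
apply: le_trans (uv (e / (c + 1)) (divr_gt0 e0 c1)) _.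
by rewrite mulrA ler_pdivrMr // mulrC ler_wpM2l ?lerDl ?ltW.
Qed.

Lemma bop_ext x y : (forall i, x (delta i) = y (delta i)) -> x = y.
Proof.
move=> xy; apply: bopP; apply: ell2_dense_ind => [|a i v xyv|u uP].
- by rewrite !bop_0.
- by rewrite !bop_lin xy xyv.
have [c c0 xc] := bop_bounded x; have [d d0 yd] := bop_bounded y.
apply: (@dist_small_eq _ _ (c + d)); first by rewrite addr_ge0 // ltW.
move=> e e0; have [v xyv uv] := uP e e0.
have -> : x u - y u = x (u - v) - y (u - v).
  by rewrite !bop_B xyv opprD opprK addrACA addNr addr0.
apply: le_trans (ell2_normD _ _) _; rewrite ell2_normN mulrDl lerD //.
- by apply: le_trans (xc _) _; rewrite ler_wpM2l ?ltW.
- by apply: le_trans (yd _) _; rewrite ler_wpM2l ?ltW.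
Qed.

(** * Adjoints *)

Section Adjoint.
Variable x : op.

Definition adj_fun v : T -> R[i] := fun i => (dot (x (delta i)) v)^*%R.

Lemma dot_sum I (s : seq I) (f : I -> H) v :
  dot (\sum_(k <- s) f k) v = \sum_(k <- s) dot (f k) v.
Proof.
elim: s => [|k s IH]; first by rewrite !big_nil dot0l.
by rewrite !big_cons dotDl IH.
Qed.

(** The Riesz representation in coordinates: pairing [x u] with [v], where [u] is
    a finite truncation of [adj_fun v], gives the square of the norm of [u]. *)
Lemma adj_energy (c : R) v : 0 < c -> (forall u, N (x u) <= c * N u) ->
  (energy (adj_fun v) <= ((4 * c * N v) ^+ 2)%:E)%E.
Proof.
move=> c0 xc; apply: ge_ereal_sup => _ [A [finA _] <-].
rewrite fsbig_finite //= sumEFin lee_fin; set F := fset_set A.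
pose u : H := \sum_(i <- F) adj_fun v i *: delta i.
set S := \sum_(i <- F) _.
have S0 : 0 <= S by apply: sumr_ge0 => i _; exact: sqr_ge0.
have dotS : dot (x u) v = S%:C.
  rewrite /u bop_sum dot_sum rmorph_sum; apply: eq_bigr => i _.
  by rewrite bop_Z dotZl /adj_fun -{2}[dot _ _]conjCK mulC_conj.
have Nu : N u ^+ 2 = S.
  have -> : u = coord_proj [set` F] u.
    by apply: ell2P => i; rewrite coord_projE asboolb /u sum_deltaE; case: (i \in F).
  rewrite ell2_norm_fset; apply: eq_big_seq => i iF.
  by rewrite /u sum_deltaE iF.
have : S <= (4 * c * N v) * N u.
  have -> : S = normc (dot (x u) v).
    by rewrite dotS; apply: complexI; rewrite -normcR ger0_norm ?lecR.
  apply: le_trans (dot_bound _ _) _.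
  rewrite [X in _ <= X]mulrAC ler_wpM2r ?ell2_norm_ge0 //.
  by rewrite -mulrA ler_wpM2l.
have := ell2_norm_ge0 u; have := ell2_norm_ge0 v; rewrite -Nu.
set n := N u; set m := N v => m0 n0 le.
have cm0 : 0 <= 4 * c * m by rewrite !mulr_ge0 // ltW.
rewrite ler_pXn2r ?nnegrE //.
have [->//|n1] := eqVneq n 0.
by rewrite -(@ler_pM2r _ n) ?lt_def ?n1.
Qed.

Lemma adj_sqsum v : adj_fun v \in @sqsum R T.
Proof.
have [c c0 xc] := bop_bounded x.
by apply/sqsumP; apply: le_lt_trans (adj_energy v c0 xc) (ltry _).
Qed.

Definition adj_ell2 v : H := Ell2 (adj_sqsum v).

Lemma adj_is_bop : adj_ell2 \in @is_bop R T.
Proof.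
have [c c0 xc] := bop_bounded x.
apply: (@bounded_is_bop _ (4 * c)) => [a u v||u].
- apply: ell2P => i; rewrite ell2D ell2Z [LHS]/(dot _ _)^*%R dot_linr.
  by rewrite rmorphD rmorphM; congr (_ * _ + _); exact: conjCK.
- by rewrite mulr_ge0 // ltW.
- have cu0 : 0 <= 4 * c * N u by rewrite !mulr_ge0 ?ell2_norm_ge0 ?ltW.
  rewrite -(@ler_pXn2r _ 2) ?nnegrE ?ell2_norm_ge0 //.
  by rewrite -lee_fin ell2_normE; exact: adj_energy.
Qed.

Lemma adj_exists : exists y : op, forall u v, dot (x u) v = dot u (y v).
Proof.
exists (Bop adj_is_bop) => + v; apply: ell2_dense_ind => [|a i u uv|u uP].
- by rewrite bop_0 !dot0l.
- rewrite bop_lin !dot_linl uv; congr (_ * _ + _).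
  by rewrite [RHS]dotC dot_delta [RHS]conjCK.
have [c c0 xc] := bop_bounded x; set y := Bop adj_is_bop in uP *.
apply/eqP; rewrite -subr_eq0 -normr_eq0 normcR; apply/eqP; congr _%:C.
apply/eqP; rewrite eq_le normc_ge0 andbT; apply/ler_addgt0Pl => e e0; rewrite addr0.
pose K := 4 * c * N v + 4 * N (y v) + 1.
have K0 : 0 < K.
  by rewrite /K ltr_wpDl // addr_ge0 // !mulr_ge0 ?ell2_norm_ge0 // ltW.
have [w wy uw] := uP (e / K) (divr_gt0 e0 K0).
have -> : dot (x u) v - dot u (y v) = dot (x (u - w)) v - dot (u - w) (y v).
  by rewrite bop_B !dotBl wy opprD opprK addrACA addNr addr0.
apply: (@le_trans _ _ (N (u - w) * K)); last by rewrite -ler_pdivlMr // ltW.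
apply: le_trans (normcB_le _ _) _.
apply: (@le_trans _ _ (4 * (c * N (u - w)) * N v + 4 * N (u - w) * N (y v))).
  apply: lerD; last exact: dot_bound.
  apply: le_trans (dot_bound _ _) _; rewrite ler_wpM2r ?ell2_norm_ge0 //.
  by rewrite ler_wpM2l.
have := ell2_norm_ge0 (u - w); rewrite /K; lra.
Qed.

End Adjoint.

Lemma adjP x u v : dot (x u) v = dot u (adj x v).
Proof.
have [y xy] := adj_exists x.
by have /(_ u v) := @xgetPex _ (0 : op)
  [set y : op | forall u v, dot (x u) v = dot u (y v)] (ex_intro _ y xy).
Qed.

Lemma adj_uniq x y : (forall u v, dot (x u) v = dot u (y v)) -> adj x = y.
Proof.
move=> xy; apply: bopP => v; apply: dot_nondegenerate => w.
by rewrite -adjP xy.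
Qed.

Lemma adjK x : adj (adj x) = x.
Proof. by apply: adj_uniq => u v; rewrite dotC -adjP -dotC. Qed.

Lemma adjM x y : adj (x * y) = adj y * adj x.
Proof. by apply: adj_uniq => u v; rewrite !bopE_M !adjP. Qed.

Lemma adj_one : adj (1 : op) = 1.
Proof. exact: adj_uniq. Qed.

Lemma adj_delta x i j : adj x (delta i) j = (x (delta j) i)^*%R.
Proof. by rewrite -dot_delta dotC -adjP dot_delta. Qed.

(** * Commutants and generated von Neumann algebras *)

Implicit Types (S : set op).

Definition adj_closed S := forall x, S x -> S (adj x).

Lemma commutant_anti S1 S2 : S1 `<=` S2 -> commutant S2 `<=` commutant S1.
Proof. by move=> S12 y yS x /S12; exact: yS. Qed.

Lemma sub_bicommutant S : S `<=` commutant (commutant S).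
Proof. by move=> x Sx y yS; rewrite yS. Qed.

Lemma commutant3 S : commutant (commutant (commutant S)) = commutant S.
Proof.
apply/seteqP; split; last exact: sub_bicommutant.
exact/commutant_anti/sub_bicommutant.
Qed.

Lemma commutant_adj S : adj_closed S -> adj_closed (commutant S).
Proof.
move=> aS y yS x Sx; apply: (can_inj adjK).
by rewrite !adjM adjK yS //; exact: aS.
Qed.

Lemma vonNeumann_commutant S : adj_closed S -> vonNeumann (commutant S).
Proof. by move=> aS; split; [exact: commutant_adj|exact: commutant3]. Qed.

Lemma vN_gen_sub S : S `<=` vN_gen S.
Proof. exact: sub_gen_smallest. Qed.

Lemma vN_gen_min S M : vonNeumann M -> S `<=` M -> vN_gen S `<=` M.
Proof. by move=> vM SM; exact: smallest_sub. Qed.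

(** Von Neumann algebras being defined as bicommutants, the least one is the
    bicommutant of the generators. *)
Lemma vN_genE S : adj_closed S -> vN_gen S = commutant (commutant S).
Proof.
move=> aS; apply/seteqP; split.
  apply: vN_gen_min; last exact: sub_bicommutant.
  exact/vonNeumann_commutant/commutant_adj.
move=> x xS M [[_ eM] SM]; rewrite -eM; move: x xS.
exact/commutant_anti/commutant_anti.
Qed.

Lemma vonNeumann_gen S : adj_closed S -> vonNeumann (vN_gen S).
Proof. by move=> aS; rewrite vN_genE //; exact/vonNeumann_commutant/commutant_adj. Qed.

Lemma vonNeumannM (M : set op) x y : vonNeumann M -> M x -> M y -> M (x * y).
Proof.
move=> [_ <-] xM yM z zM.
by rewrite mulrA (xM z zM) -mulrA (yM z zM) mulrA.
Qed.

Lemma vonNeumann1 (M : set op) : vonNeumann M -> M 1.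
Proof. by move=> [_ <-] z zM; rewrite mulr1 mul1r. Qed.

End BoundedOperators.

(** * Coordinate projections *)

Section Coordinates.
Variables (R : realType) (T : choiceType).
Local Notation H := (ell2 R T).
Local Notation N := (@ell2_norm R T).
Local Notation op := (bop R T).
Implicit Types (u v w : H) (x y z : op) (i : T).

Local Notation is_sum f l :=
  (summability.partial_sum (f : T -> R[i]^o) @ summability.totally --> (l : R[i]^o)).

Lemma is_sum_reindex (e : T -> T) (f : T -> R[i]) (l : R[i]) : bijective e ->
  is_sum f l -> is_sum (f \o e) l.
Proof.
move=> [e' eK e'K] /cvgrPdist_le fl; apply/cvgrPdist_le => r r0.
have [F _ FP] := fl r r0.
apply: (@totally_sup _ [fset e' i | i in F]%fset) => B FB.
have /FP : (F `<=` [fset e i | i in B])%fset.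
  apply/fsubsetP => i iF; apply/imfsetP; exists (e' i); last by rewrite e'K.
  by apply: FB; apply/imfsetP; exists i.
rewrite /= !partial_sumE big_imfset //= => i j _ _; exact: (can_inj eK).
Qed.

Lemma is_sum_inj (f : T -> R[i]) (l m : R[i]) : is_sum f l -> is_sum f m -> l = m.
Proof. by move=> /is_sum_unique <- /is_sum_unique. Qed.

Lemma coord_proj_is_bop (A : set T) : @coord_proj R T A \in @is_bop R T.
Proof.
apply: (@bounded_is_bop _ _ _ 1) => //; first exact: coord_proj_linear.
by move=> u; rewrite mul1r; exact: coord_proj_norm_le.
Qed.

Definition cproj A : op := Bop (coord_proj_is_bop A).

Lemma cprojE A u i : cproj A u i = if `[< A i >] then u i else 0.
Proof. by []. Qed.

Lemma cproj_id A u : (forall i, ~ A i -> u i = 0) -> cproj A u = u.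
Proof.
by move=> uA; apply: ell2P => i; rewrite cprojE; case: asboolP => // /uA ->.
Qed.

Lemma cproj_supp A u i : cproj A u = u -> ~ A i -> u i = 0.
Proof. by move=> <- nA; rewrite cprojE; case: asboolP. Qed.

Lemma cproj_cproj A B u : cproj A (cproj B u) = cproj (A `&` B) u.
Proof.
apply: ell2P => i; rewrite !cprojE.
have -> : `[< (A `&` B) i >] = `[< A i >] && `[< B i >] by exact: asbool_and.
by case: (`[< A i >]); case: (`[< B i >]).
Qed.

(** * Transport of square summable families along an injection *)

Section Transport.
Variables (e : T -> T) (e_inj : injective e).

Lemma pull_energy (u : T -> R[i]) : (energy (u \o e) <= energy u)%E.
Proof.
rewrite {1}/energy -(@esum_image _ _ _ setT e (fun i => (normc (u i) ^+ 2)%:E)).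
  by rewrite -energy_coord_proj (energy_split (e @` setT) u) leeDl // energy_ge0.
by move=> i j _ _; exact: e_inj.
Qed.

Lemma pull_sqsum u : (u : T -> R[i]) \o e \in @sqsum R T.
Proof.
by apply/sqsumP; apply: le_lt_trans (pull_energy _) _; apply/sqsumP; case: u.
Qed.

Definition pull_ell2 u : H := Ell2 (pull_sqsum u).

Lemma pull_is_bop : pull_ell2 \in @is_bop R T.
Proof.
apply: (@bounded_is_bop _ _ _ 1) => // [a u v|u]; first exact: ell2P.
by apply: le_ell2_norm; rewrite // expr1n mul1e; exact: pull_energy.
Qed.

Definition pull : op := Bop pull_is_bop.

Lemma pullE u i : pull u i = u (e i). Proof. by []. Qed.

Definition push_fun (u : T -> R[i]) i : R[i] :=
  if pselect (exists j, e j = i) is left p then u (sval (cid p)) else 0.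

Lemma push_fun_in (f : T -> R[i]) i : push_fun f (e i) = f i.
Proof.
rewrite /push_fun; case: pselect => [p|[]]; last by exists i.
by have -> : sval (cid p) = i by apply: e_inj; case: cid.
Qed.

Lemma push_fun_out (f : T -> R[i]) i : (forall j, e j <> i) -> push_fun f i = 0.
Proof. by move=> ni; rewrite /push_fun; case: pselect => // p; exfalso; case: p => j /ni. Qed.

Lemma push_energy u : energy (push_fun u) = energy u.
Proof.
rewrite (energy_split (e @` setT)) !energy_coord_proj [X in (_ + X)%E]esum1; last first.
  move=> i ni; rewrite push_fun_out ?Normc.normc0 ?expr0n // => j ji.
  by apply: ni; exists j.
rewrite adde0 esum_image; last by move=> i j _ _; exact: e_inj.
by apply: eq_esum => i _; rewrite push_fun_in.
Qed.

Lemma push_sqsum u : push_fun u \in @sqsum R T.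
Proof. by apply/sqsumP; rewrite push_energy; apply/sqsumP; case: u. Qed.

Definition push_ell2 u : H := Ell2 (push_sqsum u).

Lemma push_cases i : (exists j, e j = i) \/ (forall j, e j <> i).
Proof.
have [p|np] := pselect (exists j, e j = i); [by left|right => j ji].
by apply: np; exists j.
Qed.

Lemma push_is_bop : push_ell2 \in @is_bop R T.
Proof.
apply: (@bounded_is_bop _ _ _ 1) => // [a u v|u]; last first.
  by apply: le_ell2_norm; rewrite // expr1n mul1e push_energy.
apply: ell2P => i; rewrite ell2D ell2Z /=.
have [[j <-]|ni] := push_cases i; first by rewrite !push_fun_in.
by rewrite !push_fun_out // mulr0 addr0.
Qed.

Definition push : op := Bop push_is_bop.

Lemma push_norm u : N (push u) = N u.
Proof. by rewrite /ell2_norm push_energy. Qed.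

End Transport.

(** The graph of transport along [e].  Unlike [push] it does not contain a proof
    of injectivity, so that compositions and iterates of [e] are unproblematic. *)
Definition pushes (e : T -> T) u v :=
  (forall i, v (e i) = u i) /\ (forall i, (forall j, e j <> i) -> v i = 0).

Lemma pushes_push e (e_inj : injective e) u : pushes e u (push e_inj u).
Proof. by split=> i; [exact: push_fun_in|exact: push_fun_out]. Qed.

Lemma pushes_uniq e u v w : pushes e u v -> pushes e u w -> v = w.
Proof.
move=> [vi vo] [wi wo]; apply: ell2P => i.
by have [[j <-]|ni] := push_cases e i; rewrite ?vi ?wi ?vo ?wo.
Qed.

Lemma pushes_comp d e u v w : pushes e u v -> pushes d v w -> pushes (d \o e) u w.
Proof.
move=> [vi vo] [wi wo]; split=> i; first by rewrite /= wi vi.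
move=> ni; have [[j ji]|/wo//] := push_cases d i.
by rewrite -ji wi vo // => k kj; apply: (ni k); rewrite /= kj.
Qed.

Lemma pushes_inj e u u' v : pushes e u v -> pushes e u' v -> u = u'.
Proof. by move=> [vi _] [vi' _]; apply: ell2P => i; rewrite -vi vi'. Qed.

Lemma pushes_id u : pushes id u u.
Proof. by split=> // i /(_ i). Qed.

Lemma eq_pushes (A : set T) d e u v : injective e -> (forall i, A i -> d i = e i) ->
  (forall i, ~ A i -> u i = 0) -> pushes d u v -> pushes e u v.
Proof.
move=> e_inj de uA [vi vo]; split=> i; last first.
  move=> ni; have [[j ji]|/vo//] := push_cases d i; rewrite -ji vi uA // => Aj.
  by apply: (ni j); rewrite -de.
have [Ai|nAi] := pselect (A i); first by rewrite -de.
rewrite (uA _ nAi); have [[j ji]|/vo//] := push_cases d (e i).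
rewrite -ji vi uA // => Aj; apply: nAi.
by have /e_inj <- : e j = e i by rewrite -de.
Qed.

End Coordinates.

(** * Left regular and right regular representation *)

Section GroupAlgebra.
Variables (R : realType) (G : groupType).
Local Notation H := (ell2 R G).
Local Notation N := (@ell2_norm R G).
Local Notation op := (bop R G).
Implicit Types (u v w : H) (x y z : op) (s t g h k : G) (K : set G).

Definition rreg s : op := pull R (@mulIg G s).

Lemma rregE s u g : rreg s u g = u (g * s)%g. Proof. by []. Qed.
Lemma lregE s u g : lreg R s u g = u (s^-1 * g)%g. Proof. by []. Qed.

Lemma rreg_delta s g : rreg s (delta g) = delta (g * s^-1)%g.
Proof.
apply: ell2P => h; rewrite rregE !deltaE; congr ((_ : bool)%:R); apply/eqP/eqP => [<-|->].
  by rewrite mulgK.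
by rewrite mulgVK.
Qed.

Lemma lreg_delta s g : lreg R s (delta g) = delta (s * g)%g.
Proof.
apply: ell2P => h; rewrite lregE !deltaE; congr ((_ : bool)%:R); apply/eqP/eqP => [<-|->].
  by rewrite mulVKg.
by rewrite mulKg.
Qed.

Lemma lreg_one : lreg R (1 : G)%g = 1.
Proof. by apply: bop_ext => g; rewrite lreg_delta mul1g. Qed.

Lemma lreg_mul s t : lreg R (s * t)%g = lreg R s * lreg R t.
Proof. by apply: bop_ext => g; rewrite bopE_M !lreg_delta mulgA. Qed.

Lemma lregV s : adj (lreg R s) = lreg R s^-1%g.
Proof.
apply: bop_ext => g; apply: ell2P => h; rewrite adj_delta !lreg_delta !deltaE.
rewrite rmorph_nat; congr ((_ : bool)%:R); apply/eqP/eqP => [->|->].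
  by rewrite mulKg.
by rewrite mulVKg.
Qed.

(** * Left convolution operators *)

(** The commutant of the right translations, which turns out to be [L(G)].  It is
    the more convenient description: an operator that commutes with the right
    translations is determined by its value at [delta 1]. *)
Definition left_conv : set op := commutant [set rreg s | s in [set: G]].

Local Notation coef x := ((x : op) (delta 1%g)).

Lemma left_convP x : left_conv x <-> forall s u, x (rreg s u) = rreg s (x u).
Proof.
split=> [xc s u|xc _ [s _ <-]]; last by apply: bopP => u; rewrite !bopE_M xc.
have /(congr1 (fun y : op => y u)) : rreg s * x = x * rreg s.
  by apply: xc; exists s.
by rewrite !bopE_M => ->.
Qed.

Lemma rregV s : adj (rreg s) = rreg s^-1%g.
Proof.
apply: bop_ext => g; apply: ell2P => h; rewrite adj_delta !rreg_delta !deltaE.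
rewrite rmorph_nat invgK; congr ((_ : bool)%:R); apply/eqP/eqP => [->|->].
  by rewrite mulgVK.
by rewrite mulgK.
Qed.

Lemma left_conv_vonNeumann : vonNeumann left_conv.
Proof.
apply: vonNeumann_commutant => _ [s _ <-]; rewrite rregV.
by exists s^-1%g.
Qed.

Lemma left_convM x y : left_conv x -> left_conv y -> left_conv (x * y).
Proof. exact: (vonNeumannM left_conv_vonNeumann). Qed.

Lemma left_conv_adj x : left_conv x -> left_conv (adj x).
Proof. by have [h _] := left_conv_vonNeumann; exact: h. Qed.

Lemma left_conv_lreg s : left_conv (lreg R s).
Proof.
by apply/left_convP => t u; apply: ell2P => g; rewrite !(lregE, rregE) mulgA.
Qed.

Lemma left_conv1 : left_conv 1.
Proof. by rewrite -lreg_one; exact: left_conv_lreg. Qed.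

Lemma left_conv_lin a x y : left_conv x -> left_conv y -> left_conv (a *: x + y).
Proof.
move=> /left_convP xc /left_convP yc; apply/left_convP => s u.
by rewrite !bopE_D !bopE_Z xc yc bop_lin.
Qed.

Lemma left_conv_delta x g : left_conv x -> x (delta g) = rreg g^-1%g (coef x).
Proof. by move=> /left_convP xc; rewrite -xc rreg_delta invgK mul1g. Qed.

Lemma left_conv_deltaE x g h : left_conv x -> x (delta g) h = coef x (h * g^-1)%g.
Proof. by move=> xc; rewrite left_conv_delta. Qed.

Lemma left_conv_ext x y : left_conv x -> left_conv y -> coef x = coef y -> x = y.
Proof.
move=> xc yc xy; apply: bop_ext => g.
by rewrite (left_conv_delta _ xc) xy -left_conv_delta.
Qed.

Lemma coef_adj x g : left_conv x -> coef (adj x) g = (coef x g^-1%g)^*%R.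
Proof. by move=> xc; rewrite adj_delta left_conv_deltaE // mul1g. Qed.

Lemma trE x : tr x = coef x 1%g.
Proof. by rewrite /tr dot_delta. Qed.

Lemma Ad_lreg_coef s x g : left_conv x ->
  coef (Ad (lreg R s) x) g = coef x (s^-1 * g * s)%g.
Proof.
move=> xc; rewrite /Ad !bopE_M lregV lreg_delta mulg1 lregE.
by rewrite left_conv_deltaE // invgK.
Qed.

Lemma left_conv_Ad s x : left_conv x -> left_conv (Ad (lreg R s) x).
Proof.
move=> xc; apply: left_convM; last exact/left_conv_adj/left_conv_lreg.
by apply: left_convM => //; exact: left_conv_lreg.
Qed.

(** * The von Neumann algebra of a subgroup *)

Lemma adj_closed_lreg K : subgroup_set K -> adj_closed [set lreg R s | s in K].
Proof.
move=> [K1 KM] _ [s Ks <-]; rewrite lregV; exists s^-1%g => //.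
by rewrite -[X in K X]mul1g; exact: KM.
Qed.

(** Applied to [delta g], both products are the convolution of the coefficients of
    [x] with [y (delta g)].  Adjoints turn their values at [h] into inner
    products, that is into sums over the group, which differ by a change of the
    summation variable. *)
Lemma left_conv_commute K x y : left_conv x -> (forall g, ~ K g -> coef x g = 0) ->
  (forall s, K s -> lreg R s * y = y * lreg R s) -> x * y = y * x.
Proof.
move=> xc xK yK; apply: bop_ext => g; apply: ell2P => h; rewrite !bopE_M.
set u := y (delta g).
rewrite -[LHS]dot_delta adjP -[RHS]dot_delta adjP.
have s1 := is_sum_dot u (adj x (delta h)).
have s2 := is_sum_dot (x (delta g)) (adj y (delta h)).
have bij : bijective (fun k => h * k^-1 * g)%g.
  exists (fun k => g * k^-1 * h)%g => k; rewrite !invgM !invgK !mulgA mulgV mul1g.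
    by rewrite mulgVK.
  by rewrite mulgVK.
apply: is_sum_inj s1 _; apply: is_sum_eq (is_sum_reindex bij s2) _ (erefl _).
move=> k; rewrite /comp !adj_delta left_conv_deltaE // mulgK.
rewrite (left_conv_deltaE k h xc).
have [sK|nsK] := pselect (K (h * k^-1)%g); last first.
  by rewrite xK // mul0r rmorph0 rmorph0 mulr0.
rewrite -lreg_delta -bopE_M -yK // bopE_M lregE invgM invgK mulgVK.
by rewrite mulrC; congr (_ * _); rewrite conjCK.
Qed.

Lemma cproj_lreg K s : subgroup_set K -> K s -> cproj R K * lreg R s = lreg R s * cproj R K.
Proof.
move=> [K1 KM] Ks; apply: bopP => u; apply: ell2P => g.
rewrite !bopE_M lregE !cprojE lregE; congr (if _ then _ else _).
apply/asboolP/asboolP => Kg.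
  have -> : (s^-1 * g = (1 * s^-1) * (1 * g^-1)^-1)%g by rewrite !mul1g invgK.
  by do 2 apply: (KM) => //.
have -> : (g = s * (1 * (s^-1 * g)^-1)^-1)%g by rewrite mul1g invgK mulVKg.
by do 2 apply: (KM) => //.
Qed.

(** The commutant of the left translations by [K] contains the right translations
    and the projection onto the families supported on [K]; this gives one
    inclusion, and [left_conv_commute] the other one. *)
Lemma gvNE K : subgroup_set K ->
  @gvN R G K = [set x | left_conv x /\ forall g, ~ K g -> coef x g = 0].
Proof.
move=> sK; rewrite /gvN vN_genE; last exact: adj_closed_lreg.
apply/seteqP; split=> x.
  move=> xK; split.
    move=> _ [s _ <-]; apply: xK => _ [t _ <-].
    by have /left_convP := left_conv_lreg t; move=> h; apply: bopP => u; rewrite !bopE_M h.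
  have : x * cproj R K = cproj R K * x.
    by apply/esym/xK => _ [s Ks <-]; rewrite cproj_lreg.
  move=> /(congr1 (fun y : op => coef y)); rewrite !bopE_M.
  rewrite (cproj_id (u := delta 1%g)); last first.
    by move=> g; rewrite deltaE; case: eqP => // -> []; exact: sK.1.
  by move=> e g; exact/cproj_supp/esym.
move=> [xc xK] y yK; apply/esym/(left_conv_commute xc xK) => s Ks.
by apply: yK; exists s.
Qed.

Lemma gvNP K x : subgroup_set K ->
  @gvN R G K x <-> left_conv x /\ forall g, ~ K g -> coef x g = 0.
Proof. by move=> sK; rewrite gvNE. Qed.

Lemma subgroup_setT : subgroup_set [set: G]. Proof. by []. Qed.

Lemma gvNT : @gvN R G [set: G] = left_conv.
Proof.
rewrite gvNE; last exact: subgroup_setT.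
by apply/seteqP; split=> x; [case|move=> xc; split => // g []].
Qed.

Lemma gvN_vonNeumann K : subgroup_set K -> vonNeumann (@gvN R G K).
Proof. by move=> sK; exact/vonNeumann_gen/adj_closed_lreg. Qed.

Lemma gvN_sub K L : K `<=` L -> @gvN R G K `<=` @gvN R G L.
Proof.
move=> KL x xK M [vM LM]; apply: xK; split => //.
by move=> _ [s Ks <-]; apply: LM; exists s => //; exact: KL.
Qed.

Lemma gvN_lreg K s : K s -> @gvN R G K (lreg R s).
Proof. by move=> Ks; apply: vN_gen_sub; exists s. Qed.

Lemma gvN1 : @gvN R G [set 1%g] = @scalars R G.
Proof.
rewrite gvNE; last first.
  by split => // x y -> ->; rewrite mulgV.
apply/seteqP; split=> [x [xc x1]|_ [c ->]].
  exists (coef x 1%g); apply: left_conv_ext => //.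
    by rewrite -[_ *: _]addr0 -lreg_one; apply: left_conv_lin;
      [exact: left_conv_lreg|by apply/left_convP => s u; rewrite !bopE_0 bop_0].
  apply: ell2P => g; rewrite bopE_Z bopE_1 ell2Z deltaE.
  by case: eqP => [->|/x1]; rewrite ?mulr1 // mulr0.
split=> [|g g1].
  by apply/left_convP => s u; rewrite !bopE_Z !bopE_1 bop_Z.
by rewrite bopE_Z bopE_1 ell2Z deltaE; case: eqP => // _; rewrite mulr0.
Qed.

(** The trace of [x * y] is the sum of the products of the coefficients of [x] at
    [g] and of [y] at [g^-1], and only the unit contributes. *)
Lemma tr_factor x y : left_conv x -> left_conv y ->
  (forall g, g != 1%g -> coef x g = 0 \/ coef y g^-1%g = 0) -> tr (x * y) = tr x * tr y.
Proof.
move=> xc yc xy; rewrite !trE bopE_M -dot_delta adjP.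
rewrite (@dot_single _ _ _ _ 1%g).
  by rewrite coef_adj // invg1 mulrC; congr (_ * _); rewrite conjCK.
move=> g g1; have gV1 : g^-1%g != 1%g.
  by apply: contra g1 => /eqP e; rewrite -[g]invgK e invg1.
rewrite coef_adj //; have [->|e] := xy _ gV1; first by right; rewrite rmorph0.
by left; rewrite -e invgK.
Qed.

End GroupAlgebra.

(** * Operators that act separately on cosets *)

Section Fibers.
Variables (R : realType) (T I : choiceType) (q : T -> I).

Lemma energy_fibers (u : T -> R[i]) :
  energy u = (\esum_(c in [set: I]) \esum_(h in q @^-1` [set c]) (normc (u h) ^+ 2)%:E)%E.
Proof.
rewrite esum_esum; last by move=> c h _ _; rewrite lee_fin sqr_ge0.
rewrite (reindex_esum [set: T] _ (fun h => (q h, h))) //; split => //.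
- by move=> g h _ _ [].
- by move=> [c h] /= [_ <-]; exists h.
Qed.

Lemma energy_fibers_le (u v : T -> R[i]) (c : R) : 0 <= c ->
  (forall h, \esum_(k in q @^-1` [set q h]) (normc (u k) ^+ 2)%:E <=
     c%:E * \esum_(k in q @^-1` [set q h]) (normc (v k) ^+ 2)%:E)%E ->
  (energy u <= c%:E * energy v)%E.
Proof.
move=> c0 uv; rewrite !energy_fibers.
apply: le_trans (esumZ_le c0 _); last first.
  by move=> i; apply: esum_ge0 => h _; rewrite lee_fin sqr_ge0.
apply: le_esum => i _; have [[h <-]|ni] := pselect (exists h, q h = i); first exact: uv.
have -> : q @^-1` [set i] = set0 by apply/seteqP; split=> // h /= hi; case: ni; exists h.
by rewrite !esum_set0 mule0.
Qed.

End Fibers.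

Section Block.
Variables (R : realType) (G : groupType).
Local Notation H := (ell2 R G).
Local Notation N := (@ell2_norm R G).
Local Notation op := (bop R G).
Implicit Types (u v w : H) (x y z : op) (s t g h k : G).

Variables (f : G -> G) (K : set G).
Hypotheses (f_inj : injective f) (fM : forall g h, f (g * h)%g = (f g * f h)%g).
Hypothesis (sK : subgroup_set K).

(** The family [u] on the right coset of [h] under the image of [K], seen as a
    family on [K]: the translation by [h] brings the coset to the image of [K],
    and [f] identifies the latter with [K]. *)
Definition block_slice h u : H := cproj R K (pull R f_inj (rreg R h u)).

Lemma block_sliceE h u g :
  block_slice h u g = if `[< K g >] then u (f g * h)%g else 0.
Proof. by []. Qed.

Lemma block_slice_shift k h u : K k ->
  block_slice (f k * h)%g u = rreg R k (block_slice h u).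
Proof.
move=> Kk; apply: ell2P => g; rewrite rregE !block_sliceE fM mulgA.
congr (if _ then _ else _); have [K1 KM] := sK.
have KV t : K t -> K t^-1%g by move=> Kt; rewrite -[t^-1%g]mul1g; exact: KM.
apply/asboolP/asboolP => Kg; last by rewrite -(mulgK k g); exact: KM.
by rewrite -[k]invgK; apply: (KM) => //; exact: KV.
Qed.

Variable x : op.
Hypothesis xc : left_conv x.

(** The compression of [x] to [K], acting on each coset separately.  The value at
    [h] is read off at the unit, to which [h] corresponds in its own slice;
    [block_fun_slice] shows that the choice of [h] in the coset is immaterial. *)
Definition block_fun u : G -> R[i] := fun h => x (block_slice h u) 1%g.

Lemma block_fun_slice h u k : K k -> block_fun u (f k * h)%g = x (block_slice h u) k.
Proof.
move=> Kk; rewrite /block_fun block_slice_shift // (left_convP x).1 //.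
by rewrite rregE mul1g.
Qed.

Definition block_coset h : set G := [set (f k * h)%g | k in K].

Lemma block_coset_fiber h :
  [set g | block_coset g = block_coset h] = [set (f k * h)%g | k in K].
Proof.
have [K1 KM] := sK.
have f1 : f 1%g = 1%g by apply: (mulgI (f 1%g)); rewrite -fM !mulg1.
have fV k : f k^-1%g = (f k)^-1%g by apply: (mulgI (f k)); rewrite -fM !mulgV.
have KV t : K t -> K t^-1%g by move=> Kt; rewrite -[t^-1%g]mul1g; exact: KM.
apply/seteqP; split=> [g /= gh|_ [k Kk <-]] /=.
  have : block_coset g g by exists 1%g => //; rewrite f1 mul1g.
  by rewrite gh.
apply/seteqP; split=> _ [j Kj <-].
  exists (j * k)%g; last by rewrite fM mulgA.
  by rewrite -[k]invgK; apply: KM => //; exact: KV.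
exists (j * k^-1)%g; first exact: KM.
by rewrite fM fV !mulgA mulgVK.
Qed.

(** The cosets partition the group, and the slices of [u] and of the result on a
    coset are related by [x]. *)
Lemma block_energy (c : R) u : 0 < c -> (forall v, N (x v) <= c * N v) ->
  (energy (block_fun u) <= (c ^+ 2)%:E * energy u)%E.
Proof.
move=> c0 xbd; have c20 : 0 <= c ^+ 2 by exact: sqr_ge0.
apply: (@energy_fibers_le R G (set G) block_coset) => // h.
have -> : block_coset @^-1` [set block_coset h] = [set (f k * h)%g | k in K].
  exact: block_coset_fiber.
rewrite !esum_image; [|by move=> k l _ _ /mulIg/f_inj..].
set v := block_slice h u.
have -> : (\esum_(k in K) (normc (u (f k * h)%g) ^+ 2)%:E = energy v)%E.
  rewrite /energy esum_mkcond; apply: eq_esum => k _.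
  rewrite block_sliceE; case: asboolP => Kk; first by rewrite mem_set.
  by rewrite memNset // Normc.normc0 expr0n.
apply: (@le_trans _ _ (energy (x v))).
  rewrite (energy_split K) energy_coord_proj.
  rewrite [X in (X <= _)%E](_ : _ = \esum_(k in K) (normc (x v k) ^+ 2)%:E)%E.
    by rewrite leeDl // energy_ge0.
  by apply: eq_esum => k Kk; rewrite block_fun_slice.
rewrite -!ell2_normE -EFinM lee_fin -exprMn.
by rewrite ler_pXn2r ?nnegrE ?mulr_ge0 ?ell2_norm_ge0 // ltW.
Qed.

Lemma block_sqsum u : block_fun u \in @sqsum R G.
Proof.
have [c c0 xbd] := bop_bounded x; apply/sqsumP.
apply: le_lt_trans (block_energy u c0 xbd) _.
by rewrite -ell2_normE -EFinM ltry.
Qed.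

Definition block_ell2 u : H := Ell2 (block_sqsum u).

Lemma block_is_bop : block_ell2 \in @is_bop R G.
Proof.
have [c c0 xbd] := bop_bounded x.
apply: (@bounded_is_bop _ _ _ c) => [a u v||u]; last 2 first.
- exact: ltW.
- by apply: le_ell2_norm; [exact: ltW|exact: block_energy].
apply: ell2P => h; rewrite ell2D ell2Z [LHS]/(x (block_slice h _) 1%g).
by rewrite /block_slice !bop_lin.
Qed.

Definition block_op : op := Bop block_is_bop.

Lemma block_opE u h : block_op u h = x (block_slice h u) 1%g. Proof. by []. Qed.

Lemma block_op_conv : left_conv block_op.
Proof.
apply/left_convP => s u; apply: ell2P => h; rewrite rregE !block_opE.
congr (x _ _); apply: ell2P => g; rewrite !block_sliceE rregE.
by rewrite mulgA.
Qed.

Lemma block_op_coef : pushes f (cproj R K (x (delta 1%g))) (block_op (delta 1%g)).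
Proof.
have f1 : f 1%g = 1%g by apply: (mulgI (f 1%g)); rewrite -fM !mulg1.
split=> [t|h nh]; rewrite block_opE; last first.
  rewrite (_ : block_slice _ _ = 0) ?bop_0 //; apply: ell2P => g.
  rewrite block_sliceE deltaE; case: eqP => [fgh|_]; last by rewrite if_same.
  case: (nh g^-1%g); apply: (mulgI (f g)).
  by rewrite -fM mulgV f1 fgh.
rewrite cprojE; case: asboolP => Kt; last first.
  rewrite (_ : block_slice _ _ = 0) ?bop_0 //; apply: ell2P => g.
  rewrite block_sliceE deltaE; case: asboolP => // Kg; case: eqP => // e.
  case: Kt; have -> : t = g^-1%g; last first.
    by rewrite -[g^-1%g]mul1g; apply: sK.2 => //; exact: sK.1.
  by apply: (mulgI g); apply: f_inj; rewrite fM e mulgV f1.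
have -> : block_slice (f t) (delta 1%g) = delta t^-1%g.
  apply: ell2P => g; rewrite block_sliceE !deltaE.
  have -> : (f g * f t == 1)%g = (g == t^-1)%g.
    rewrite -fM -f1 (inj_eq f_inj).
    by apply/eqP/eqP => [e|->]; [apply: (mulIg t); rewrite e mulVg|rewrite mulVg].
  case: eqP => [->|_]; last by rewrite if_same.
  by rewrite asboolT // -[t^-1%g]mul1g; apply: sK.2 => //; exact: sK.1.
by rewrite left_conv_deltaE // mul1g invgK.
Qed.

End Block.

(** * Maps that implement an endomorphism of the group *)

Section Implements.
Variables (R : realType) (G : groupType).
Local Notation H := (ell2 R G).
Local Notation N := (@ell2_norm R G).
Local Notation op := (bop R G).
Local Notation coef x := ((x : op) (delta 1%g)).
Local Notation lconv := (@left_conv R G).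
Implicit Types (u v w : H) (x y z : op) (s t g h k : G) (K L : set G).
Implicit Types (f : G -> G) (phi : op -> op).

(** The condition only concerns coefficients, but all the algebraic properties of
    [phi] follow from it. *)
Definition implements phi f :=
  forall x, lconv x -> lconv (phi x) /\ pushes f (coef x) (coef (phi x)).

Lemma implements_comp phi psi f d : implements phi f -> implements psi d ->
  implements (phi \o psi) (f \o d).
Proof.
move=> pf pd x /pd[yc xy]; have [zc yz] := pf _ yc.
by split => //; exact: pushes_comp xy yz.
Qed.

Lemma implements_id : implements id id.
Proof. by move=> x xc; split => //; exact: pushes_id. Qed.

Lemma implements_iter phi f n : implements phi f -> implements (iter n phi) (iter n f).
Proof.
move=> pf; elim: n => [|n IH]; first exact: implements_id.
exact: implements_comp pf IH.
Qed.

Lemma implements_Ad s : implements (Ad (lreg R s)) (fun g => s * g * s^-1)%g.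
Proof.
move=> x xc; split; first exact: left_conv_Ad.
split=> [g|g ng]; rewrite Ad_lreg_coef //.
  by congr (coef x _); rewrite !mulgA mulgVK mulVg mul1g.
by case: (ng (s^-1 * g * s)%g); rewrite !mulgA mulgK mulgV mul1g.
Qed.

(** This reduces identities between powers of an endomorphism and inner
    automorphisms on [L(K)] to identities between homomorphisms on [K]. *)
Lemma implements_eq phi psi f d K x : injective d ->
  implements phi f -> implements psi d -> (forall g, K g -> f g = d g) ->
  lconv x -> (forall g, ~ K g -> coef x g = 0) -> phi x = psi x.
Proof.
move=> d_inj pf pd fd xc xK; have [yc xy] := pf x xc; have [zc xz] := pd x xc.
apply: left_conv_ext => //; apply: pushes_uniq xz.
exact: (eq_pushes d_inj fd xK xy).
Qed.

Section Homomorphism.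
Variables (f : G -> G) (f_inj : injective f).
Hypothesis fM : forall g h, f (g * h)%g = (f g * f h)%g.

Let f1 : f 1%g = 1%g.
Proof. by apply: (mulgI (f 1%g)); rewrite -fM !mulg1. Qed.

Let fV g : f g^-1%g = (f g)^-1%g.
Proof. by apply: (mulgI (f g)); rewrite -fM !mulgV. Qed.

Lemma push_delta g : push R f_inj (delta g) = delta (f g).
Proof.
apply: ell2P => h; rewrite deltaE; have [pi po] := pushes_push f_inj (delta g : H).
have [[j <-]|nh] := push_cases f h; first by rewrite pi deltaE (inj_eq f_inj).
by rewrite po //; case: eqP => // e; case: (nh g).
Qed.

Lemma push_rreg g u : push R f_inj (rreg R g u) = rreg R (f g) (push R f_inj u).
Proof.
apply: ell2P => h; rewrite rregE.
have [pi po] := pushes_push f_inj u; have [qi qo] := pushes_push f_inj (rreg R g u).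
have [[j <-]|nh] := push_cases f h; first by rewrite qi -fM pi.
rewrite qo // po // => j e; apply: (nh (j * g^-1)%g).
by rewrite fM fV e mulgK.
Qed.

Lemma pull_rreg g u : pull R f_inj (rreg R (f g) u) = rreg R g (pull R f_inj u).
Proof. by apply: ell2P => h; rewrite pullE !rregE pullE fM. Qed.

Section Spec.
Variable phi : op -> op.
Hypothesis phif : implements phi f.

(** [phi x] acts on the families transported by [f] as [x] does before transport;
    hence [phi] is multiplicative. *)
Lemma implements_push x : lconv x -> phi x * push R f_inj = push R f_inj * x.
Proof.
move=> xc; have [yc xy] := phif xc; apply: bop_ext => g; rewrite !bopE_M push_delta.
rewrite (left_conv_delta _ yc) (left_conv_delta _ xc) push_rreg fV; congr (rreg R _ _).
exact: pushes_uniq xy (pushes_push _ _).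
Qed.

Lemma implements_rv K L : subgroup_set K -> subgroup_set L ->
  (forall g, K g -> L (f g)) -> nc_random_variable (@gvN R G K) (@gvN R G L) phi.
Proof.
move=> sK sL fKL.
have cK x : gvN K x -> lconv x by move=> /(gvNP x sK)[].
have ext x y : lconv x -> lconv y -> pushes f (coef x) (coef y) -> phi x = y.
  move=> xc yc xy; have [zc xz] := phif xc; apply: left_conv_ext => //.
  exact: pushes_uniq xz xy.
split.
- move=> x /(gvNP x sK)[xc xK]; apply/(gvNP _ sL); have [yc [yi yo]] := phif xc.
  split => // g nLg; have [[t tg]|/yo//] := push_cases f g.
  by rewrite -tg yi xK // => /fKL; rewrite tg.
- move=> c x y /cK xc /cK yc; have [x'c [xi xo]] := phif xc; have [y'c [yi yo]] := phif yc.
  apply: ext; [exact: left_conv_lin|exact: left_conv_lin|split=> g].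
    by rewrite !bopE_D !bopE_Z !ell2D !ell2Z xi yi.
  by move=> ng; rewrite bopE_D bopE_Z ell2D ell2Z xo // yo // mulr0 addr0.
- move=> x y /cK xc /cK yc; have [x'c xx] := phif xc; have [y'c yy] := phif yc.
  apply: ext; [exact: left_convM|exact: left_convM|].
  have h := congr1 (fun z : op => z (coef y)) (implements_push xc).
  rewrite !bopE_M in h; rewrite !bopE_M (pushes_uniq yy (pushes_push f_inj _)) h.
  exact: pushes_push.
- apply: ext; [exact: left_conv1|exact: left_conv1|rewrite !bopE_1].
  have := pushes_push f_inj (delta 1%g : H); by rewrite push_delta f1.
- move=> x /cK xc; have [x'c [xi xo]] := phif xc.
  apply: ext; [exact: left_conv_adj|exact: left_conv_adj|split=> g].
    by rewrite !coef_adj // -fV xi.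
  move=> ng; rewrite coef_adj // xo ?rmorph0 // => t e; apply: (ng t^-1%g).
  by rewrite fV e invgK.
- by move=> x /cK xc; have [_ [/(_ 1%g)]] := phif xc; rewrite f1 !trE.
- move=> x y /cK xc /cK yc e; have [_ xx] := phif xc; have [_ yy] := phif yc.
  by apply: left_conv_ext => //; apply: pushes_inj xx _; rewrite e.
Qed.

(** The preimage of [y] is its compression to the families supported on the image
    of [f]. *)
Lemma implements_image K : subgroup_set K ->
  phi @` gvN K = gvN [set f g | g in K].
Proof.
move=> sK; have sfK : subgroup_set [set f g | g in K].
  split; first by exists 1%g => //; exact: sK.1.
  by move=> _ _ [g Kg <-] [h Kh <-]; exists (g * h^-1)%g; [exact: sK.2|rewrite fM fV].
apply/seteqP; split=> [_ [x xK <-]|y /(gvNP _ sfK)[yc yK]].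
  by apply: (rv_sub (implements_rv sK sfK _)) => // g Kg; exists g.
pose x : op := pull R f_inj * y * push R f_inj.
have xc : lconv x.
  apply/left_convP => s u; rewrite !bopE_M push_rreg.
  by rewrite (left_convP y).1 // pull_rreg.
have xE g : coef x g = coef y (f g) by rewrite !bopE_M push_delta f1 pullE.
exists x.
  apply/(gvNP _ sK); split => // g nKg; rewrite xE yK // => -[h Kh /f_inj hg].
  by apply: nKg; rewrite -hg.
have [zc xz] := phif xc; apply: left_conv_ext => //; apply: pushes_uniq xz _.
split=> [g|g ng]; first by rewrite xE.
by apply: yK => -[h _ hg]; case: (ng h).
Qed.

End Spec.
End Homomorphism.

(** * Strong limits of inner automorphisms *)

Lemma ell2_cvgP (a : nat -> H) (l : H) : a @ \oo --> l <->
  forall e : R, 0 < e -> \forall n \near \oo, N (l - a n) < e.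
Proof.
split=> [/cvgrPdist_lt al e e0|al].
  have := al e%:C; rewrite ltcR => /(_ e0); apply: filterS => n.
  by rewrite ell2_norm_normr ltcR.
apply/cvgrPdist_lt => e /complex_gt0P[r r0 ->]; apply: filterS (al r r0) => n.
by rewrite ell2_norm_normr ltcR.
Qed.

Lemma sot_lim_dense (A : nat -> op) (B : op) (c : R) : 0 <= c ->
  (forall n u, N (A n u) <= c * N u) ->
  (forall g, (fun n => A n (delta g)) @ \oo --> B (delta g)) -> sot_lim A B.
Proof.
move=> c0 Ac AB u; have [d d0 Bd] := bop_bounded B.
move: u; apply: ell2_dense_ind => [|a g v Av|u uP].
- rewrite bop_0; have -> : (fun n => A n 0) = (fun n => 0 : H).
    by apply/funext => n; rewrite bop_0.
  exact: cvg_cst.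
- rewrite bop_lin; have -> : (fun n => A n (a *: delta g + v)) =
      (fun n => a *: A n (delta g) + A n v).
    by apply/funext => n; rewrite bop_lin.
  exact: (cvgD (cvgZl_tmp (AB g)) Av).
apply/ell2_cvgP => e e0; pose K := c + d + 1.
have K0 : 0 < K by rewrite /K; lra.
have e3 : 0 < e / 2 / K by rewrite !divr_gt0.
have [v /ell2_cvgP Av uv] := uP _ e3.
have e2 : 0 < e / 2 by rewrite divr_gt0.
apply: filterS (Av _ e2) => n lt.
have -> : B u - A n u = B (u - v) + (B v - A n v) - A n (u - v).
  by rewrite !bop_B opprB !addrA !subrK.
apply: le_lt_trans (ell2_normD _ _) _; rewrite ell2_normN.
apply: (@le_lt_trans _ _ (N (B (u - v)) + N (B v - A n v) + N (A n (u - v)))).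
  by rewrite lerD2r ell2_normD.
have h1 := Bd (u - v); have h2 := Ac n (u - v); have h3 := ell2_norm_ge0 (u - v).
have : N (u - v) * K < e / 2 by rewrite -ltr_pdivlMr.
rewrite /K; nra.
Qed.

Lemma sot_lim_unique (A : nat -> op) (B C : op) : sot_lim A B -> sot_lim A C -> B = C.
Proof.
move=> AB AC; apply: bopP => u.
exact: (cvg_unique (@norm_hausdorff _ H) (AB u) (AC u)).
Qed.

Lemma conj_inj s : injective (fun t => s * t * s^-1)%g.
Proof. by move=> t t' /mulIg/mulgI. Qed.

Lemma conj_morph s t t' : (s * (t * t') * s^-1 = (s * t * s^-1) * (s * t' * s^-1))%g.
Proof. by rewrite !mulgA mulgVK. Qed.

Lemma lreg_isometry s u : N (lreg R s u) = N u.
Proof. by rewrite /ell2_norm /= energy_lreg. Qed.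

(** On coefficients the inner automorphisms are isometries that permute the
    canonical basis, and they converge on each basis vector; so they converge
    strongly.  Right translations carry the convergence from [delta 1] to the
    other basis vectors. *)
Lemma sot_lim_Ad (c : nat -> G) f x y : injective f ->
  (forall g h, f (g * h)%g = (f g * f h)%g) -> lconv x -> lconv y ->
  pushes f (coef x) (coef y) ->
  (forall t, \forall n \near \oo, (c n * t * (c n)^-1)%g = f t) ->
  sot_lim (fun n => Ad (lreg R (c n)) x) y.
Proof.
move=> f_inj fM xc yc xy cf.
have push_lim : sot_lim (fun n => push R (@conj_inj (c n))) (push R f_inj).
  apply: (@sot_lim_dense _ _ 1) => // [n u|g]; first by rewrite mul1r push_norm.
  apply: cvg_near_cst; apply: filterS (cf g) => n e.
  by rewrite !push_delta // e.
have [d d0 xd] := bop_bounded x.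
apply: (@sot_lim_dense _ _ d); first exact: ltW.
  by move=> n u; rewrite /Ad !bopE_M lregV lreg_isometry (le_trans (xd _)) // lreg_isometry.
move=> g; rewrite (left_conv_delta _ yc).
have -> : coef y = push R f_inj (coef x) by exact: pushes_uniq xy (pushes_push _ _).
have -> : (fun n => Ad (lreg R (c n)) x (delta g)) =
    (fun n => rreg R g^-1%g (push R (@conj_inj (c n)) (coef x))).
  apply/funext => n; have [zc xz] := implements_Ad (c n) xc.
  rewrite (left_conv_delta _ zc); congr (rreg R _ _).
  exact: pushes_uniq xz (pushes_push _ _).
exact: (continuous_cvg _ (@bop_continuous _ _ (rreg R g^-1%g) _) (push_lim (coef x))).
Qed.

End Implements.

(** * Conditional expectations onto subgroup algebras *)

Lemma complex_ge0_closed (R : realType) (z : R[i]) :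
  (forall e : R, 0 < e -> exists2 w : R[i], 0 <= w & normc (z - w) <= e) -> 0 <= z.
Proof.
have nRe (a b : R) : `|a| <= normc (a +i* b).
  by rewrite -sqrtr_sqr ler_wsqrtr // lerDl sqr_ge0.
have nIm (a b : R) : `|b| <= normc (a +i* b).
  by rewrite -sqrtr_sqr ler_wsqrtr // lerDr sqr_ge0.
case: z => a b zw; rewrite lecE /=; apply/andP; split.
  rewrite -normr_le0; apply/ler_addgt0Pl => e e0; rewrite addr0.
  have [[c d]] := zw e e0; rewrite lecE /= => /andP[/eqP d0 _].
  apply: le_trans; apply: le_trans (nIm (a - c) _); by rewrite d0 subr0.
rewrite -oppr_le0; apply/ler_addgt0Pl => e e0; rewrite addr0.
have [[c d]] := zw e e0; rewrite lecE /= => /andP[_ c0].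
move=> /(le_trans (nRe (a - c) (b - d))); rewrite ler_norml => /andP[]; lra.
Qed.

Section ConditionalExpectation.
Variables (R : realType) (G : groupType).
Local Notation H := (ell2 R G).
Local Notation N := (@ell2_norm R G).
Local Notation op := (bop R G).
Local Notation coef x := ((x : op) (delta 1%g)).
Local Notation lconv := (@left_conv R G).
Implicit Types (u v w : H) (x y z : op) (s t g h k : G) (K L : set G).

Definition expect K (x : op) : op :=
  xget (0 : op) [set y | lconv y /\ coef y = cproj R K (coef x)].

Lemma dot_cproj A u v : dot (cproj R A u) v = dot u (cproj R A v).
Proof.
apply: dot_eq; apply: is_sum_eq (is_sum_dot u (cproj R A v)) _ (erefl _) => g.
by rewrite !cprojE; case: asboolP => // _; rewrite rmorph0 mulr0 mul0r.
Qed.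

Lemma dotBr u v w : dot u (v - w) = dot u v - dot u w.
Proof. by rewrite dotC dotBl rmorphB /= -!dotC. Qed.

Section Positivity.
Variables (K : set G) (sK : subgroup_set K) (x : op).
Hypothesis xc : lconv x.

Let id_inj : injective (@id G). Proof. by []. Qed.
Let idM (g h : G) : id (g * h)%g = (id g * id h)%g. Proof. by []. Qed.

Let y := block_op id_inj idM sK xc.

Lemma expect_block : expect K x = y.
Proof.
have yc : lconv y by exact: block_op_conv.
have yE : coef y = cproj R K (coef x).
  apply/esym/pushes_uniq; first exact: pushes_id.
  exact: block_op_coef.
apply: xget_unique => // z [zc zE]; apply: left_conv_ext => //.
by rewrite zE yE.
Qed.

Let coset h := block_coset (@id G) K h.

Let KV t : K t -> K t^-1%g.
Proof. by move=> Kt; rewrite -[t^-1%g]mul1g; apply: sK.2 => //; exact: sK.1. Qed.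

Let KM s t : K s -> K t -> K (s * t)%g.
Proof. by move=> Ks Kt; rewrite -[t]invgK; apply: sK.2 => //; exact: KV. Qed.

Let coset_mul h g k : K k -> coset h (k * g)%g <-> coset h g.
Proof.
move=> Kk; split=> -[j Kj /= e].
  exists (k^-1 * j)%g; first by apply: KM => //; exact: KV.
  by rewrite -mulgA [X in (_ * X)%g]e mulKg.
by exists (k * j)%g; [exact: KM|rewrite -mulgA e].
Qed.

Let expect_coset h u : y (cproj R (coset h) u) = cproj R (coset h) (y u).
Proof.
apply: ell2P => g; rewrite cprojE !block_opE; case: asboolP => gh.
  congr (x _ _); apply: ell2P => k; rewrite !block_sliceE cprojE.
  case: asboolP => // Kk; case: asboolP => // n; case: n.
  exact/coset_mul.
rewrite (_ : block_slice _ _ _ _ = 0) ?bop_0 //; apply: ell2P => k.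
rewrite !block_sliceE cprojE; case: asboolP => // Kk; case: asboolP => // n.
by case: gh; exact/(coset_mul _ _ Kk).
Qed.

(** On a family supported on one coset the expectation is a compression of [x]. *)
Let expect_compress h u :
  y (cproj R (coset h) u) = cproj R (coset h) (x (cproj R (coset h) u)).
Proof.
apply: ell2P => g; rewrite cprojE; case: asboolP => gh; last first.
  by rewrite expect_coset cprojE asboolF.
rewrite block_opE; have -> : block_slice K id_inj g (cproj R (coset h) u) =
    rreg R g (cproj R (coset h) u).
  apply: ell2P => k; rewrite block_sliceE rregE; case: asboolP => // nKk.
  rewrite cprojE; case: asboolP => // -[j Kj e]; case: nKk.
  have [i Ki /= ig] := gh; have -> : k = (j * i^-1)%g; last exact: sK.2.
  apply: (mulIg i); rewrite mulgVK; apply: (mulIg h).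
  by rewrite -mulgA ig -e.
by rewrite (left_convP x).1 // rregE mul1g.
Qed.

Let expect_split h u : dot (y u) u =
  dot (x (cproj R (coset h) u)) (cproj R (coset h) u) +
  dot (y (u - cproj R (coset h) u)) (u - cproj R (coset h) u).
Proof.
set c := cproj R (coset h).
have cc v : c (c v) = c v.
  by rewrite /c cproj_cproj setIid.
have e1 : dot (x (c u)) (c u) = dot (y u) (c u).
  transitivity (dot (x (c u)) (c (c u))); first by rewrite cc.
  by rewrite /c -dot_cproj -expect_compress expect_coset dot_cproj -/c cc.
have e2 : dot (y (c u)) (u - c u) = 0.
  rewrite expect_coset dot_cproj -/c bop_B cc subrr dotC dot0l rmorph0 //.
rewrite e1 bop_B dotBl e2 subr0 -dotDr addrC subrK //.
Qed.

Let expect_positive_fin (xp : positive x) (s : seq G) u :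
  (forall g, g \notin s -> u g = 0) -> 0 <= dot (y u) u.
Proof.
elim: s u => [|h s IH] u us.
  have -> : u = 0 by apply: ell2P => g; rewrite us.
  by rewrite bop_0 dot0l.
rewrite (expect_split h) addr_ge0 //; apply: IH => g gs.
rewrite ell2B cprojE; case: asboolP => [_|ng]; first by rewrite subrr.
rewrite subr0 us // inE negb_or gs andbT; apply/eqP => gh; apply: ng.
by rewrite gh; exists 1%g; [exact: sK.1|rewrite /= mul1g].
Qed.

(** A finitely supported family splits into its parts on finitely many cosets,
    between which the expectation has no matrix entries; on each coset
    [expect_compress] applies. *)
Lemma expect_positive : positive x -> positive (expect K x).
Proof.
move=> xp u; rewrite expect_block; apply: complex_ge0_closed => e e0.
have [c c0 yc] := bop_bounded y.
pose M := 8 * c * N u + 1.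
have Nu := ell2_norm_ge0 u.
have M0 : 0 < M by rewrite /M ltr_wpDl // !mulr_ge0 // ltW.
have [F uF] := ell2_tail u (divr_gt0 e0 M0).
set v := coord_proj [set` F] u.
exists (dot (y v) v).
  apply: (@expect_positive_fin xp (enum_fset F)) => g gF.
  by rewrite coord_projE asboolb (negbTE gF).
have -> : dot (y u) u - dot (y v) v = dot (y u) (u - v) + dot (y (u - v)) v.
  by rewrite bop_B dotBl dotBr addrA subrK.
apply: le_trans (normcD_le _ _) _.
have h1 := dot_bound (y u) (u - v); have h2 := dot_bound (y (u - v)) v.
have yu := yc u; have yuv := yc (u - v).
have uv : N (u - v) < e / M by exact: uF.
have vu : N v <= N u by exact: coord_proj_norm_le.
have N0 := ell2_norm_ge0 (u - v); have Nv := ell2_norm_ge0 v.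
apply: (@le_trans _ _ (N (u - v) * M)); last by rewrite -ler_pdivlMr // ltW.
apply: (@le_trans _ _ (4 * (c * N u) * N (u - v) + 4 * (c * N (u - v)) * N u)).
  apply: lerD.
    by apply: le_trans h1 _; rewrite ler_wpM2r // ler_wpM2l.
  apply: le_trans h2 _; apply: ler_pM => //; first by rewrite mulr_ge0 ?ell2_norm_ge0.
  by rewrite ler_wpM2l.
rewrite /M; lra.
Qed.

End Positivity.

Lemma expectP K x : subgroup_set K -> lconv x ->
  lconv (expect K x) /\ coef (expect K x) = cproj R K (coef x).
Proof.
move=> sK xc; rewrite (expect_block sK xc); split; first exact: block_op_conv.
by apply/esym/pushes_uniq; [exact: pushes_id|exact: block_op_coef].
Qed.

Lemma cproj_rreg K g u : subgroup_set K -> K g ->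
  cproj R K (rreg R g u) = rreg R g (cproj R K u).
Proof.
move=> [K1 KM] Kg; apply: ell2P => h; rewrite rregE !cprojE rregE.
congr (if _ then _ else _); apply/asboolP/asboolP => Kh.
  have -> : (h * g = h * (1 * g^-1)^-1)%g by rewrite mul1g invgK.
  by do 2 apply: (KM) => //.
by rewrite -(mulgK g h); exact: KM.
Qed.

(** The case of the coset [K] itself, in operator form; the bimodule property is
    a consequence, as the elements of [L(K)] commute with the projection. *)
Lemma expect_cproj K x : subgroup_set K -> lconv x ->
  expect K x * cproj R K = cproj R K * x * cproj R K.
Proof.
move=> sK xc; have [yc yE] := expectP sK xc; apply: bop_ext => g; rewrite !bopE_M.
have [Kg|nKg] := pselect (K g); last first.
  have -> : cproj R K (delta g) = 0.
    apply: ell2P => h; rewrite cprojE deltaE.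
    by case: asboolP => // Kh; case: eqP => // hg; case: nKg; rewrite -hg.
  by rewrite !bop_0.
have -> : cproj R K (delta g) = delta g.
  by apply: cproj_id => h nKh; rewrite deltaE; case: eqP => // hg; case: nKh; rewrite hg.
have KgV : K g^-1%g by rewrite -[g^-1%g]mul1g; apply: sK.2 => //; exact: sK.1.
by rewrite (left_conv_delta _ yc) (left_conv_delta _ xc) yE cproj_rreg.
Qed.

Lemma gvN_cproj K a : subgroup_set K -> gvN K a -> a * cproj R K = cproj R K * a.
Proof.
move=> sK /(gvNP _ sK)[ac aK]; apply: (left_conv_commute ac aK) => s Ks.
by rewrite cproj_lreg.
Qed.

Lemma cond_exp_expect K : subgroup_set K ->
  cond_exp (@gvN R G [set: G]) (@gvN R G K) (expect K).
Proof.
move=> sK; have EP := expectP sK; rewrite gvNT.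
have BP b : gvN K b -> lconv b /\ cproj R K (coef b) = coef b.
  by move=> /(gvNP _ sK)[bc bK]; split => //; exact: cproj_id.
split.
- move=> x /EP[yc yE]; apply/(gvNP _ sK); split => // g nKg.
  by rewrite yE cprojE asboolF.
- move=> c x y xc yc; have [zc zE] := EP _ (left_conv_lin c xc yc).
  have [x'c xE] := EP _ xc; have [y'c yE] := EP _ yc.
  apply: left_conv_ext => //; first exact: left_conv_lin.
  by rewrite zE bopE_D bopE_Z bop_lin bopE_D bopE_Z xE yE.
- move=> b /BP[bc bE]; have [b'c b'E] := EP _ bc.
  by apply: left_conv_ext => //; rewrite b'E bE.
- move=> a x b aK xc bK; have [ac aE] := BP _ aK; have [bc bE] := BP _ bK.
  have axbc : lconv (a * x * b) by do 2 apply: left_convM => //.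
  have [zc zE] := EP _ axbc; have [yc yE] := EP _ xc.
  apply: left_conv_ext => //; first by do 2 apply: left_convM => //.
  rewrite zE !bopE_M -[in RHS]bE.
  have /(congr1 (fun z : op => z (coef b))) := expect_cproj sK xc.
  rewrite !bopE_M => ->; rewrite bE.
  have /(congr1 (fun z : op => z (x (coef b)))) := gvN_cproj sK aK.
  by rewrite !bopE_M => ->.
- by move=> x xc; exact: expect_positive.
- move=> x xc; have [yc yE] := EP _ xc.
  by rewrite !trE yE cprojE asboolT //; exact: sK.1.
Qed.

(** The conditional expectations restrict the coefficients to the subgroups. *)
Lemma commuting_square_gvN (A B C D : set G) :
  subgroup_set A -> subgroup_set B -> subgroup_set C -> subgroup_set D ->
  A `<=` B -> D `<=` B -> D `&` A = C ->
  commuting_square (@gvN R G [set: G]) (gvN A) (gvN B) (gvN C) (gvN D).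
Proof.
move=> sA sB sC sD AB DB DAC; split.
- by split; exact: gvN_vonNeumann.
- by split; exact: gvN_vonNeumann.
- by split; apply: gvN_sub => //; rewrite -DAC => g [].
exists (expect D), (expect A), (expect C); split; [exact: cond_exp_expect..|].
rewrite gvNT => x xc; have [yc yE] := expectP sA xc.
have [zc zE] := expectP sD yc; have [wc wE] := expectP sC xc.
by apply: left_conv_ext => //; rewrite zE yE wE cproj_cproj DAC.
Qed.

(** * Algebras generated by subgroup algebras *)

Lemma gvN_unit_subgroup (M : set op) : vonNeumann M ->
  subgroup_set [set g | M (lreg R g)].
Proof.
move=> vM; split; first by rewrite /= lreg_one; exact: vonNeumann1.
move=> g h /= gM hM; rewrite lreg_mul; apply: vonNeumannM => //.
by rewrite -lregV; exact: vM.1.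
Qed.

Lemma vN_gen_bigcup_gvN (I : set nat) (K : nat -> set G) (S : nat -> G) :
  (forall i, K i = gen_group [set S i]) ->
  vN_gen (\bigcup_(i in I) @gvN R G (K i)) = gvN (gen_group [set S i | i in I]).
Proof.
move=> KE; apply/seteqP; split.
  apply: vN_gen_min; first exact/gvN_vonNeumann/gen_group_subgroup.
  move=> x [i Ii]; apply: gvN_sub; rewrite KE; apply: gen_group_min.
    exact: gen_group_subgroup.
  by move=> _ ->; apply: gen_group_sub; exists i.
move=> x xI M [vM IM]; apply: xI; split => // _ [g gI <-]; move: g gI.
apply: (@gen_group_min _ _ [set g | M (lreg R g)]); first exact: gvN_unit_subgroup.
move=> _ [i Ii <-]; apply: IM; exists i => //; apply: gvN_lreg.
by rewrite KE; exact: gen_group_sub.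
Qed.

Lemma gvN_independent K L x y : subgroup_set K -> subgroup_set L ->
  (forall g, K g -> L g -> g = 1%g) -> gvN K x -> gvN L y -> tr (x * y) = tr x * tr y.
Proof.
move=> sK sL KL /(gvNP _ sK)[xc xK] /(gvNP _ sL)[yc yL].
apply: tr_factor => // g /eqP g1.
have [Kg|] := pselect (K g); last by left; exact: xK.
right; apply: yL => LgV; apply: g1; apply: KL => //.
by rewrite -[g]invgK -[g^-1^-1%g]mul1g; apply: sL.2 => //; exact: sL.1.
Qed.

(** Otherwise the energy of [u] would exceed every multiple of the square of the
    modulus of [a]. *)
Lemma ell2_infinite_orbit u (t : nat -> G) (a : R[i]) : injective t ->
  (forall n, u (t n) = a) -> a = 0.
Proof.
move=> t_inj ut; apply/Normc.eq0_normc/eqP; rewrite -sqrf_eq0; apply/eqP.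
apply/eqP; rewrite eq_le sqr_ge0 andbT leNgt; apply/negP => a0.
pose n := Num.bound (N u ^+ 2 / normc a ^+ 2).
have : (n.+1)%:R * normc a ^+ 2 <= N u ^+ 2.
  pose F := [fset t (val i) | i in 'I_n.+1]%fset.
  apply: (@le_trans _ _ (N (coord_proj [set` F] u) ^+ 2)); last first.
    by rewrite ler_pXn2r ?nnegrE ?ell2_norm_ge0 // coord_proj_norm_le.
  rewrite ell2_norm_fset big_imfset /=; last by move=> i j _ _ /t_inj/val_inj.
  under eq_bigr do rewrite ut.
  rewrite big_enum /= sumr_const card_ord mulr_natl //.
rewrite -ler_pdivlMr // leNgt => /negP; apply.
apply: lt_trans (archi_boundP _) _; first by rewrite divr_ge0 ?sqr_ge0.
by rewrite ltr_nat.
Qed.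

End ConditionalExpectation.

(** * The shifted inverse representation *)

Section BraidAlgebra.
Variable R : realType.
Local Notation op := (bop R braid).
Local Notation coef x := ((x : op) (delta 1%g)).
Local Notation lconv := (@left_conv R braid).
Implicit Types (x y : op) (s t g h : braid).

Lemma LB_ooE : LB_oo R = lconv. Proof. exact: gvNT. Qed.

Lemma Bn_subgroup n : subgroup_set (Bn n).
Proof. exact: gen_group_subgroup. Qed.

Lemma Ad_Ad s t x : Ad (lreg R s) (Ad (lreg R t) x) = Ad (lreg R (s * t)%g) x.
Proof. by rewrite /Ad lreg_mul adjM !mulrA. Qed.

Lemma Ad_one x : Ad (lreg R (1 : braid)%g) x = x.
Proof. by rewrite /Ad lreg_one adj_one mulr1 mul1r. Qed.

Lemma Ad_mul s x y : Ad (lreg R s) (x * y) = Ad (lreg R s) x * Ad (lreg R s) y.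
Proof.
rewrite /Ad !mulrA -[_ * adj _ * lreg R s]mulrA lregV -lreg_mul mulVg lreg_one.
by rewrite mulr1.
Qed.

Lemma Ad_lreg s t : Ad (lreg R s) (lreg R t) = lreg R (s * t * s^-1)%g.
Proof. by rewrite /Ad lregV -!lreg_mul. Qed.

Lemma representation_rho1_inv : representation (LB_oo R) (rho1_inv R).
Proof.
split=> [s|s t x xM]; last by rewrite /rho1_inv Ad_Ad invM shM.
split.
  apply: (implements_rv (@conj_inj _ (sh (Defs.inv s))) (@conj_morph _ _)) => //.
  exact: implements_Ad.
move=> y; rewrite LB_ooE => yM; exists (Ad (lreg R (sh (Defs.inv s))^-1%g) y).
  exact: left_conv_Ad.
by rewrite /rho1_inv Ad_Ad mulgV Ad_one.
Qed.

(** * Fixed points *)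

Lemma Bn_oo_comm n s g : Bn n g -> Bn_oo n s ->
  (sh (Defs.inv s) * g = g * sh (Defs.inv s))%g.
Proof.
move=> gn; move: s; apply: (@gen_group_min _ _ [set s | (sh (Defs.inv s) * g = g * sh (Defs.inv s))%g]).
  split=> [|s t /= sg tg]; first by rewrite /= inv1g sh1g mul1g mulg1.
  by rewrite invM braid_invV shM shV -mulgA -commVg // mulgA sg mulgA.
move=> _ [k /= /andP[k0 nk] <-]; rewrite inv_sigma shV sh_sigma //.
exact/esym/commVg/(Bn_sigma_comm gn).
Qed.

Lemma Bn_oo1 s : Bn_oo 1 s.
Proof.
have Bk k : Bn_oo 1 (sigma k.+1) by apply: gen_group_sub; exists k.+1.
elim/braid_ind: s => [|k s|k s]; first exact: gen_group1.
  by move=> s1; apply: gen_groupM s1; exact: Bk.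
by move=> s1; apply: gen_groupM s1; apply: gen_groupV; exact: Bk.
Qed.

Lemma rho1_inv_fix n s x : Bn_oo n s -> LB R n x -> rho1_inv R s x = x.
Proof.
move=> sn /(gvNP _ (Bn_subgroup n))[xc xn].
apply: (implements_eq (d := id) (psi := id) _ (implements_Ad _) _ _ xc xn) => //.
  exact: implements_id.
by move=> g gn; rewrite (Bn_oo_comm gn sn) mulgK.
Qed.

(** The coefficients of a fixed point are constant on conjugation orbits, which are
    infinite off [Bn n]. *)
Lemma fixed_points_rho1_inv n (S : set braid) : (0 < n)%N -> Bn_oo n `<=` S ->
  (forall s x, S s -> LB R n x -> rho1_inv R s x = x) ->
  fixed_points (LB_oo R) (rho1_inv R) S = LB R n.
Proof.
move=> n0 nS Sfix; apply/seteqP; split=> x; last first.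
  move=> xn; split; last by move=> s Ss; exact: Sfix.
  exact: (@gvN_sub R braid (Bn n)).
rewrite /fixed_points LB_ooE => -[xc xS]; apply/(gvNP _ (Bn_subgroup n)).
split => // t nt; have [c [cn c_inj]] := infinite_orbit n0 nt.
apply: (ell2_infinite_orbit (u := coef x) c_inj) => j.
have [s sn ce] := Bn_oo_sh_inv n0 (cn j).
have /(congr1 (fun y : op => coef y (c j * t * (c j)^-1)%g)) := xS s (nS _ sn).
rewrite /rho1_inv -ce Ad_lreg_coef // => <-.
by rewrite !mulgA mulgVK mulVg mul1g.
Qed.

Lemma generating_rho1_inv : generating_property (rho1_inv R).
Proof.
apply/seteqP; split.
  have vL : vonNeumann (LB_oo R) by exact/gvN_vonNeumann/subgroup_setT.
  apply: (vN_gen_min vL).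
  by move=> x [n _ []].
move=> x xM M [vM FM]; apply: xM; split => // _ [g _ <-].
have [n gn] := Bn_exists g; apply: FM; exists n => //; split.
  exact: gvN_lreg.
move=> s sn; apply: (@rho1_inv_fix n.+1) => //.
apply: gvN_lreg; exact: Bn_mono gn.
Qed.

Lemma LB1 : LB R 1 = @scalars R braid.
Proof.
rewrite -gvN1 /LB; congr gvN; apply/seteqP; split=> g; first exact: Bn1.
by move=> ->; exact: gen_group1.
Qed.

(** * The endomorphism beta *)

(** The limit in the definition of [beta], given in advance. *)
Let beta_block x (xc : lconv x) := block_op sh1_inj sh1M (@subgroup_setT braid) xc.

Let beta_block_spec x (xc : lconv x) :
  lconv (beta_block xc) /\ pushes sh1 (coef x) (coef (beta_block xc)).
Proof.
split; first exact: block_op_conv.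
have := block_op_coef sh1_inj sh1M (@subgroup_setT braid) xc.
by rewrite (cproj_id (u := coef x)) // => i [].
Qed.

Let sot_lim_shift (c : nat -> braid) x (xc : lconv x) :
  (forall t, \forall n \near \oo, (c n * t * (c n)^-1)%g = sh1 t) ->
  sot_lim (fun n => Ad (lreg R (c n)) x) (beta_block xc).
Proof.
move=> ct; have [yc xy] := beta_block_spec xc.
exact: (sot_lim_Ad sh1_inj sh1M xc yc xy ct).
Qed.

(** On the braids with a given number of strands both sequences of conjugations are
    eventually equal to [sh1]. *)
Lemma beta_limits x : lconv x ->
  sot_lim (fun n => rho1_inv R (\prod_(1 <= i < n.+1) sigma i)%g x) (beta R x) /\
  sot_lim (fun n => rho R (\prod_(2 <= i < n.+1) (sigma i)^-1)%g x) (beta R x) /\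
  lconv (beta R x) /\ pushes sh1 (coef x) (coef (beta R x)).
Proof.
move=> xc.
have l1 : sot_lim (fun n => rho1_inv R (\prod_(1 <= i < n.+1) sigma i)%g x) (beta_block xc).
  apply: sot_lim_shift => t; have [N tN] := Bn_exists t; exists N => // n /= Nn.
  rewrite -/(coxeter n) sh_inv_coxeter -sh1_conj //.
  by apply: Bn_mono tN; exact: leqW.
have -> : beta R x = beta_block xc.
  by apply: xget_unique => // y ly; exact: sot_lim_unique ly l1.
split; first exact: l1.
split; last exact: beta_block_spec.
apply: sot_lim_shift => t; have [N tN] := Bn_exists t; exists N.+1 => // -[//|n] /= Nn.
by rewrite prod_sigmaV -sh1_conj //; apply: Bn_mono tN; exact: leqW.
Qed.

Lemma beta_implements : implements (beta R) sh1.
Proof. by move=> x /beta_limits[_ [_]]. Qed.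

Lemma iter_sh1_inj n : injective (iter n sh1).
Proof. by elim: n => // n IH x y /sh1_inj/IH. Qed.

Lemma iter_sh1M n g h : iter n sh1 (g * h)%g = (iter n sh1 g * iter n sh1 h)%g.
Proof. by elim: n => // n IH; rewrite !iterS IH sh1M. Qed.

Lemma iota_implements n : implements (iota_beta R n) (iter n sh1).
Proof. exact/implements_iter/beta_implements. Qed.

Lemma beta_endomorphism : endomorphism (LB_oo R) (beta R).
Proof. exact: (implements_rv sh1_inj sh1M beta_implements). Qed.

Lemma iota_lreg n t : iota_beta R n (lreg R t) = lreg R (iter n sh1 t).
Proof.
have [yc ty] := iota_implements n (@left_conv_lreg R braid t).
apply: left_conv_ext => //; first exact: left_conv_lreg.
apply: pushes_uniq ty _; rewrite !lreg_delta !mulg1 -(@push_delta R braid _ (@iter_sh1_inj n)).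
exact: pushes_push.
Qed.

Lemma iota_gvN n (K : set braid) : subgroup_set K ->
  iota_beta R n @` gvN K = gvN [set iter n sh1 g | g in K].
Proof.
exact: (implements_image (@iter_sh1_inj n) (@iter_sh1M n) (@iota_implements n)).
Qed.

Lemma iter_sh1_1 n : iter n sh1 1%g = 1%g.
Proof. by elim: n => // n IH; rewrite iterS IH sh1_1. Qed.

Lemma iter_sh1_subgroup n (K : set braid) : subgroup_set K ->
  subgroup_set [set iter n sh1 g | g in K].
Proof.
move=> [K1 KM]; split; first by exists 1%g => //; exact: iter_sh1_1.
move=> _ _ [g Kg <-] [h Kh <-]; exists (g * h^-1)%g; first exact: KM.
by rewrite iter_sh1M (homV (iter_sh1_1 n) (iter_sh1M n)).
Qed.

(** * The triangular tower *)

Lemma towerE k m : (k <= m)%N ->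
  tower R k m = gvN [set iter k sh1 g | g in Bn (m - k).+1].
Proof.
move=> km; rewrite /tower; case: eqP => [->|_]; last first.
  exact/iota_gvN/Bn_subgroup.
rewrite subnn -gvN1; congr gvN; apply/seteqP; split=> [_ ->|_ [g /Bn1 -> <-]].
  by exists 1%g; [exact: gen_group1|exact: iter_sh1_1].
exact: iter_sh1_1.
Qed.

Lemma tower_ooE k : tower_oo R k = gvN [set iter k sh1 g | g in [set: braid]].
Proof. exact/iota_gvN/subgroup_setT. Qed.

(** By [sh1_Bn_inv] only braids on [n + 1] strands are mapped into [Bn n.+2] by
    [sh1]. *)
Lemma tower_meet k n (S : set braid) : Bn n.+1 `<=` S ->
  [set iter k.+1 sh1 g | g in S] `&` [set iter k sh1 g | g in Bn n.+2] =
  [set iter k.+1 sh1 g | g in Bn n.+1].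
Proof.
move=> nS; apply/seteqP; split=> [_ [[g _ <-] [h hn]]|_ [g gn <-]].
  rewrite iterSr => /iter_sh1_inj hg; exists g; last by rewrite iterSr.
  by apply: sh1_Bn_inv => //; rewrite -hg.
split; first by exists g => //; exact: nS.
by exists (sh1 g); [exact: sh1_Bn|rewrite iterSr].
Qed.

Lemma commuting_cells k m : (k < m)%N ->
  commuting_square (LB_oo R) (tower R k m) (tower R k m.+1)
                             (tower R k.+1 m) (tower R k.+1 m.+1) /\
  commuting_square (LB_oo R) (tower R k m) (tower_oo R k)
                             (tower R k.+1 m) (tower_oo R k.+1).
Proof.
move=> km; rewrite !tower_ooE !towerE //; [|by lia..].
have [n ->] : exists n, m = (k + n).+1 by exists (m - k.+1)%N; lia.
have -> : ((k + n).+1 - k = n.+1)%N by lia.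
have -> : ((k + n).+2 - k = n.+2)%N by lia.
have -> : ((k + n).+1 - k.+1 = n)%N by lia.
have -> : ((k + n).+2 - k.+1 = n.+1)%N by lia.
have sub (S : set braid) : subgroup_set S ->
    forall j, subgroup_set [set iter j sh1 g | g in S].
  by move=> sS j; exact: iter_sh1_subgroup.
have mono (S T : set braid) j : S `<=` T ->
    [set iter j sh1 g | g in S] `<=` [set iter j sh1 g | g in T].
  by move=> ST _ [g Sg <-]; exists g => //; exact: ST.
split; apply: commuting_square_gvN; try by apply: sub; exact: Bn_subgroup.
- by apply: mono; exact: Bn_mono.
- move=> _ [g gn <-]; exists (sh1 g); last by rewrite iterSr.
  exact: sh1_Bn.
- by apply: tower_meet; exact: Bn_mono.
- exact/sub/subgroup_setT.
- exact/sub/subgroup_setT.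
- exact: mono.
- by move=> _ [g _ <-]; exists (sh1 g) => //; rewrite iterSr.
- exact: tower_meet.
Qed.

(** * The random sequence *)

Lemma Bn2_hom_eq (f d : braid -> braid) : f 1%g = 1%g ->
  (forall g h, f (g * h)%g = (f g * f h)%g) -> d 1%g = 1%g ->
  (forall g h, d (g * h)%g = (d g * d h)%g) -> f (sigma 1) = d (sigma 1) ->
  forall g, Bn 2 g -> f g = d g.
Proof.
move=> f1 fM d1 dM fd; apply: eq_gen_group_hom => // _ [k /= k2 <-].
by have -> : k = 1%N by lia.
Qed.

Lemma Ad_iota g m m' x : (g * star m * g^-1)%g = star m' -> LB R 2 x ->
  Ad (lreg R g) (iota_beta R m x) = iota_beta R m' x.
Proof.
move=> gm /(gvNP _ (Bn_subgroup 2))[xc x2].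
have comp := implements_comp (implements_Ad g) (@iota_implements m).
apply: (implements_eq (@iter_sh1_inj m') comp (@iota_implements m') _ xc x2).
apply: Bn2_hom_eq => //=.
- by rewrite iter_sh1_1 mulg1 mulgV.
- by move=> s t; rewrite iter_sh1M conj_morph.
- exact: iter_sh1_1.
- exact: iter_sh1M.
Qed.

Lemma iota_random_variable n : nc_random_variable (LB R 2) (LB_oo R) (iota_beta R n).
Proof.
apply: (implements_rv (@iter_sh1_inj n) (@iter_sh1M n) (@iota_implements n)) => //.
exact: Bn_subgroup.
Qed.

Lemma iota_braidable : braidable (LB R 2) (iota_beta R).
Proof.
exists (rho1_inv R); split; first exact: representation_rho1_inv.
  move=> n x x2 _; apply/esym/Ad_iota => //.
  elim: n => [|n IH].
    by rewrite big_ord0 inv1g sh1g mul1g invg1 mulg1.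
  have -> : (\prod_(i < n.+1) sigma (n.+1 - i) =
      sigma n.+1 * \prod_(i < n) sigma (n - i))%g by rewrite big_ord_recl.
  by rewrite invM shM conjM IH inv_sigma shV sh_sigma // invgK star_next.
move=> n x n2 x2; apply: (@rho1_inv_fix 2) => //.
by apply: gen_group_sub; exists n => //=; lia.
Qed.

Lemma moment_Ad n (j j' : 'I_n -> nat) g (a : 'I_n -> op) :
  (forall k, g * star (j k) * g^-1 = star (j' k))%g -> (forall k, LB R 2 (a k)) ->
  moment (iota_beta R) j a = moment (iota_beta R) j' a.
Proof.
move=> gj a2; rewrite /moment.
have -> : \prod_(k < n) iota_beta R (j' k) (a k) =
    Ad (lreg R g) (\prod_(k < n) iota_beta R (j k) (a k)).
  rewrite (big_morph _ (Ad_mul g) (_ : _ = 1)).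
    by apply: eq_bigr => k _; apply/esym/Ad_iota.
  by rewrite -lreg_one Ad_lreg mulg1 mulgV.
rewrite !trE Ad_lreg_coef; first by rewrite mulg1 mulVg.
elim/big_ind: _ => [|x y|k _]; [exact: left_conv1|exact: left_convM|].
by have := rv_sub (iota_random_variable (j k)) (a2 k); rewrite LB_ooE.
Qed.

(** [d] is a nondecreasing function of [j], so it extends to a nondecreasing [D] on
    all indices, and [shift_star] makes the change from [j] to [j + d] inner. *)
Lemma moment_expand n (j d : 'I_n -> nat) (a : 'I_n -> op) :
  (forall k l, (j k <= j l)%N -> (d k <= d l)%N) -> (forall k, LB R 2 (a k)) ->
  moment (iota_beta R) j a = moment (iota_beta R) (fun k => j k + d k)%N a.
Proof.
move=> jd a2; pose D (m : nat) := \max_(k < n | (j k <= m)%N) d k.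
have Dmono : {homo D : x y / (x <= y)%N}.
  move=> x y xy; apply/bigmax_leqP => k kx.
  by apply: (@leq_bigmax_cond _ _ d k); exact: leq_trans kx xy.
have DE k : D (j k) = d k.
  apply/eqP; rewrite eqn_leq; apply/andP; split.
    by apply/bigmax_leqP => l; exact: jd.
  exact: (@leq_bigmax_cond _ _ d k).
have [g hg] := shift_star (\max_(k < n) j k).+1 Dmono.
apply: (@moment_Ad _ _ _ g) => // k; rewrite hg ?DE // ltnS.
exact: leq_bigmax.
Qed.

(** Both index functions can be expanded to their sum. *)
Lemma iota_spreadable : spreadable (LB R 2) (iota_beta R).
Proof.
move=> n i j p _ pj ij a a2.
have le k l : (j k <= j l)%N = (i k <= i l)%N.
  rewrite (leqNgt (j k)) (leqNgt (i k)) !ij; congr (~~ _).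
  apply/idP/idP => [|lt]; first exact: pj.
  have [//|kl|e] := ltngtP (j l) (j k); last by rewrite e ltnn in lt.
  by have := ltn_trans lt (pj _ _ kl); rewrite ltnn.
have ej : moment (iota_beta R) j a = moment (iota_beta R) (fun k => j k + i k)%N a.
  by apply: moment_expand a2 => k l; rewrite le.
have ei : moment (iota_beta R) i a = moment (iota_beta R) (fun k => i k + j k)%N a.
  by apply: moment_expand a2 => k l; rewrite le.
rewrite ej ei; congr (moment _ _ _); apply/funext => k; exact: addnC.
Qed.

Lemma iota_star n : iota_beta R n @` LB R 2 = gvN (gen_group [set star n]).
Proof.
rewrite iota_gvN; last exact: Bn_subgroup.
have sK := iter_sh1_subgroup n (Bn_subgroup 2).
congr gvN; apply/seteqP; split=> [_ [g g2 <-]|].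
  apply: (gen_group_hom (iter_sh1_1 n) (iter_sh1M n) _ _ g2).
    exact: gen_group_subgroup.
  move=> _ [k /= k2 <-]; have -> : k = 1%N by lia.
  exact: gen_group_sub.
apply: gen_group_min => // _ ->; exists (sigma 1) => //.
exact: Bn_sigma.
Qed.

Lemma vN_gen_iota (I : set nat) :
  vN_gen (\bigcup_(i in I) (iota_beta R i @` LB R 2)) = gvN (star_group I).
Proof.
rewrite -(@vN_gen_bigcup_gvN _ _ I (fun i => gen_group [set star i])) //.
by congr vN_gen; apply: eq_bigcupr => i _; exact: iota_star.
Qed.

Lemma iota_full_independent : full_independent (fun n => iota_beta R n @` LB R 2).
Proof.
move=> I J IJ x y; rewrite !vN_gen_iota; apply: gvN_independent.
- exact: gen_group_subgroup.
- exact: gen_group_subgroup.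
- by move=> g; exact: star_group_disjoint.
Qed.

Lemma beta_full_Bernoulli : full_Bernoulli_shift (beta R) (LB R 2).
Proof.
split; last exact: iota_full_independent.
rewrite (vN_gen_iota setT); apply: (implements_rv sh1_inj sh1M beta_implements).
- exact: gen_group_subgroup.
- exact: gen_group_subgroup.
apply: gen_group_hom; [exact: sh1_1|exact: sh1M|exact: gen_group_subgroup|].
by move=> _ [n _ <-]; apply: gen_group_sub; exists n.+1.
Qed.

(** The first component of a letter is the time at which the operator is taken; it
    enters the moment as the index of [iota_beta]. *)
Definition letter_op (l : nat * bool) : op :=
  lreg R (if l.2 then (sigma 1)^-1 else sigma 1)%g.

Lemma letter_op_LB l : LB R 2 (letter_op l).
Proof.
apply: gvN_lreg; case: l.2; last exact: Bn_sigma.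
by apply: gen_groupV; exact: Bn_sigma.
Qed.

Lemma iota_letter l : iota_beta R l.1 (letter_op l) = lreg R (letter_val l).
Proof.
rewrite iota_lreg /letter_val; case: l.2 => //; congr lreg.
exact: (homV (iter_sh1_1 _) (iter_sh1M _)).
Qed.

Lemma tr_lreg g : tr (lreg R g) = (g == 1%g)%:R.
Proof. by rewrite trE lreg_delta mulg1 deltaE eq_sym. Qed.

Lemma moment_letters (s : seq (nat * bool)) (p : nat -> nat) :
  moment (iota_beta R) (fun k : 'I_(size s) => p (tnth (in_tuple s) k).1)
    (fun k => letter_op (tnth (in_tuple s) k)) =
  ((\prod_(l <- [seq (p l.1, l.2) | l <- s]) letter_val l)%g == 1%g)%:R.
Proof.
rewrite -tr_lreg /moment; congr tr.
rewrite (big_morph _ (@lreg_mul R braid) (@lreg_one R braid)) big_map big_tnth.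
by apply: eq_bigr => k _; rewrite -iota_letter.
Qed.

Lemma iota_not_exchangeable : ~ exchangeable (LB R 2) (iota_beta R).
Proof.
move=> /(_ _ (fun k : 'I_(size asym_word) => swap01 (tnth (in_tuple asym_word) k).1)
  (fun k => (tnth (in_tuple asym_word) k).1) swap01).
have sw : finite_perm swap01.
  split; first by exists swap01 => -[|[|]].
  by exists 2%N => -[|[|]].
move=> /(_ sw (fun=> erefl) (fun k => letter_op (tnth (in_tuple asym_word) k))).
move=> /(_ (fun k => letter_op_LB _)).
rewrite (moment_letters asym_word swap01) (moment_letters asym_word id).
have -> : [seq (id l.1, l.2) | l <- asym_word] = asym_word by [].
rewrite asym_word_val eqxx; case: eqP => [/asym_word_swap_val//|_ /eqP].
by rewrite eq_sym oner_eq0.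
Qed.

End BraidAlgebra.

Theorem theorem5p9 (R : realType) :
  representation (LB_oo R) (rho1_inv R) /\
  (* (i) *)
  generating_property (rho1_inv R) /\
  (* (ii) *)
  fixed_points (LB_oo R) (rho1_inv R) [set: braid] = @scalars R braid /\
  (* (iii) *)
  (forall n : nat,
    fixed_points (LB_oo R) (rho1_inv R) (Bn_oo n.+2) = LB R n.+2) /\
  (* (iv) *)
  ((forall x, LB_oo R x ->
      sot_lim (fun n => rho1_inv R (\prod_(1 <= i < n.+1) sigma i)%g x)
              (beta R x) /\
      sot_lim (fun n => rho R (\prod_(2 <= i < n.+1) (sigma i)^-1)%g x)
              (beta R x)) /\
   endomorphism (LB_oo R) (beta R) /\
   (forall t : braid, beta R (lreg R t) = lreg R (sh1 t))) /\
  (* (v) *)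
  (forall k m : nat, (k < m)%N ->
    commuting_square (LB_oo R) (tower R k m) (tower R k m.+1)
                               (tower R k.+1 m) (tower R k.+1 m.+1) /\
    commuting_square (LB_oo R) (tower R k m) (tower_oo R k)
                               (tower R k.+1 m) (tower_oo R k.+1)) /\
  (* (vi) *)
  ((forall n : nat, nc_random_variable (LB R 2) (LB_oo R) (iota_beta R n)) /\
   braidable (LB R 2) (iota_beta R) /\
   spreadable (LB R 2) (iota_beta R) /\
   full_independent (fun n : nat => iota_beta R n @` LB R 2) /\
   full_Bernoulli_shift (beta R) (LB R 2)) /\
  (* (vii) *)
  ~ exchangeable (LB R 2) (iota_beta R).
Proof.
split; first exact: representation_rho1_inv.
split; first exact: generating_rho1_inv.
split.
  rewrite -LB1; apply: fixed_points_rho1_inv => // s x _.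
  exact: (rho1_inv_fix (@Bn_oo1 s)).
split.
  by move=> n; apply: fixed_points_rho1_inv => // s x; exact: rho1_inv_fix.
split.
  split; first by rewrite LB_ooE => x /beta_limits[l1 [l2 _]].
  by split; [exact: beta_endomorphism|exact: (iota_lreg R 1)].
split; first exact: commuting_cells.
split; last exact: iota_not_exchangeable.
split; first exact: iota_random_variable.
split; first exact: iota_braidable.
split; first exact: iota_spreadable.
split; first exact: iota_full_independent.
exact: beta_full_Bernoulli.
Qed.
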